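(* Let $k$ be a field of characteristic $0$. For any associative unital $k$-algebra $A$, there is an isomorphism (of graded $k$-vector spaces) $$\mathrm{HS}_*(A)\ \cong\ \mathrm H_*(B(D,T,A),k),$$ where $B(D,T,A)$ is the two-sided bar construction associated to the monad $D$ of the $E_\infty$-operad in simplicial $k$-modules corresponding to the Barratt–Eccles operad, and $T$ is the tensor algebra functor on $k$-modules.
   Context: **The bar construction.** For a simplicial $k$-module $V$, $DV=\bigoplus_{n\ge0}k[E_*\Sigma_n^{\rm op}]\otimes_{k[\Sigma_n]}V^{\otimes n}$, where $\Sigma_n$ is the $n$-th symmetric group and $E_*\Sigma_n$ is the standard contractible free simplicial $\Sigma_n$-set with $p$-simplices $\Sigma_n^{p+1}$; $D$ is the monad of the operad $\{k[E_*\Sigma_n^{\rm op}]\}_{n\ge0}$. $T$ is the tensor algebra monad $TV=\bigoplus_{n\ge 0}V^{\otimes n}$; the inclusion of $\Sigma_n$ as the $0$-simplices of $E_*\Sigma_n$ gives a map of monads $T\to D$, making $D$ a right $T$-functor. An associative algebra $A$ is a $T$-algebra. $B_*(D,T,A)$ is the two-sided simplicial bar construction with $B_p(D,T,A)=D\,T^p A$, $B(D,T,A)$ is its geometric realization (diagonal), and $\mathrm H_*(B(D,T,A),k)$ denotes the homology of the chain complex of $k$-modules associated to it. **Symmetric category.** $\Delta S$ has objects $[n]=\{0,1,\dots,n\}$, $n\ge 0$. A morphism $f:[n]\to[m]$ is an ordered tuple $f=X_0\otimes X_1\otimes\cdots\otimes X_m$ of noncommutative (possibly empty) monomials in formal variables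 $x_0,\dots,x_n$ such that each variable occurs exactly once in total (equivalently: a map of sets with a total order on each fibre). Composition is substitution: if $g=Y_0\otimes\cdots\otimes Y_l:[m]\to[l]$ in variables $y_0,\dots,y_m$, then $g\circ f$ is obtained by substituting $y_i=X_i$. **Symmetric homology.** For an associative unital $k$-algebra $A$, $B_{\rm sym}A:\Delta S\to \mathrm{Mod}_k$ is the functor $[n]\mapsto A^{\otimes(n+1)}$, where $f=X_0\otimes\cdots\otimes X_m$ sends $a_0\otimes\cdots\otimes a_n$ to the tensor obtained by substituting $x_i=a_i$ (empty monomial $=1_A$). Then $\mathrm{HS}_*(A):=\mathrm{Tor}^{\Delta S}_*(k,B_{\rm sym}A)=H_*(k\otimes^{\boldsymbol L}_{\Delta S}B_{\rm sym}A)$, where $k$ is the constant contravariant functor and $\otimes_{\Delta S}$ is the functor tensor product. *)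

(* Defs.v *)
From HB Require Import structures.
From mathcomp Require Import all_boot all_algebra.
From mathcomp Require Import finmap boolp.
From mathcomp Require Import monalg.

Set Implicit Arguments.
Unset Strict Implicit.
Unset Printing Implicit Defensive.

Import GRing.Theory.
Local Open Scope ring_scope.

(* The quotient of V by the subspace spanned by R. *)
Section QuotientModule.
Variables (k : fieldType) (V : lmodType k) (R : V -> Prop).

Definition spanned : {pred V} := fun x =>
  `[< forall S : V -> Prop, S 0 ->
        (forall a u v, S u -> S v -> S (a *: u + v)) ->
        (forall r, R r -> S r) -> S x >].

Lemma spannedZD a u v : u \in spanned -> v \in spanned -> a *: u + v \in spanned.
Proof.
move=> /asboolP su /asboolP sv; apply/asboolP => S S0 SD SR.
by apply: (SD); [apply: su | apply: sv].
Qed.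

Lemma spanned0 : 0 \in spanned.
Proof. by apply/asboolP => S S0. Qed.

Lemma sub_spanned r : R r -> r \in spanned.
Proof. by move=> Rr; apply/asboolP => S _ _ SR; apply: SR. Qed.

Lemma spanned_closed : zmod_closed spanned.
Proof.
split=> [|x y sx sy]; first exact: spanned0.
by rewrite addrC -scaleN1r; apply: spannedZD.
Qed.

HB.instance Definition _ := GRing.isZmodClosed.Build V spanned spanned_closed.

Definition quotmod : Type := Quotient.quot spanned.
HB.instance Definition _ := GRing.Zmodule.on quotmod.
HB.instance Definition _ := Choice.on quotmod.

Definition qpi (x : V) : quotmod := (\pi_(Quotient.quot spanned) x)%qT.
Definition qrepr (y : quotmod) : V := repr (y : Quotient.quot spanned).

Lemma qreprK y : qpi (qrepr y) = y.
Proof. exact: reprK. Qed.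

Lemma qpiP x y : qpi x = qpi y <-> x - y \in spanned.
Proof.
by rewrite Quotient.idealrBE; split=> [/eqP|/eqP].
Qed.

Lemma qpiB : {morph qpi : x y / x - y}.
Proof. by move=> x y; rewrite /qpi !raddfB. Qed.

Lemma qpiD : {morph qpi : x y / x + y}.
Proof. by move=> x y; rewrite /qpi !raddfD. Qed.

Definition qscale (a : k) (y : quotmod) : quotmod := qpi (a *: qrepr y).

Lemma qpiZ a x : qpi (a *: x) = qscale a (qpi x).
Proof.
apply/qpiP; rewrite -scalerBr -[_ *: _]addr0; apply: spannedZD (spanned0).
by apply/qpiP; rewrite qreprK.
Qed.

Lemma qscaleA a b y : qscale a (qscale b y) = qscale (a * b) y.
Proof. by rewrite -[y]qreprK -!qpiZ scalerA. Qed.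
Lemma qscale1 : left_id 1 qscale.
Proof. by move=> y; rewrite -[y]qreprK -!qpiZ scale1r. Qed.
Lemma qscaleDr : right_distributive qscale +%R.
Proof.
move=> a x y; rewrite -[x]qreprK -[y]qreprK -[X in qscale a X]qpiD.
by rewrite -!qpiZ -[RHS]qpiD scalerDr.
Qed.
Lemma qscaleDl y : {morph qscale^~ y : a b / a + b}.
Proof. by move=> a b; rewrite -[y]qreprK -!qpiZ -[RHS]qpiD scalerDl. Qed.

HB.instance Definition _ :=
  GRing.Zmodule_isLmodule.Build k quotmod qscaleA qscale1 qscaleDr qscaleDl.

Lemma qpi_is_linear : linear qpi.
Proof. by move=> a x y; rewrite qpiD qpiZ. Qed.
HB.instance Definition _ := GRing.isLinear.Build k V quotmod _ qpi qpi_is_linear.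

Lemma qpi_rel r : R r -> qpi r = 0.
Proof.
by move=> Rr; rewrite -[0](linear0 qpi); apply/qpiP; rewrite subr0 sub_spanned.
Qed.

Section Lift.
Variables (W : lmodType k) (f : {linear V -> W}).

Definition qlift of (forall r, R r -> f r = 0) : quotmod -> W :=
  fun y => f (qrepr y).

Variable fR : forall r, R r -> f r = 0.

Lemma spanned_kernel x : x \in spanned -> f x = 0.
Proof.
move=> /asboolP sx; apply: (sx (fun v => f v = 0)); first exact: linear0.
- by move=> a u v fu fv; rewrite linearP fu fv scaler0 addr0.
- exact: fR.
Qed.

Lemma qliftE x : qlift fR (qpi x) = f x.
Proof.
apply/eqP; rewrite -subr_eq0 -linearB spanned_kernel //.
by apply/qpiP; rewrite qreprK.
Qed.

Lemma qlift_is_linear : linear (qlift fR).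
Proof.
move=> a x y; rewrite -[x]qreprK -[y]qreprK -linearP !qliftE.
exact: linearP.
Qed.
HB.instance Definition _ :=
  GRing.isLinear.Build k quotmod W _ (qlift fR) qlift_is_linear.
End Lift.
End QuotientModule.

Section Homology.
Variables (k : fieldType).

Section Kernel.
Variables (V W : lmodType k) (g : {linear V -> W}).
Definition in_kernel : {pred V} := fun x => g x == 0.
Lemma in_kernel_closed : submod_closed in_kernel.
Proof.
split=> [|a x y]; rewrite !unfold_in /in_kernel ?linear0 // linearP.
by move=> /eqP-> /eqP->; rewrite scaler0 addr0.
Qed.
HB.instance Definition _ :=
  GRing.isSubmodClosed.Build k V in_kernel in_kernel_closed.

Record kernel := Kernel { kernel_val : V; _ : kernel_val \in in_kernel }.
HB.instance Definition _ := [isSub for kernel_val].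
HB.instance Definition _ := [Choice of kernel by <:].
HB.instance Definition _ := [SubChoice_isSubLmodule of kernel by <:].
End Kernel.

Definition homology_at (U V W : lmodType k) (f : {linear U -> V})
    (g : {linear V -> W}) : lmodType k :=
  quotmod (fun z : kernel g => exists y, kernel_val z = f y).

(* The homology of ... -> C 2 -> C 1 -> C 0 -> 0. *)
Definition homology (C : nat -> lmodType k)
    (d : forall n, {linear C n.+1 -> C n}) (n : nat) : lmodType k :=
  match n with
  | 0 => homology_at (d 0) (\0 : {linear C 0 -> C 0})
  | m.+1 => homology_at (d m.+1) (d m)
  end.
End Homology.

(* k[X] is {malg k[X]}, with basis vectors << x >>. *)
Section Presented.
Variables (k : fieldType) (X : choiceType).

Section LinearExtension.
Variables (W : lmodType k) (f : X -> W).
Definition linext (u : {malg k[X]}) : W := \sum_(x <- msupp u) u@_x *: f x.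

Lemma linextEw (u : {malg k[X]}) (D : {fset X}) :
  (msupp u `<=` D)%fset -> linext u = \sum_(x <- D) u@_x *: f x.
Proof.
move=> uD; rewrite /linext; apply: big_fset_incl => // x _ xu.
by rewrite mcoeff_outdom ?scale0r.
Qed.

Lemma linext_is_linear : linear linext.
Proof.
move=> a u v; pose D := (msupp u `|` msupp v)%fset.
have uD : (msupp u `<=` D)%fset by apply: fsubsetUl.
have vD : (msupp v `<=` D)%fset by apply: fsubsetUr.
rewrite (linextEw uD) (linextEw vD) (@linextEw _ D); last first.
  apply: fsubset_trans (msuppD_le _ _) _.
  by rewrite fsubUset vD andbT (fsubset_trans (msuppZ_le _ _)).
rewrite scaler_sumr -big_split; apply: eq_bigr => x _ /=.
by rewrite mcoeffD mcoeffZ scalerDl scalerA.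
Qed.
HB.instance Definition _ :=
  GRing.isLinear.Build k {malg k[X]} W _ linext linext_is_linear.

Lemma linextU x : linext << x >> = f x.
Proof.
rewrite (@linextEw _ [fset x]%fset) ?msuppU_le // big_seq_fset1.
by rewrite mcoeffUU scale1r.
Qed.
End LinearExtension.

Lemma linear_malg_eq (W : lmodType k) (f g : {linear {malg k[X]} -> W}) :
  (forall x, f << x >> = g << x >>) -> f =1 g.
Proof.
move=> fg u; rewrite [u]monalgE !linear_sum; apply: eq_bigr => x _.
have -> : << u@_x *g x >> = u@_x *: << x >> :> {malg k[X]}.
  by apply/malgP => y; rewrite mcoeffZ !mcoeffU mulrnAr mulr1.
by rewrite !linearZ fg.
Qed.

(* The vector space with generators X and relators R. *)
Variable R : {malg k[X]} -> Prop.
Definition presented : lmodType k := quotmod R.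
Definition gen (x : X) : presented := qpi R << x >>.

Section PresentedLift.
Variables (W : lmodType k) (f : X -> W).
Definition plift (fR : forall r, R r -> linext f r = 0) :
  {linear presented -> W} := qlift fR.

Lemma pliftE fR x : plift fR (gen x) = f x.
Proof. by apply: etrans (qliftE fR << x >>) (linextU f x). Qed.
End PresentedLift.

Lemma linear_presented_eq (W : lmodType k) (f g : {linear presented -> W}) :
  (forall x, f (gen x) = g (gen x)) -> f =1 g.
Proof.
move=> fg y; rewrite -[y]qreprK.
by apply: (@linear_malg_eq W (f \o qpi R) (g \o qpi R)).
Qed.
End Presented.

(* Multilinear extension: a function g of words in the generators of a
   presented vector space is extended to words of elements of that space.
   The value does not depend on the choice of representatives as soon as g
   vanishes on relators in each slot (mlext_slot). *)
Section MultilinearExtension.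
Variables (k : fieldType) (X : choiceType) (W : lmodType k).

Fixpoint mlext_free (us : seq {malg k[X]}) (g : seq X -> W) : W :=
  if us is u :: us' then
    linext (fun x => mlext_free us' (fun xs => g (x :: xs))) u
  else g [::].

Definition mlext (R : {malg k[X]} -> Prop) (ys : seq (presented R))
    (g : seq X -> W) : W :=
  mlext_free [seq qrepr y | y <- ys] g.

Lemma eq_linext (f f' : X -> W) u : f =1 f' -> linext f u = linext f' u.
Proof. by move=> ff; apply: eq_bigr => x _; rewrite ff. Qed.

Lemma linext0 u : linext (fun _ : X => 0 : W) u = 0.
Proof. by apply: big1 => x _; rewrite scaler0. Qed.

Lemma linext_swap (Y : choiceType) (F : X -> Y -> W) u v :
  linext (fun x => linext (F x) v) u =
  linext (fun y => linext (fun x => F x y) u) v.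
Proof.
rewrite /linext; under eq_bigr => x _ do rewrite scaler_sumr.
rewrite exchange_big /=; apply: eq_bigr => y _.
by rewrite scaler_sumr; apply: eq_bigr => x _; rewrite !scalerA mulrC.
Qed.

Lemma eq_mlext_free us g g' :
  (forall xs, size xs = size us -> g xs = g' xs) ->
  mlext_free us g = mlext_free us g'.
Proof.
elim: us g g' => [|u us IH] g g' gg /=; first exact: gg.
by apply: eq_linext => x; apply: IH => xs sxs; apply: gg; rewrite /= sxs.
Qed.

Lemma mlext_free0 us : mlext_free us (fun _ => 0) = 0.
Proof.
elim: us => //= u us IH.
by rewrite (eq_linext _ (f' := fun _ => 0)) ?linext0.
Qed.

Lemma mlext_free_linext (Y : choiceType) us (g : seq X -> Y -> W) u :
  mlext_free us (fun xs => linext (g xs) u) =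
  linext (fun y => mlext_free us (g^~ y)) u.
Proof.
elim: us g => //= v us IH g; rewrite -linext_swap.
by apply: eq_linext => x; rewrite IH.
Qed.

Lemma mlext_free_basis xs g : mlext_free [seq << x >> | x <- xs] g = g xs.
Proof. by elim: xs g => //= x xs IH g; rewrite linextU IH. Qed.

Lemma mlext_free_slot us u vs g :
  mlext_free (us ++ u :: vs) g =
  linext (fun x => mlext_free (us ++ << x >> :: vs) g) u.
Proof.
elim: us g => [|w us IH] g /=.
  by apply: eq_linext => x; rewrite linextU.
by rewrite linext_swap; apply: eq_linext => y; rewrite IH.
Qed.

Definition slot us vs g u := mlext_free (us ++ u :: vs) g.

Lemma slot_is_linear us vs g : linear (slot us vs g).
Proof.
move=> a x y; rewrite /slot !(mlext_free_slot us _ vs).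
exact: linearP.
Qed.
HB.instance Definition _ us vs g :=
  GRing.isLinear.Build k {malg k[X]} W _ (slot us vs g) (slot_is_linear us vs g).

Variable R : {malg k[X]} -> Prop.

Definition kills_relators n (g : seq X -> W) := forall xs ys r,
  size (xs ++ ys) = n -> R r -> linext (fun x => g (xs ++ x :: ys)) r = 0.

Lemma slot_relator us vs g r : kills_relators (size (us ++ vs)) g -> R r ->
  slot us vs g r = 0.
Proof.
move=> + Rr; rewrite /slot.
elim: us g => [|u us IH] g kg /=.
  rewrite -mlext_free_linext -[RHS](mlext_free0 vs); apply: eq_mlext_free.
  by move=> ys sys; apply: (kg [::]) => //=.
rewrite (eq_linext _ (f' := fun _ => 0)) ?linext0 // => x.
by apply: IH => xs ys r' s Rr'; apply: (kg (x :: xs)) => //=; rewrite s.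
Qed.

Lemma mlext_slot (us vs : seq (presented R)) g a x y :
  kills_relators (size (us ++ vs)) g ->
  mlext (us ++ (a *: x + y) :: vs) g =
  a *: mlext (us ++ x :: vs) g + mlext (us ++ y :: vs) g.
Proof.
move=> kg; pose f := slot (map (@qrepr _ _ R) us) (map (@qrepr _ _ R) vs) g.
have fR r : R r -> f r = 0.
  by move=> Rr; apply: slot_relator Rr; rewrite -map_cat size_map.
have E z : mlext (us ++ z :: vs) g = qlift fR z by rewrite /mlext map_cat.
by rewrite !E linearP.
Qed.

Lemma mlext_gen xs g : (forall n, kills_relators n g) ->
  mlext [seq gen R x | x <- xs] g = g xs.
Proof.
move=> kg; rewrite /mlext -map_comp -[RHS]mlext_free_basis.
suff H vs : mlext_free (vs ++ [seq qrepr (gen R x) | x <- xs]) g =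
  mlext_free (vs ++ [seq << x >> | x <- xs]) g by apply: (H [::]).
elim: xs vs => //= x xs IH vs.
have := IH (rcons vs (qrepr (gen R x))); rewrite !cat_rcons => ->.
pose f := slot vs [seq << x >> | x <- xs] g.
have fR r : R r -> f r = 0 by apply: slot_relator.
have := @qliftE _ _ _ _ f fR << x >>; apply: etrans.
by [].
Qed.
End MultilinearExtension.

(* The tensor power V^(tensor n), generated by the symbols v_1 (x) ... (x) v_n. *)
Section TensorPower.
Variables (k : fieldType) (V : lmodType k) (n : nat).

Definition agree_off (i : 'I_n) (t t' : n.-tuple V) :=
  forall j, j != i -> tnth t j = tnth t' j.

Inductive tpow_rel : {malg k[n.-tuple V]} -> Prop :=
  TpowLin (i : 'I_n) (a : k) (t t1 t2 : n.-tuple V) of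
    agree_off i t t1 & agree_off i t t2 &
    tnth t i = a *: tnth t1 i + tnth t2 i :
  tpow_rel (<< t >> - a *: << t1 >> - << t2 >>).

Definition tpow : lmodType k := presented tpow_rel.

Definition multilinear (W : lmodType k) (F : n.-tuple V -> W) :=
  forall (i : 'I_n) (a : k) (t t1 t2 : n.-tuple V),
    agree_off i t t1 -> agree_off i t t2 ->
    tnth t i = a *: tnth t1 i + tnth t2 i -> F t = a *: F t1 + F t2.

Lemma multilinear_rel (W : lmodType k) (F : n.-tuple V -> W) : multilinear F ->
  forall r, tpow_rel r -> linext F r = 0.
Proof.
move=> mF _ [i a t t1 t2 h1 h2 e].
by rewrite !linearB linearZ /= !linextU (mF i a t t1 t2) //= addrAC addrK subrr.
Qed.

Definition tpow_lift (W : lmodType k) (F : n.-tuple V -> W) (mF : multilinear F) :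
  {linear tpow -> W} := plift (multilinear_rel mF).

Lemma tpow_gen_multilinear : multilinear (gen tpow_rel).
Proof.
move=> i a t t1 t2 h1 h2 e; rewrite /gen -linearZ -linearD.
apply/qpiP; rewrite opprD addrA; apply: sub_spanned.
exact: TpowLin h1 h2 e.
Qed.
End TensorPower.

(* T V, generated by the words v_1 ... v_n (n >= 0) in V, so that
   T V is the direct sum of the V^(tensor n). *)
Section TensorAlgebra.
Variable k : fieldType.

Section Def.
Variable V : lmodType k.

Inductive T_rel : {malg k[seq V]} -> Prop :=
  TLin (u w : seq V) (a : k) (x y : V) :
  T_rel (<< u ++ (a *: x + y) :: w >>
         - a *: << u ++ x :: w >> - << u ++ y :: w >>).

Definition T : lmodType k := presented T_rel.

Definition word_multilinear (W : lmodType k) (F : seq V -> W) :=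
  forall u w a x y, F (u ++ (a *: x + y) :: w) =
                    a *: F (u ++ x :: w) + F (u ++ y :: w).

Lemma word_multilinear_rel (W : lmodType k) (F : seq V -> W) :
  word_multilinear F ->
  forall r, T_rel r -> linext F r = 0.
Proof.
move=> mF _ [u w a x y].
by rewrite !linearB linearZ /= !linextU mF /= addrAC addrK subrr.
Qed.

Definition T_lift (W : lmodType k) (F : seq V -> W) (mF : word_multilinear F) :
  {linear T -> W} := plift (word_multilinear_rel mF).

Lemma T_gen_multilinear : word_multilinear (gen T_rel).
Proof.
move=> u w a x y; rewrite /gen -linearZ -linearD.
by apply/qpiP; rewrite opprD addrA; apply: sub_spanned.
Qed.
End Def.

Section Functor.
Variables (V W : lmodType k) (f : {linear V -> W}).
Lemma T_map_subproof : word_multilinear (fun v => gen (@T_rel W) (map f v)).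
Proof.
by move=> u w a x y; rewrite !map_cat /= linearP T_gen_multilinear.
Qed.
Definition T_map : {linear T V -> T W} := T_lift T_map_subproof.
End Functor.

(* The multiplication T T V -> T V of the monad T. *)
Section Mult.
Variable V : lmodType k.
Definition T_concat (cs : seq (seq V)) : T V := gen (@T_rel V) (flatten cs).
Lemma T_concat_relators n : kills_relators (@T_rel V) n T_concat.
Proof.
move=> xs ys r _ [u w a x y]; rewrite !linearB linearZ /= !linextU /T_concat /=.
have E z : flatten (xs ++ (u ++ z :: w) :: ys) =
    (flatten xs ++ u) ++ z :: (w ++ flatten ys).
  by rewrite flatten_cat /= -!catA.
by rewrite !E T_gen_multilinear addrAC addrK subrr.
Qed.
Lemma T_mu_subproof : word_multilinear (fun ys : seq (T V) => mlext ys T_concat).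
Proof. by move=> u w a x y; apply: mlext_slot; apply: T_concat_relators. Qed.
Definition T_mu : {linear T (T V) -> T V} := T_lift T_mu_subproof.
End Mult.
End TensorAlgebra.

(* Associative unital k-algebras. Unlike algType k, this includes the zero
   algebra. *)
Record unitalAlgebra (k : fieldType) := UnitalAlgebra {
  alg_sort :> lmodType k;
  alg_mul : alg_sort -> alg_sort -> alg_sort;
  alg_one : alg_sort;
  alg_mulA : associative alg_mul;
  alg_mul1 : left_id alg_one alg_mul;
  alg_mulr1 : right_id alg_one alg_mul;
  alg_mul_linl : forall a x y z,
    alg_mul (a *: x + y) z = a *: alg_mul x z + alg_mul y z;
  alg_mul_linr : forall a x y z,
    alg_mul z (a *: x + y) = a *: alg_mul z x + alg_mul z y }.

Definition unitalAlgebra_of (k : fieldType) (A : algType k) :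
  unitalAlgebra k :=
  @UnitalAlgebra k A *%R 1 (@mulrA A) (@mul1r A) (@mulr1 A)
    (fun a x y z => etrans (mulrDl (a *: x) y z)
                           (congr1 (+%R^~ (y * z)) (esym (scalerAl a x z))))
    (fun a x y z => etrans (mulrDr z (a *: x) y)
                           (congr1 (+%R^~ (z * y)) (esym (scalerAr a z x)))).

Section AlgebraProduct.
Variables (k : fieldType) (A : unitalAlgebra k).

Definition alg_prod (s : seq A) : A := foldr (@alg_mul k A) (alg_one A) s.

Lemma alg_prod_cat s t : alg_prod (s ++ t) = alg_mul (alg_prod s) (alg_prod t).
Proof.
by elim: s => [|x s IH] /=; rewrite ?alg_mul1 // IH alg_mulA.
Qed.

Lemma alg_prod_flatten ss : alg_prod (flatten ss) = alg_prod (map alg_prod ss).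
Proof. by elim: ss => //= s ss IH; rewrite alg_prod_cat IH. Qed.

Lemma alg_prod_multilinear : word_multilinear alg_prod.
Proof.
move=> u w a x y; rewrite !alg_prod_cat /= alg_mul_linl.
by rewrite alg_mul_linr.
Qed.

(* The T-algebra structure T A -> A. *)
Definition T_action : {linear T A -> A} := T_lift alg_prod_multilinear.
End AlgebraProduct.

(* Permutations of {0, ..., n-1} in one-line notation. *)
Section OneLine.
Definition is_oneline (n : nat) (s : seq nat) := perm_eq s (iota 0 n).

(* The word v_{h(0)} v_{h(1)} ...; for v a permutation this is the
   composite of v with h, h being applied first. *)
Definition reindex (X : Type) (x0 : X) (v : seq X) (h : seq nat) :=
  [seq nth x0 v a | a <- h].

Definition offset (ts : seq (seq nat)) (i : nat) := sumn (take i (map size ts)).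

(* The composition s(t_0, ..., t_{n-1}) of the associative operad: the blocks
   {offset ts i, ...} are listed in the order s, block i in the order t_i. *)
Definition operad_comp (s : seq nat) (ts : seq (seq nat)) : seq nat :=
  flatten [seq [seq (offset ts i + a)%N | a <- nth [::] ts i] | i <- s].

Lemma is_oneline_size n s : is_oneline n s -> size s = n.
Proof. by move/perm_size; rewrite size_iota. Qed.

Lemma is_oneline_lt n s a : is_oneline n s -> a \in s -> (a < n)%N.
Proof. by move/perm_mem->; rewrite mem_iota. Qed.

Lemma is_oneline_iota n : is_oneline n (iota 0 n).
Proof. exact: perm_refl. Qed.

Lemma size_reindex (X : Type) (x0 : X) v h : size (reindex x0 v h) = size h.
Proof. exact: size_map. Qed.

Lemma is_oneline_reindex n h s :
  is_oneline n h -> is_oneline n s -> is_oneline n (reindex 0%N h s).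
Proof.
move=> hh hs; apply: perm_trans (hh).
have {2}-> : h = reindex 0%N h (iota 0 n).
  by rewrite /reindex -(is_oneline_size hh) map_nth_iota0 // take_size.
exact: perm_map.
Qed.

Lemma reindex_slot (X : Type) (x0 : X) (u w : seq X) h :
  is_oneline (size u + size w).+1 h -> exists A B,
    size (A ++ B) = size (u ++ w) /\
    forall x, reindex x0 (u ++ x :: w) h = A ++ x :: B.
Proof.
move=> hh; have ph : size u \in h.
  by rewrite (perm_mem hh) mem_iota add0n ltnS leq_addr.
move: (is_oneline_size hh) (perm_uniq hh); rewrite iota_uniq.
clear hh; case/splitPr: ph => h1 h2 sh uh.
exists (reindex x0 (u ++ x0 :: w) h1), (reindex x0 (u ++ x0 :: w) h2).
split.
  rewrite !size_cat !size_reindex; apply/eqP.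
  by move: sh; rewrite size_cat /= addnS => -[->].
have E x a : a != size u -> nth x0 (u ++ x :: w) a = nth x0 (u ++ x0 :: w) a.
  move=> au; rewrite !nth_cat; case: ltnP => // ua.
  have : (0 < a - size u)%N by rewrite subn_gt0 ltn_neqAle eq_sym au.
  by case: (a - size u)%N.
move: uh; rewrite cat_uniq /= negb_or => /and4P[_ /andP[p1 _] p2 _].
move=> x; rewrite /reindex map_cat /= nth_cat ltnn subnn /=.
congr (_ ++ _ :: _); apply/eq_in_map => a ah; apply: E.
- by apply: contraNneq p1 => <-.
- by apply: contraNneq p2 => <-.
Qed.

Lemma size_operad_comp s ts : is_oneline (size ts) s ->
  size (operad_comp s ts) = size (flatten ts).
Proof.
move=> hs; rewrite !size_flatten /shape -map_comp.
rewrite (eq_map (g := fun i => size (nth [::] ts i))); last first.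
  by move=> i; rewrite /= size_map.
rewrite (perm_sumn (perm_map _ hs)); congr sumn.
by rewrite map_comp map_nth_iota0 // take_size.
Qed.

Lemma operad_comp_iota ts : (forall t, t \in ts -> is_oneline (size t) t) ->
  is_oneline (size (flatten ts)) (operad_comp (iota 0 (size ts)) ts).
Proof.
elim/last_ind: ts => [|ts t IH] hts //.
have ht : is_oneline (size t) t by apply: hts; rewrite mem_rcons inE eqxx.
have {}IH : is_oneline (size (flatten ts)) (operad_comp (iota 0 (size ts)) ts).
  by apply: IH => t' h; apply: hts; rewrite mem_rcons inE h orbT.
rewrite /is_oneline flatten_rcons size_cat iotaD size_rcons -addn1 iotaD.
rewrite /operad_comp map_cat flatten_cat /= cats0; apply: perm_cat.
  apply: perm_trans IH; rewrite /operad_comp.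
  rewrite (_ : map _ _ = [seq [seq (offset ts i + a)%N | a <- nth [::] ts i]
                              | i <- iota 0 (size ts)]) //.
  apply/eq_in_map => i; rewrite mem_iota /= add0n => it.
  rewrite nth_rcons it; apply: eq_map => a; congr addn.
  by rewrite /offset map_rcons -cats1 takel_cat ?size_map ?(ltnW it).
rewrite !add0n nth_rcons ltnn eqxx.
have -> : offset (rcons ts t) (size ts) = size (flatten ts).
  rewrite /offset map_rcons size_flatten -cats1 take_cat size_map ltnn subnn.
  by rewrite take0 cats0.
by rewrite -[X in iota X _]addn0 iotaDl; apply: perm_map.
Qed.

Lemma is_oneline_operad_comp s ts : is_oneline (size ts) s ->
  (forall t, t \in ts -> is_oneline (size t) t) ->
  is_oneline (size (flatten ts)) (operad_comp s ts).
Proof.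
move=> hs hts; apply: perm_trans (operad_comp_iota hts).
by apply: perm_flatten; apply: perm_map.
Qed.
End OneLine.

Section OneLineEquivariance.
Implicit Types (ts : seq (seq nat)).

Lemma offsetS ts i : offset ts i.+1 = (offset ts i + size (nth [::] ts i))%N.
Proof.
rewrite /offset; case: (ltnP i (size ts)) => ti; last first.
  by rewrite !take_oversize ?size_map ?(leqW ti) // nth_default // addn0.
by rewrite (take_nth 0%N) ?size_map // sumn_rcons (nth_map [::]).
Qed.

Lemma leq_offset ts : {homo offset ts : i j / (i <= j)%N}.
Proof.
by apply: homo_leq => [//|j i l|i]; [exact: leq_trans | rewrite offsetS leq_addr].
Qed.

Lemma offset_size ts i : (size ts <= i)%N -> offset ts i = size (flatten ts).
Proof. by move=> ti; rewrite /offset take_oversize ?size_map // size_flatten. Qed.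

Lemma reindex_operad_comp H s s' ts ts' :
  size s = size s' ->
  (forall j, (j < size s)%N ->
     [seq nth 0%N H (offset ts (nth 0%N s j) + a)%N | a <- nth [::] ts (nth 0%N s j)] =
     [seq (offset ts' (nth 0%N s' j) + a)%N | a <- nth [::] ts' (nth 0%N s' j)]) ->
  reindex 0%N H (operad_comp s ts) = operad_comp s' ts'.
Proof.
move=> ss E; rewrite /reindex /operad_comp map_flatten -map_comp; congr flatten.
apply: (eq_from_nth (x0 := [::])); rewrite !size_map // => j js.
rewrite (nth_map 0%N) // (nth_map 0%N) -?ss //= -E // -map_comp.
exact: eq_map.
Qed.

(* h acting on the middle one of three blocks of sizes a, size h, b. *)
Definition block_perm (a : nat) (h : seq nat) (b : nat) :=
  iota 0 a ++ [seq (a + i)%N | i <- h] ++ iota (a + size h) b.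

Lemma nth_block_perm a h b y : (y < a + size h + b)%N ->
  nth 0%N (block_perm a h b) y =
  if (a <= y < a + size h)%N then (a + nth 0 h (y - a))%N else y.
Proof.
move=> yn; rewrite /block_perm !nth_cat size_iota size_map.
case: ltnP => ya /=; first by rewrite nth_iota.
rewrite ltn_subLR //; case: ltnP => yh; first by rewrite (nth_map 0%N) // ltn_subLR.
by rewrite -subnDA nth_iota ?subnKC // ltn_subLR.
Qed.

Lemma is_oneline_block_perm a n h b : is_oneline n h ->
  is_oneline (a + n + b) (block_perm a h b).
Proof.
move=> hh; rewrite /is_oneline !iotaD -catA /block_perm (is_oneline_size hh).
rewrite perm_cat2l perm_cat2r add0n -[X in iota X n]addn0 iotaDl.
exact: perm_map.
Qed.

Lemma reindex_block_perm (X : Type) (x0 : X) (A v B : seq X) h :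
  is_oneline (size v) h ->
  reindex x0 (A ++ v ++ B) (block_perm (size A) h (size B)) =
  A ++ reindex x0 v h ++ B.
Proof.
move=> hh; rewrite /reindex /block_perm !map_cat; congr (_ ++ _ ++ _).
- by rewrite map_nth_iota0 ?size_cat ?leq_addr // take_size_cat.
- rewrite -map_comp; apply/eq_in_map => i ih /=.
  rewrite nth_cat ltnNge leq_addr /= addKn nth_cat.
  by rewrite (is_oneline_lt hh ih).
- rewrite (is_oneline_size hh) map_nth_iota.
    by rewrite catA -size_cat drop_size_cat // take_size.
  by rewrite !size_cat addnA addKn.
Qed.

Lemma operad_comp_block s P t Q h :
  is_oneline (size P + size Q).+1 s ->
  (forall t', t' \in P ++ t :: Q -> is_oneline (size t') t') ->
  is_oneline (size t) h ->
  operad_comp s (P ++ reindex 0%N h t :: Q) =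
  reindex 0%N (block_perm (size (flatten P)) h (size (flatten Q)))
    (operad_comp s (P ++ t :: Q)).
Proof.
move=> hs ht hh; set ts := P ++ t :: Q; symmetry.
have th : size h = size t by exact: is_oneline_size hh.
apply: reindex_operad_comp => // j js; set i := nth 0%N s j.
have it : (i < size ts)%N.
  by rewrite size_cat /= addnS; apply: is_oneline_lt hs (mem_nth _ js).
have eo : offset (P ++ reindex 0%N h t :: Q) i = offset ts i.
  by rewrite /offset /ts !map_cat /= size_reindex.
rewrite eo.
have oP : offset ts (size P) = size (flatten P).
  by rewrite /offset map_cat take_size_cat ?size_map // size_flatten.
have oQ : offset ts (size P).+1 = (size (flatten P) + size h)%N.
  by rewrite offsetS oP nth_cat ltnn subnn /= th.
have tot : size (flatten ts) = (size (flatten P) + size h + size (flatten Q))%N.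
  by rewrite flatten_cat /= !size_cat th addnA.
have lt a : a \in nth [::] ts i -> (offset ts i + a < offset ts i.+1)%N.
  move=> ai; rewrite offsetS ltn_add2l.
  by apply: is_oneline_lt ai; apply: ht; apply: mem_nth.
have ltn a : a \in nth [::] ts i ->
    (offset ts i + a < size (flatten P) + size h + size (flatten Q))%N.
  move=> /lt /leq_trans; apply; rewrite -tot -(offset_size (leqnn (size ts))).
  exact: leq_offset.
case: (ltngtP i (size P)) => iP.
- have -> : nth [::] (P ++ reindex 0%N h t :: Q) i = nth [::] ts i.
    by rewrite !nth_cat iP.
  apply/eq_in_map => a ai; rewrite nth_block_perm ?ltn //.
  rewrite [(size _ <= _)%N]leqNgt -oP.
  by rewrite (leq_trans (lt a ai) (leq_offset _ iP)).
- have -> : nth [::] (P ++ reindex 0%N h t :: Q) i = nth [::] ts i.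
    rewrite !nth_cat ltnNge (ltnW iP) /=.
    by rewrite -subn_gt0 in iP; case: (i - _)%N iP.
  apply/eq_in_map => a ai; rewrite nth_block_perm ?ltn //.
  rewrite [(_ < _ + size h)%N]ltnNge -oQ.
  by rewrite (leq_trans (leq_offset _ iP) (leq_addr _ _)) andbF.
- have E : nth [::] ts i = t by rewrite nth_cat iP ltnn subnn.
  rewrite {1}E nth_cat iP ltnn subnn /= -map_comp.
  apply/eq_in_map => a ai /=; rewrite nth_block_perm; last first.
    by rewrite -iP; apply: ltn; rewrite E.
  rewrite oP leq_addr ltn_add2l addKn th.
  suff -> : (a < size t)%N by [].
  apply: is_oneline_lt ai; apply: ht.
  by rewrite mem_cat inE eqxx orbT.
Qed.

Lemma nth_flatten_offset (X : Type) (x0 : X) (w : seq (seq X)) i a :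
  (a < size (nth [::] w i))%N ->
  nth x0 (flatten w) (sumn (take i (shape w)) + a)%N = nth x0 (nth [::] w i) a.
Proof.
move=> ai; have iw : (i < size w)%N.
  by rewrite ltnNge; apply: contraTN ai => wi; rewrite nth_default.
have ai' : (a < nth 0%N (shape w) i)%N by rewrite (nth_map [::]).
rewrite nth_flatten -/(flatten_index (shape w) i a).
by rewrite flatten_indexKl // flatten_indexKr.
Qed.

Definition permute_blocks (h : seq nat) ts :=
  operad_comp h [seq iota 0 (size t) | t <- ts].

Lemma permute_blocksE h ts : is_oneline (size ts) h ->
  permute_blocks h ts =
  flatten [seq iota (offset ts i) (size (nth [::] ts i)) | i <- h].
Proof.
move=> hh; congr flatten; apply/eq_in_map => i ih.
have it := is_oneline_lt hh ih.
rewrite (nth_map [::]) // -iotaDl addn0; congr iota.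
rewrite /offset -map_comp; congr (sumn (take _ _)).
by apply: eq_map => t /=; rewrite size_iota.
Qed.

Lemma is_oneline_permute_blocks h ts : is_oneline (size ts) h ->
  is_oneline (size (flatten ts)) (permute_blocks h ts).
Proof.
move=> hh; set ts' := [seq iota 0 (size t) | t <- ts].
have -> : size (flatten ts) = size (flatten ts').
  rewrite !size_flatten; congr sumn; rewrite /shape -map_comp.
  by apply: eq_map => t /=; rewrite size_iota.
apply: is_oneline_operad_comp; first by rewrite size_map.
by move=> _ /mapP[t _ ->]; rewrite size_iota is_oneline_iota.
Qed.

Lemma reindex_permute_blocks (X : Type) (x0 : X) (w : seq (seq X)) h ts :
  is_oneline (size ts) h -> shape w = map size ts ->
  reindex x0 (flatten w) (permute_blocks h ts) = flatten (reindex [::] w h).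
Proof.
move=> hh sw; rewrite permute_blocksE // /reindex map_flatten -map_comp.
congr flatten; apply/eq_in_map => i ih /=.
have it := is_oneline_lt hh ih.
have iw : (i < size w)%N by rewrite -(size_map size) -/(shape w) sw size_map.
have si : size (nth [::] w i) = size (nth [::] ts i).
  by rewrite -!(nth_map _ 0%N) // -/(shape w) sw.
rewrite -[offset ts i]addn0 iotaDl -map_comp -si.
rewrite -[RHS](take_size) -[RHS](map_nth_iota0 x0) //.
apply/eq_in_map => a; rewrite mem_iota add0n /= => ai.
by rewrite /offset -sw nth_flatten_offset.
Qed.

Lemma operad_comp_permute_blocks s h ts :
  is_oneline (size ts) s -> is_oneline (size ts) h ->
  (forall t, t \in ts -> is_oneline (size t) t) ->
  operad_comp (reindex 0%N h s) ts =
  reindex 0%N (permute_blocks h ts) (operad_comp s (reindex [::] ts h)).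
Proof.
move=> hs hh ht; symmetry; apply: reindex_operad_comp.
  by rewrite size_reindex.
move=> j js; rewrite [nth 0%N (reindex _ _ _) j](nth_map 0%N) //.
set i := nth 0%N s j.
have it : (i < size ts)%N by apply: is_oneline_lt hs (mem_nth _ js).
have ih : (i < size h)%N by rewrite (is_oneline_size hh).
have hit : (nth 0%N h i < size ts)%N by apply: is_oneline_lt hh (mem_nth _ ih).
rewrite [nth [::] (reindex _ _ _) i](nth_map 0%N) //; apply/eq_in_map => a ai.
have alt : (a < size (nth [::] ts (nth 0%N h i)))%N.
  by apply: is_oneline_lt ai; apply: ht; apply: mem_nth.
pose B := [seq iota (offset ts i) (size (nth [::] ts i)) | i <- h].
have Bi : nth [::] B i = iota (offset ts (nth 0%N h i)) (size (nth [::] ts (nth 0%N h i))).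
  by rewrite (nth_map 0%N).
have -> : offset (reindex [::] ts h) i = sumn (take i (shape B)).
  rewrite /offset /shape -!map_comp; congr (sumn (take _ _)).
  by apply: eq_map => b /=; rewrite size_iota.
have aB : (a < size (nth [::] B i))%N by rewrite Bi size_iota.
by rewrite permute_blocksE // (nth_flatten_offset 0%N aB) Bi nth_iota.
Qed.
End OneLineEquivariance.

Section ReindexExtension.
Variables (k : fieldType) (X : choiceType) (x0 : X) (W : lmodType k).

Lemma mlext_free_reindex (us : seq {malg k[X]}) h (g : seq X -> W) :
  is_oneline (size us) h ->
  mlext_free (reindex 0 us h) g = mlext_free us (fun xs => g (reindex x0 xs h)).
Proof.
move=> hh; pose n := size us.
suff H xs vs : size (xs ++ map (fun=> x0) vs) = n ->
    mlext_free (reindex 0 ([seq << x >> | x <- xs] ++ vs) h) g =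
    mlext_free ([seq << x >> | x <- xs] ++ vs) (fun xs => g (reindex x0 xs h)).
  by apply: (H [::] us); rewrite /= size_map.
elim: vs xs => [|v vs IH] xs; rewrite size_cat /= ?size_map => sxs.
  rewrite !cats0 mlext_free_basis.
  have -> : reindex 0 [seq << x >> | x <- xs] h =
            [seq << x >> | x <- reindex x0 xs h] :> seq {malg k[X]}.
    rewrite /reindex -map_comp; apply/eq_in_map => a ah /=.
    by rewrite (nth_map x0) // -[size xs]addn0 sxs (is_oneline_lt hh ah).
  by rewrite mlext_free_basis.
have hs : is_oneline (size [seq << x >> : {malg k[X]} | x <- xs] + size vs).+1 h.
  by rewrite size_map -addnS sxs.
have [A [B [_ E]]] := reindex_slot 0 hs.
rewrite E; apply: (linear_malg_eq (f := slot A B g) (g := slot _ vs _)) => x.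
have := IH (rcons xs x); rewrite map_rcons !cat_rcons E; apply.
by rewrite size_cat /= size_map.
Qed.

Lemma mlext_reindex (R : {malg k[X]} -> Prop) (ys : seq (presented R)) h
    (g : seq X -> W) : is_oneline (size ys) h ->
  mlext (reindex 0 ys h) g = mlext ys (fun xs => g (reindex x0 xs h)).
Proof.
move=> hh; rewrite /mlext -mlext_free_reindex ?size_map //; congr mlext_free.
rewrite /reindex -map_comp; apply/eq_in_map => a ah /=.
by rewrite (nth_map 0) // (is_oneline_lt hh ah).
Qed.
End ReindexExtension.

(* The functor D on a constant simplicial vector space V, in simplicial degree
   q: the direct sum over n of k[E_q Sigma_n^op] (x)_{k Sigma_n} V^(tensor n).
   It is generated by the symbols [s_0, ..., s_q; v_0 ... v_{n-1}] with s_i in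
   Sigma_n, multilinear in v, with
     [h s_0, ..., h s_q; v] = [s_0, ..., s_q; v h]   for h in Sigma_n,
   where (v h)_i = v_{h(i)}. With q = 0, [s; v] corresponds to the word
   v_{s(0)} ... v_{s(n-1)} of T V. *)
Section BarrattEccles.
Variables (k : fieldType) (q : nat).
Local Notation simplex := (q.+1.-tuple (seq nat)).

Section Def.
Variable V : lmodType k.

Definition is_symbol (x : simplex * seq V) : bool :=
  all (is_oneline (size x.2)) x.1.
Definition symbol := {x : simplex * seq V | is_symbol x}.

(* The symbol [s; v] in the free vector space, 0 if s is not a tuple of
   permutations of the positions of v. *)
Definition symb (s : simplex) (v : seq V) : {malg k[symbol]} :=
  if insub (s, v) is Some x then << x >> else 0.

Definition left_mul (h : seq nat) (s : simplex) :=
  [tuple of [seq reindex 0%N h si | si <- s]].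

Inductive D_rel : {malg k[symbol]} -> Prop :=
| DLin (s : simplex) (u w : seq V) (a : k) (x y : V) :
  D_rel (symb s (u ++ (a *: x + y) :: w)
         - a *: symb s (u ++ x :: w) - symb s (u ++ y :: w))
| DEquiv (s : simplex) (v : seq V) (h : seq nat) :
  all (is_oneline (size v)) s -> is_oneline (size v) h ->
  D_rel (symb (left_mul h s) v - symb s (reindex 0 v h)).

Definition D : lmodType k := presented D_rel.
Definition Dsym s v : D := qpi D_rel (symb s v).

Record D_compatible (W : lmodType k)
    (F : simplex -> seq V -> W) : Prop := DCompatible {
  D_compat_lin : forall (s : simplex) u w a x y,
    all (is_oneline (size u + size w).+1) s ->
    F s (u ++ (a *: x + y) :: w) = a *: F s (u ++ x :: w) + F s (u ++ y :: w);
  D_compat_equiv : forall (s : simplex) v h,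
    all (is_oneline (size v)) s -> is_oneline (size v) h ->
    F (left_mul h s) v = F s (reindex 0 v h) }.

Definition on_symbol (W : Type) (F : simplex -> seq V -> W)
  (x : symbol) := F (val x).1 (val x).2.

Lemma linext_symb (W : lmodType k) F (s : simplex) v :
  linext (@on_symbol W F) (symb s v) =
  if all (is_oneline (size v)) s then F s v else 0.
Proof.
rewrite /symb; case: insubP => [x xs ex|/negbTE]; last first.
  by rewrite /is_symbol /= => ->; rewrite linear0.
by rewrite linextU /on_symbol ex; rewrite /is_symbol /= in xs; rewrite xs.
Qed.

Lemma all_left_mul n h (s : simplex) : is_oneline n h -> all (is_oneline n) s ->
  all (is_oneline n) (left_mul h s).
Proof.
move=> hh /allP hs; apply/allP => _ /mapP[t ts ->].
by apply: is_oneline_reindex (hs t ts).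
Qed.

Lemma D_compat_rel (W : lmodType k) F : @D_compatible W F ->
  forall r, D_rel r -> linext (on_symbol F) r = 0.
Proof.
case=> Flin Fequ _ [s u w a x y|s v h hs hh].
  rewrite !linearB linearZ /= !linext_symb !size_cat /= addnS.
  by case: ifP => hs; rewrite ?scaler0 ?subr0 // Flin // addrAC addrK subrr.
rewrite linearB /= !linext_symb (all_left_mul hh hs) size_reindex.
by rewrite (is_oneline_size hh) hs Fequ // subrr.
Qed.

Definition D_lift (W : lmodType k) F (cF : @D_compatible W F) :
  {linear D -> W} := plift (D_compat_rel cF).

Lemma Dsym_lin s u w a x y :
  Dsym s (u ++ (a *: x + y) :: w) =
  a *: Dsym s (u ++ x :: w) + Dsym s (u ++ y :: w).
Proof.
rewrite /Dsym -linearZ -linearD; apply/qpiP; rewrite opprD addrA.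
by apply: sub_spanned; apply: DLin.
Qed.

Lemma Dsym_equiv (s : simplex) (v : seq V) h :
  all (is_oneline (size v)) s -> is_oneline (size v) h ->
  Dsym (left_mul h s) v = Dsym s (reindex 0 v h).
Proof. by move=> hs hh; apply/qpiP; apply: sub_spanned; apply: DEquiv. Qed.

Lemma D_liftE (W : lmodType k) F (cF : @D_compatible W F)
    (s : simplex) v :
  all (is_oneline (size v)) s -> D_lift cF (Dsym s v) = F s v.
Proof.
move=> hs; rewrite /D_lift /plift /=.
apply: etrans (qliftE (D_compat_rel cF) (symb s v)) _.
by apply: etrans (linext_symb F s v) _; rewrite hs.
Qed.

Lemma symbol0_subproof : is_symbol ([tuple of nseq q.+1 [::]], [::]).
Proof. by rewrite /is_symbol /= all_nseq orbT. Qed.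
Definition symbol0 : symbol := Sub _ symbol0_subproof.
End Def.

Section Functor.
Variables (V W : lmodType k) (f : {linear V -> W}).
Lemma D_map_subproof : D_compatible (fun s v => Dsym s (map f v)).
Proof.
split=> [s u w a x y _|s v h hs hh]; first by rewrite !map_cat /= linearP Dsym_lin.
rewrite Dsym_equiv ?size_map //; congr Dsym.
rewrite /reindex -map_comp; apply/eq_in_map => i ih /=.
by rewrite (nth_map 0) // (is_oneline_lt hh ih).
Qed.
Definition D_map : {linear D V -> D W} := D_lift D_map_subproof.
End Functor.

(* The map T -> D, induced by the (degenerate) simplex (id, ..., id). *)
Section FromT.
Variable V : lmodType k.
Definition id_simplex n : simplex := [tuple of nseq q.+1 (iota 0 n)].
Lemma T_to_D_subproof :
  word_multilinear (fun v : seq V => Dsym (id_simplex (size v)) v).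
Proof. by move=> u w a x y; rewrite !size_cat Dsym_lin. Qed.
Definition T_to_D : {linear T V -> D V} := T_lift T_to_D_subproof.
End FromT.

(* The multiplication D D V -> D V of the monad D:
   [s; [t_0; w_0] ... [t_{n-1}; w_{n-1}]] |->
     [s(t_0, ..., t_{n-1}); w_0 ... w_{n-1}]. *)
Section Mult.
Variable V : lmodType k.

Definition symbol_perms (cs : seq (symbol V)) (r : 'I_q.+1) : seq (seq nat) :=
  [seq tnth (val c).1 r | c <- cs].
Definition symbol_word (cs : seq (symbol V)) : seq V :=
  flatten [seq (val c).2 | c <- cs].

Definition D_comp (s : simplex) (cs : seq (symbol V)) : D V :=
  Dsym [tuple operad_comp (tnth s r) (symbol_perms cs r) | r < q.+1]
       (symbol_word cs).

Lemma symbolP (c : symbol V) r :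
  is_oneline (size (val c).2) (tnth (val c).1 r).
Proof. by have /allP := valP c; apply; apply: mem_tnth. Qed.

Lemma size_symbol_perms cs r : size (symbol_perms cs r) = size cs.
Proof. exact: size_map. Qed.

Lemma map_size_symbol_perms cs r :
  map size (symbol_perms cs r) = [seq size (val c).2 | c <- cs].
Proof.
rewrite -map_comp; apply: eq_map => c /=.
exact: is_oneline_size (symbolP c r).
Qed.

Lemma size_flatten_symbol_perms cs r :
  size (flatten (symbol_perms cs r)) = size (symbol_word cs).
Proof.
by rewrite !size_flatten /shape map_size_symbol_perms -map_comp.
Qed.

Lemma symbol_perms_oneline cs r t :
  t \in symbol_perms cs r -> is_oneline (size t) t.
Proof.
case/mapP=> c _ ->; have := symbolP c r.
by move=> h; rewrite (is_oneline_size h).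
Qed.

Lemma all_D_comp (s : simplex) cs : all (is_oneline (size cs)) s ->
  all (is_oneline (size (symbol_word cs)))
    [tuple operad_comp (tnth s r) (symbol_perms cs r) | r < q.+1].
Proof.
move=> /allP hs; apply/allP => _ /mapP[r _ ->].
rewrite -(size_flatten_symbol_perms cs r); apply: is_oneline_operad_comp.
  by rewrite size_symbol_perms; apply: hs; apply: mem_tnth.
exact: symbol_perms_oneline.
Qed.

Lemma symbol_word_cat xs ys :
  symbol_word (xs ++ ys) = symbol_word xs ++ symbol_word ys.
Proof. by rewrite /symbol_word map_cat flatten_cat. Qed.

Lemma D_comp_relators (s : simplex) n :
  all (is_oneline n.+1) s -> kills_relators (@D_rel V) n (D_comp s).
Proof.
move=> hs xs ys r sxy Rr.
pose F (t : simplex) (v : seq V) : D V :=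
  Dsym [tuple operad_comp (tnth s r) (symbol_perms xs r ++
                                      tnth t r :: symbol_perms ys r) | r < q.+1]
       (symbol_word xs ++ v ++ symbol_word ys).
rewrite (eq_linext _ (f' := on_symbol F)); last first.
  move=> c; rewrite /D_comp symbol_word_cat; congr Dsym.
  by apply: eq_from_tnth => i; rewrite !tnth_mktuple /symbol_perms map_cat.
apply: D_compat_rel Rr; split=> [t u w a x y _|t v h ht hh].
  have E z : F t (u ++ z :: w) =
      Dsym [tuple operad_comp (tnth s r) (symbol_perms xs r ++
                                      tnth t r :: symbol_perms ys r) | r < q.+1]
       ((symbol_word xs ++ u) ++ z :: (w ++ symbol_word ys)).
    by rewrite /F -!catA.
  by rewrite !E Dsym_lin.
have ht' i : is_oneline (size v) (tnth t i) by apply: (allP ht); apply: mem_tnth.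
have hts i t' : t' \in symbol_perms xs i ++ tnth t i :: symbol_perms ys i ->
    is_oneline (size t') t'.
  rewrite mem_cat inE => /or3P[/symbol_perms_oneline //|/eqP->|].
    by rewrite (is_oneline_size (ht' i)).
  exact: symbol_perms_oneline.
have hsi i : is_oneline (size (symbol_perms xs i) + size (symbol_perms ys i)).+1
    (tnth s i).
  rewrite !size_symbol_perms -size_cat sxy.
  by apply: (allP hs); apply: mem_tnth.
pose H := block_perm (size (symbol_word xs)) h (size (symbol_word ys)).
rewrite /F -(reindex_block_perm 0 _ _ hh) -Dsym_equiv.
- congr Dsym; apply: eq_from_tnth => i; rewrite tnth_mktuple [RHS]tnth_map tnth_mktuple.
  rewrite -!(size_flatten_symbol_perms _ i) tnth_map operad_comp_block //.
  + exact: hts.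
  + by rewrite (is_oneline_size (ht' i)).
- apply/allP => _ /mapP[i _ ->].
  have -> : size (symbol_word xs ++ v ++ symbol_word ys) =
      size (flatten (symbol_perms xs i ++ tnth t i :: symbol_perms ys i)).
    rewrite flatten_cat /= !size_cat !size_flatten_symbol_perms.
    by rewrite (is_oneline_size (ht' i)).
  apply: is_oneline_operad_comp (hts i).
  by rewrite size_cat /= addnS.
- by rewrite !size_cat addnA; apply: is_oneline_block_perm.
Qed.

Lemma D_comp_equiv (s : simplex) h cs :
  all (is_oneline (size cs)) s -> is_oneline (size cs) h ->
  D_comp (left_mul h s) cs = D_comp s (reindex (symbol0 V) cs h).
Proof.
move=> hs hh.
have perms_reindex i : symbol_perms (reindex (symbol0 V) cs h) i =
    reindex [::] (symbol_perms cs i) h.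
  rewrite /symbol_perms /reindex -map_comp; apply/eq_in_map => j jh /=.
  by rewrite (nth_map (symbol0 V)) // (is_oneline_lt hh jh).
have sz i : is_oneline (size (symbol_perms cs i)) h by rewrite size_symbol_perms.
rewrite /D_comp; pose K := permute_blocks h (symbol_perms cs ord0).
have KE i : permute_blocks h (symbol_perms cs i) = K.
  rewrite /K /permute_blocks !(map_comp (iota 0) size).
  by rewrite !map_size_symbol_perms.
have -> : symbol_word (reindex (symbol0 V) cs h) =
    reindex 0 (symbol_word cs) K.
  rewrite reindex_permute_blocks ?map_size_symbol_perms //; last first.
    by rewrite /shape -map_comp.
  rewrite /symbol_word; congr flatten.
  rewrite /reindex -map_comp; apply/eq_in_map => j jh /=.
  by rewrite !(nth_map (symbol0 V)) // (is_oneline_lt hh jh).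
rewrite -Dsym_equiv.
- congr Dsym; apply: eq_from_tnth => i.
  rewrite tnth_mktuple [RHS]tnth_map tnth_mktuple tnth_map perms_reindex.
  rewrite operad_comp_permute_blocks ?KE //.
  + by rewrite size_symbol_perms; apply: (allP hs); apply: mem_tnth.
  + exact: symbol_perms_oneline.
- have hs' : all (is_oneline (size (reindex (symbol0 V) cs h))) s.
    by rewrite size_reindex (is_oneline_size hh).
  have := all_D_comp hs'; congr (is_true (all (is_oneline _) _)).
  rewrite -!(size_flatten_symbol_perms _ ord0) perms_reindex.
  rewrite !size_flatten; apply: perm_sumn; apply: perm_map.
  have sc := size_symbol_perms cs ord0.
  rewrite -[X in perm_eq _ X](take_size).
  rewrite -(map_nth_iota0 [::]) // sc.
  exact: perm_map.
- rewrite -(size_flatten_symbol_perms cs ord0).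
  exact: is_oneline_permute_blocks.
Qed.

Lemma D_mu_subproof :
  D_compatible (fun s (ys : seq (D V)) => mlext ys (D_comp s)).
Proof.
split=> [s u w a x y hs|s ys h hs hh].
  by apply: mlext_slot; apply: D_comp_relators; rewrite size_cat.
rewrite (mlext_reindex (symbol0 V)) //; apply: eq_mlext_free => cs.
rewrite size_map => scs.
by apply: D_comp_equiv; rewrite scs.
Qed.
Definition D_mu : {linear D (D V) -> D V} := D_lift D_mu_subproof.

(* The right action of T on D. *)
Definition D_act : {linear D (T V) -> D V} := D_mu \o D_map (T_to_D V).
End Mult.
End BarrattEccles.

(* The faces E_{q+1} Sigma_n -> E_q Sigma_n, deleting the i-th entry. *)
Section Faces.
Variables (k : fieldType) (q : nat) (V : lmodType k) (i : 'I_q.+2).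

Definition delete (s : q.+2.-tuple (seq nat)) : q.+1.-tuple (seq nat) :=
  [tuple tnth s (lift i j) | j < q.+1].

Lemma all_delete P (s : q.+2.-tuple (seq nat)) : all P s -> all P (delete s).
Proof.
move=> /allP hs; apply/allP => _ /mapP[j _ ->]; apply: hs; exact: mem_tnth.
Qed.

Lemma D_face_subproof : D_compatible (fun s (v : seq V) => Dsym (delete s) v).
Proof.
split=> [s u w a x y _|s v h hs hh]; first exact: Dsym_lin.
rewrite -Dsym_equiv ?all_delete //; congr Dsym.
apply: eq_from_tnth => j.
by rewrite tnth_mktuple [RHS]tnth_map tnth_mktuple tnth_map.
Qed.
Definition D_face : {linear D q.+1 V -> D q V} := D_lift D_face_subproof.
End Faces.

Section AlternatingSum.
Variables (k : fieldType) (V W : lmodType k) (n : nat).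
Variable f : 'I_n -> {linear V -> W}.
Definition alternating_sum (x : V) : W := \sum_(i < n) (-1) ^+ i *: f i x.
Lemma alternating_sum_is_linear : linear alternating_sum.
Proof.
move=> a x y; rewrite /alternating_sum scaler_sumr -big_split /=.
apply: eq_bigr => i _.
by rewrite linearP scalerDr !scalerA mulrC.
Qed.
HB.instance Definition _ :=
  GRing.isLinear.Build k V W _ alternating_sum alternating_sum_is_linear.
End AlternatingSum.

(* The bar construction B_p(D, T, A) = D T^p A, and the diagonal of the
   bisimplicial vector space obtained from the simplicial degree of D. Only the
   faces enter the associated chain complex. *)
Section Bar.
Variables (k : fieldType) (A : unitalAlgebra k).

Fixpoint Tpow (p : nat) : lmodType k :=
  if p is p'.+1 then T (Tpow p') else A.

(* The T-algebra structure of T^p A. *)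
Definition Tpow_action (p : nat) : {linear Tpow p.+1 -> Tpow p} :=
  match p with
  | 0 => T_action A
  | p'.+1 => T_mu (Tpow p')
  end.

(* T^i applied to the action on T^(p-i) A, for i <= p. *)
Fixpoint Tpow_face (p i : nat) : {linear Tpow p.+1 -> Tpow p} :=
  match i, p with
  | 0, _ => Tpow_action p
  | i'.+1, p'.+1 => T_map (Tpow_face p' i')
  | _.+1, 0 => \0
  end.

Definition bar_hface (q p i : nat) :
    {linear D q (Tpow p.+1) -> D q (Tpow p)} :=
  match i with
  | 0 => D_act q (Tpow p)
  | i'.+1 => D_map q (Tpow_face p i')
  end.

Definition bar (p : nat) : lmodType k := D p (Tpow p).

Definition bar_face (p : nat) (i : 'I_p.+2) : {linear bar p.+1 -> bar p} :=
  D_face (Tpow p) i \o bar_hface p.+1 p i.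

Definition bar_diff (p : nat) : {linear bar p.+1 -> bar p} :=
  alternating_sum (@bar_face p).

Definition bar_homology (n : nat) : lmodType k := homology bar_diff n.
End Bar.

(* The category Delta S; the object [n] is represented by n. A morphism
   [n] -> [m] is a tuple of m+1 words in which every element of {0, ..., n}
   occurs exactly once in total. *)
Section DeltaS.

Definition is_dS n m (X : m.+1.-tuple (seq 'I_n.+1)) : bool :=
  perm_eq (flatten X) (enum 'I_n.+1).

Record dS (n m : nat) := DS {
  dS_monomials :> m.+1.-tuple (seq 'I_n.+1);
  dS_monomialsP : is_dS dS_monomials }.

HB.instance Definition _ n m := [isSub for @dS_monomials n m].
HB.instance Definition _ n m := [Countable of dS n m by <:].

Lemma dS_id_subproof n : is_dS [tuple [:: i] | i < n.+1].
Proof. by rewrite /is_dS /= flatten_seq1. Qed.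
Definition dS_id n : dS n n := DS (dS_id_subproof n).

Definition substitute n m (X : m.+1.-tuple (seq 'I_n.+1)) (Y : seq 'I_m.+1) :=
  flatten [seq tnth X y | y <- Y].

Lemma flatten_substitute n m (X : m.+1.-tuple (seq 'I_n.+1)) Ys :
  flatten [seq substitute X Y | Y <- Ys] = substitute X (flatten Ys).
Proof.
elim: Ys => //= Y Ys ->.
by rewrite /substitute map_cat flatten_cat.
Qed.

Lemma dS_comp_subproof n m l (g : dS m l) (f : dS n m) :
  is_dS (map_tuple (substitute f) g).
Proof.
apply: perm_trans (dS_monomialsP f).
rewrite flatten_substitute -[in X in perm_eq _ X](map_tnth_enum f).
by apply: perm_flatten; apply: perm_map; apply: dS_monomialsP.
Qed.
Definition dS_comp n m l (g : dS m l) (f : dS n m) : dS n l :=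
  DS (dS_comp_subproof g f).

End DeltaS.

Section FunctorHomology.
Variable k : fieldType.

Record covFunctor := CovFunctor {
  cov_obj :> nat -> lmodType k;
  cov_map : forall n m, dS n m -> {linear cov_obj n -> cov_obj m};
  cov_id : forall n x, cov_map (dS_id n) x = x;
  cov_comp : forall n m l (g : dS m l) (f : dS n m) x,
    cov_map (dS_comp g f) x = cov_map g (cov_map f x) }.

Record contraFunctor := ContraFunctor {
  con_obj :> nat -> lmodType k;
  con_map : forall n m, dS n m -> {linear con_obj m -> con_obj n};
  con_id : forall n x, con_map (dS_id n) x = x;
  con_comp : forall n m l (g : dS m l) (f : dS n m) x,
    con_map (dS_comp g f) x = con_map f (con_map g x) }.

Record contraMap (P Q : contraFunctor) := ContraMap {
  nat_map :> forall n, {linear P n -> Q n};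
  nat_mapP : forall n m (f : dS n m) x,
    nat_map n (con_map P f x) = con_map Q f (nat_map m x) }.

Definition const_functor : contraFunctor :=
  @ContraFunctor (fun _ => k^o) (fun _ _ _ => idfun)
    (fun _ _ => erefl) (fun _ _ _ _ _ _ => erefl).

Definition projective (P : contraFunctor) : Prop :=
  forall (M N : contraFunctor) (e : contraMap M N) (g : contraMap P N),
    (forall n (y : N n), exists x, e n x = y) ->
    exists h : contraMap P M, forall n x, e n (h n x) = g n x.

Record projResolution (M : contraFunctor) := ProjResolution {
  res :> nat -> contraFunctor;
  res_diff : forall i, contraMap (res i.+1) (res i);
  res_aug : contraMap (res 0) M;
  res_projective : forall i, projective (res i);
  res_aug_onto : forall n (y : M n), exists x, res_aug n x = y;
  res_exact0 : forall n x,
    res_aug n x = 0 <-> exists y, res_diff 0 n y = x;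
  res_exactS : forall i n x,
    res_diff i n x = 0 <-> exists y, res_diff i.+1 n y = x }.

(* The functor tensor product P (x)_{Delta S} F, generated by the symbols
   p (x) x with p in P n and x in F n. *)
Section FunctorTensor.
Variable F : covFunctor.

Section Def.
Variable P : contraFunctor.
Definition ftgen : choiceType := {n : nat & (P n * F n)%type}.
Definition ftsymb n (p : P n) (x : F n) : ftgen := Tagged _ (p, x).

Inductive ftensor_rel : {malg k[ftgen]} -> Prop :=
| FTLinl n a (p p' : P n) (x : F n) :
  ftensor_rel (<< ftsymb (a *: p + p') x >>
               - a *: << ftsymb p x >> - << ftsymb p' x >>)
| FTLinr n a (p : P n) (x x' : F n) :
  ftensor_rel (<< ftsymb p (a *: x + x') >>
               - a *: << ftsymb p x >> - << ftsymb p x' >>)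
| FTBal n m (f : dS n m) (p : P m) (x : F n) :
  ftensor_rel (<< ftsymb (con_map P f p) x >> - << ftsymb p (cov_map F f x) >>).

Definition ftensor : lmodType k := presented ftensor_rel.
Definition ftpure n (p : P n) (x : F n) : ftensor := gen ftensor_rel (ftsymb p x).

Lemma ftpure_linl n a (p p' : P n) x :
  ftpure (a *: p + p') x = a *: ftpure p x + ftpure p' x.
Proof.
rewrite /ftpure /gen -linearZ -linearD; apply/qpiP; rewrite opprD addrA.
by apply: sub_spanned; apply: FTLinl.
Qed.
Lemma ftpure_linr n a (p : P n) (x x' : F n) :
  ftpure p (a *: x + x') = a *: ftpure p x + ftpure p x'.
Proof.
rewrite /ftpure /gen -linearZ -linearD; apply/qpiP; rewrite opprD addrA.
by apply: sub_spanned; apply: FTLinr.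
Qed.
Lemma ftpure_bal n m (f : dS n m) (p : P m) (x : F n) :
  ftpure (con_map P f p) x = ftpure p (cov_map F f x).
Proof. by apply/qpiP; apply: sub_spanned; apply: FTBal. Qed.
End Def.

Section Map.
Variables (P Q : contraFunctor) (phi : contraMap P Q).
Definition ftensor_map_fun (c : ftgen P) : ftensor Q :=
  ftpure (phi (tag c) (tagged c).1) (tagged c).2.
Lemma ftensor_map_subproof r :
  ftensor_rel r -> linext ftensor_map_fun r = 0.
Proof.
case=> [n a p p' x|n a p x x'|n m f p x].
- rewrite !linearB linearZ /= !linextU /ftensor_map_fun /=.
  by rewrite linearP ftpure_linl addrAC addrK subrr.
- rewrite !linearB linearZ /= !linextU /ftensor_map_fun /=.
  by rewrite ftpure_linr addrAC addrK subrr.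
- rewrite linearB /= !linextU /ftensor_map_fun /=.
  by rewrite nat_mapP ftpure_bal subrr.
Qed.
Definition ftensor_map : {linear ftensor P -> ftensor Q} :=
  plift ftensor_map_subproof.
End Map.

(* Tor_n(M, F) as the n-th homology of P (x)_{Delta S} F, for P a projective
   resolution of M in the category of contravariant functors. *)
Definition Tor (M : contraFunctor) (P : projResolution M) (n : nat) :
    lmodType k :=
  homology (fun i => ftensor_map (res_diff P i)) n.
End FunctorTensor.
End FunctorHomology.

Section SymmetricBar.
Variables (k : fieldType) (A : unitalAlgebra k).

(* The action of f on B_sym A: the tensor t_0 (x) ... (x) t_n is sent to the
   tensor of the monomials of f evaluated at x_i = t_i. *)
Definition bsym_tensor n m (f : dS n m) (t : n.+1.-tuple A) : m.+1.-tuple A :=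
  [tuple alg_prod [seq tnth t i | i <- tnth f j] | j < m.+1].

Definition bsym_fun n m (f : dS n m) (t : n.+1.-tuple A) : tpow A m.+1 :=
  gen (@tpow_rel k A m.+1) (bsym_tensor f t).

Lemma dS_monomial n m (f : dS n m) i : exists j u w,
  [/\ tnth f j = u ++ i :: w, i \notin u, i \notin w &
      forall j', j' != j -> i \notin tnth f j'].
Proof.
have : count_mem i (flatten f) == 1%N.
  rewrite (permP (dS_monomialsP f)) count_uniq_mem ?enum_uniq //.
  by rewrite mem_enum.
rewrite count_flatten sumnE big_map big_tuple => /sum_nat_eq1.
case=> j [_ cj c0]; exists j.
have ij : i \in tnth f j by rewrite -has_pred1 has_count cj.
have {c0} ni j' : j' != j -> i \notin tnth f j'.
  by move=> jj; apply/count_memPn; apply: c0.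
case/splitPr: ij cj => u w; rewrite count_cat /= eqxx addnCA add1n => -[].
move/eqP; rewrite addn_eq0 => /andP[/eqP cu /eqP cw].
by exists u, w; split=> //; apply/count_memPn.
Qed.

Lemma eval_notin n (t t' : n.+1.-tuple A) i (s : seq 'I_n.+1) :
  agree_off i t t' -> i \notin s ->
  [seq tnth t j | j <- s] = [seq tnth t' j | j <- s].
Proof.
move=> tt is'; apply/eq_in_map => j js; apply: tt.
by apply: contraNneq is' => <-.
Qed.

Lemma bsym_multilinear n m (f : dS n m) : multilinear (bsym_fun f).
Proof.
move=> i a t t1 t2 h1 h2 e; have [j [u [w [ej iu iw nj]]]] := dS_monomial f i.
apply: (tpow_gen_multilinear (i := j)).
- by move=> j' jj; rewrite !tnth_mktuple (eval_notin h1) ?nj.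
- by move=> j' jj; rewrite !tnth_mktuple (eval_notin h2) ?nj.
- rewrite !tnth_mktuple ej !map_cat /= e alg_prod_multilinear.
  by rewrite !(eval_notin h1) // -!(eval_notin h1) // !(eval_notin h2).
Qed.

Definition bsym_map n m (f : dS n m) : {linear tpow A n.+1 -> tpow A m.+1} :=
  tpow_lift (bsym_multilinear f).

Lemma bsym_mapE n m (f : dS n m) t :
  bsym_map f (gen (@tpow_rel k A n.+1) t) =
  gen (@tpow_rel k A m.+1) (bsym_tensor f t).
Proof. exact: pliftE. Qed.

Lemma bsym_id n x : bsym_map (dS_id n) x = x.
Proof.
apply: (linear_presented_eq (f := bsym_map (dS_id n)) (g := idfun)) => t.
rewrite bsym_mapE; congr gen; apply: eq_from_tnth => i.
by rewrite !tnth_mktuple /= alg_mulr1.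
Qed.

Lemma bsym_comp n m l (g : dS m l) (f : dS n m) x :
  bsym_map (dS_comp g f) x = bsym_map g (bsym_map f x).
Proof.
apply: (linear_presented_eq (f := bsym_map (dS_comp g f))
                            (g := bsym_map g \o bsym_map f)) => t.
rewrite bsym_mapE; apply: etrans _ (esym (congr1 (bsym_map g) (bsym_mapE f t))).
rewrite bsym_mapE; congr gen; apply: eq_from_tnth => j.
rewrite !tnth_mktuple tnth_map /substitute map_flatten alg_prod_flatten.
rewrite -!map_comp; congr alg_prod; apply: eq_map => i /=.
by rewrite tnth_mktuple.
Qed.

Definition Bsym : covFunctor k := CovFunctor bsym_id bsym_comp.
End SymmetricBar.

Definition HS (k : fieldType) (A : unitalAlgebra k)
    (P : projResolution (const_functor k)) (n : nat) : lmodType k :=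
  Tor (Bsym A) P n.

(* Main.v *)
(* Both sides are compared with the homology of the simplicial vector space
   q |-> Ab (T^(q+1) A), where the algebras T^(q+1) A form the standard free
   resolution of A and Ab B is the quotient of B by its commutator ideal. The
   terms of both complexes depend on A only through its underlying vector space,
   so the free resolution gives double complexes whose rows are exact. For a
   free algebra T V both complexes are resolutions of Ab (T V), which makes the
   columns exact:
   - in the bar construction, appending an averaged permutation and inserting
     the unit of T in the innermost slot contracts everything up to the face
     given by the action of T on D, and the resulting error is nilpotent;
   - for HS, a tensor of words is the image of its letters under a morphism of
     Delta S, unique up to a permutation of the letters. Averaging over these
     permutations turns a pointwise contraction of the projective resolution P
     into a contraction of the complex. Tensors without letters are dealt with
     by first lifting P to its shift along [n] |-> [n+1]. *)
Require Import Defs.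
From HB Require Import structures.
From mathcomp Require Import all_boot all_algebra.
From mathcomp Require Import finmap boolp monalg zify.

Set Implicit Arguments.
Unset Strict Implicit.
Unset Printing Implicit Defensive.

Import GRing.Theory.
Local Open Scope ring_scope.
Local Notation reindex := Defs.reindex.

(** * Linear relations and homology *)

Arguments qlift : simpl never.
Arguments plift : simpl never.
Arguments T_lift : simpl never.
Arguments T_map : simpl never.
Arguments T_mu : simpl never.
Arguments T_action : simpl never.
Arguments D_lift : simpl never.
Arguments D_map : simpl never.
Arguments D_mu : simpl never.
Arguments D_act : simpl never.
Arguments D_face : simpl never.
Arguments T_to_D : simpl never.
Arguments tpow_lift : simpl never.
Arguments bsym_map : simpl never.
Arguments ftensor_map : simpl never.
Arguments alternating_sum : simpl never.

(** The two complexes come from unrelated data, a bar construction on one side and an arbitrary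
    projective resolution [P] on the other, with no evident chain map between them. Homology
    isomorphisms are therefore produced from linear relations instead of maps: a diagram chase in a
    double complex relates elements without any linear choice of lifts, and no total complex with
    its signs is needed. Characteristic 0 enters only through division by n!. Appending a
    permutation to a simplex of E Sigma_n, and numbering the letters of a tensor, both depend on a
    chosen order; only the average over all orders respects the relations that define D and the
    tensor product over Delta S. The shift of [P] answers the following obstacle: a tensor with m
    letters ought to come from the object [m-1], which does not exist for m = 0. An extra slot
    holding the unit lets the letters live on [m] for every m. *)

Section LinearRelations.
Variable k : fieldType.

Lemma scaleD_fun0 (V W : lmodType k) (f : V -> W) :
  (forall a x y, f (a *: x + y) = a *: f x + f y) -> f 0 = 0.
Proof.
move=> lf; have := lf (-1) 0 0.
by rewrite scaler0 addr0 scaleN1r addNr.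
Qed.

Definition subspace (V : lmodType k) (S : V -> Prop) :=
  S 0 /\ forall a u v, S u -> S v -> S (a *: u + v).

Lemma eq_subspace (V W : lmodType k) (f g : V -> W) :
  linear f -> linear g -> subspace (fun x => f x = g x).
Proof.
move=> lf lg; split; last by move=> a u v fu fv; rewrite lf lg fu fv.
by rewrite !(scaleD_fun0 (f := _ : V -> W)).
Qed.

Lemma linear_scale_sum (V W : lmodType k) (f : {linear V -> W}) c
    (I : Type) (r : seq I) (F : I -> V) :
  f (c *: \sum_(i <- r) F i) = c *: \sum_(i <- r) f (F i).
Proof. by rewrite linearZ linear_sum. Qed.

Lemma linear_combination (V W : lmodType k) (f g : {linear V -> W}) a :
  linear (fun u => a *: f u + g u).
Proof.
by move=> b u v; rewrite (linearP f) (linearP g) !scalerDr !scalerA addrACA mulrC.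
Qed.

Definition linear_rel (V W : lmodType k) (R : V -> W -> Prop) :=
  R 0 0 /\ forall a u v x y, R u x -> R v y -> R (a *: u + v) (a *: x + y).

Lemma spanned_ind (V : lmodType k) (R S : V -> Prop) : subspace S ->
  (forall r, R r -> S r) -> forall x, x \in spanned R -> S x.
Proof. by case=> S0 SD RS x /asboolP; apply. Qed.

Lemma subspace_sum (V : lmodType k) (S : V -> Prop) (I : Type) (r : seq I)
    (P : pred I) (F : I -> V) :
  subspace S -> (forall i, P i -> S (F i)) -> S (\sum_(i <- r | P i) F i).
Proof.
move=> [S0 SD] SF; elim/big_rec: _ => // i x Pi Sx.
by rewrite -[F i]scale1r; apply: SD => //; apply: SF.
Qed.

Lemma subspaceZ (V : lmodType k) (S : V -> Prop) a u :
  subspace S -> S u -> S (a *: u).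
Proof. by move=> [S0 SD] Su; rewrite -[_ *: _]addr0; apply: SD. Qed.

Lemma subspaceD (V : lmodType k) (S : V -> Prop) u v :
  subspace S -> S u -> S v -> S (u + v).
Proof. by move=> [S0 SD] Su Sv; rewrite -[u]scale1r; apply: SD. Qed.

Lemma subspaceB (V : lmodType k) (S : V -> Prop) u v :
  subspace S -> S u -> S v -> S (u - v).
Proof. by move=> [S0 SD] Su Sv; rewrite addrC -scaleN1r; apply: SD. Qed.

Definition in_image (V W : lmodType k) (f : {linear V -> W}) (y : W) := exists x, f x = y.

Lemma in_image_subspace (V W : lmodType k) (f : {linear V -> W}) :
  subspace (in_image f).
Proof.
split; first by exists 0; rewrite linear0.
by move=> a u v [x <-] [y <-]; exists (a *: x + y); rewrite linearP.
Qed.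

Lemma malg_ind (X : choiceType) (S : {malg k[X]} -> Prop) : subspace S ->
  (forall x, S << x >>) -> forall u, S u.
Proof.
move=> sS Sg u; rewrite [u]monalgE; apply: subspace_sum => // x _.
have -> : << u@_x *g x >> = u@_x *: << x >> :> {malg k[X]}.
  by apply/malgP => y; rewrite mcoeffZ !mcoeffU mulrnAr mulr1.
exact: subspaceZ.
Qed.

Lemma presented_ind (X : choiceType) (R : {malg k[X]} -> Prop)
    (S : presented R -> Prop) : subspace S ->
  (forall x, S (gen R x)) -> forall y, S y.
Proof.
move=> [S0 SD] Sg y; rewrite -[y]qreprK.
apply: (@malg_ind X (fun u => S (qpi R u))) => //; split.
  by rewrite linear0.
by move=> a u v Su Sv; rewrite linearP; apply: SD.
Qed.

Lemma injective_surjective_bij (V W : lmodType k) (f : {linear V -> W}) :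
  (forall x, f x = 0 -> x = 0) -> (forall y, exists x, f x = y) -> bijective f.
Proof.
move=> f0 fs; pose g y := sval (cid (fs y)).
have gK y : f (g y) = y by rewrite /g; case: cid.
exists g => // x; apply/eqP; rewrite -subr_eq0; apply/eqP; apply: f0.
by rewrite linearB gK subrr.
Qed.

Section HomologyRelation.
Variables (U V W U' V' W' : lmodType k).
Variables (f : {linear U -> V}) (g : {linear V -> W}).
Variables (f' : {linear U' -> V'}) (g' : {linear V' -> W'}).
Variable R : V -> V' -> Prop.
Hypotheses (linR : linear_rel R)
  (totR : forall x, g x = 0 -> exists x', g' x' = 0 /\ R x x')
  (surR : forall x', g' x' = 0 -> exists x, g x = 0 /\ R x x')
  (bndR : forall x x', R x x' -> in_image f x <-> in_image f' x').

Let bnd (x : kernel g) := exists y, kernel_val x = f y.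
Let bnd' (x : kernel g') := exists y, kernel_val x = f' y.

Lemma kernel_valP (z : kernel g) : g (val z) = 0.
Proof. by apply/eqP; apply: (valP z). Qed.

Let partner_ex (z : kernel g) : exists z' : kernel g', R (val z) (val z').
Proof.
have [x' [gx' Rx]] := totR (kernel_valP z).
by exists (Kernel (introT eqP gx')).
Qed.

Let partner z := sval (cid (partner_ex z)).
Let partnerP z : R (val z) (val (partner z)).
Proof. by rewrite /partner; case: cid. Qed.

Let F0 (z : kernel g) : homology_at f' g' := qpi bnd' (partner z).

Let subRB u v x y : R u x -> R v y -> R (u - v) (x - y).
Proof.
move=> Ru Rv; rewrite -[u - v]addrC -[x - y]addrC -!scaleN1r.
by apply: linR.2.
Qed.

Let same_class (z : kernel g) (z' : kernel g') : R (val z) (val z') ->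
  F0 z = qpi bnd' z'.
Proof.
move=> Rz; apply/qpiP; apply: sub_spanned.
have R0 : R 0 (val (partner z - z')).
  by rewrite raddfB -[X in R X _](subrr (val z)); apply: subRB.
have [y fy] : in_image f' (val (partner z - z')).
  by apply/(bndR R0); exists 0; rewrite linear0.
by exists y.
Qed.

Let F0_linear : linear F0.
Proof.
move=> a x y; rewrite /F0 -linearP; apply: same_class.
by rewrite !linearP; apply: linR.2; apply: partnerP.
Qed.
HB.instance Definition _ :=
  GRing.isLinear.Build k (kernel g) (homology_at f' g') _ F0 F0_linear.

Lemma qpi_eq0 (Z : lmodType k) (S : Z -> Prop) z :
  subspace S -> qpi S z = 0 -> S z.
Proof.
move=> sS; rewrite -[0](linear0 (qpi S)) => /qpiP; rewrite subr0.
by apply: spanned_ind.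
Qed.

Let bnd_subspace' : subspace bnd'.
Proof.
split; first by exists 0; rewrite linear0 [LHS](linear0 (val : kernel g' -> V')).
move=> a u v [x ex] [y ey]; exists (a *: x + y).
by rewrite linearP -ex -ey [LHS](linearP (val : kernel g' -> V')).
Qed.

Let F0_bnd z : bnd z -> F0 z = 0.
Proof.
move=> [y ey]; rewrite (same_class (z' := partner z)) //.
apply: qpi_rel; have [x ex] : in_image f' (val (partner z)).
  by apply/(bndR (partnerP z)); exists y.
by exists x.
Qed.

(** Two partners of a cycle differ by an element related to 0, which [bndR] makes a boundary. Hence
    any choice of partners becomes a linear map on classes. The converse half of [bndR] gives
    injectivity and [surR] surjectivity. *)
Lemma homology_at_iso :
  exists F : {linear homology_at f g -> homology_at f' g'}, bijective F.
Proof.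
exists (qlift F0_bnd : {linear homology_at f g -> homology_at f' g'}).
apply: injective_surjective_bij => [y|y].
  rewrite -[y]qreprK; set z := qrepr y.
  move=> /(etrans (esym (qliftE F0_bnd z)))/(qpi_eq0 bnd_subspace')[x ex].
  apply: qpi_rel; have [u eu] : in_image f (val z).
    by apply/(bndR (partnerP z)); exists x.
  by exists u.
rewrite -[y]qreprK; set z' := qrepr y.
have /eqP gz' := valP z'; have [x [gx Rx]] := surR gz'.
pose z := Kernel (introT eqP gx : x \in in_kernel g).
exists (qpi bnd z).
apply: etrans (qliftE F0_bnd z) _.
exact: same_class.
Qed.
End HomologyRelation.

Section HomologyIso.
Variables (C C' : nat -> lmodType k).
Variables (d : forall n, {linear C n.+1 -> C n}).
Variables (d' : forall n, {linear C' n.+1 -> C' n}).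

(** In degree 0 everything is a cycle, in accordance with the zero map that [homology] uses out of
    [C 0]. *)
Definition is_cycle (E : nat -> lmodType k) (e : forall n, {linear E n.+1 -> E n}) n :
    E n -> Prop :=
  match n with 0 => fun _ => True | m.+1 => fun x => e m x = 0 end.

Lemma homology_iso n (R : C n -> C' n -> Prop) : linear_rel R ->
  (forall x, is_cycle d x -> exists x', is_cycle d' x' /\ R x x') ->
  (forall x', is_cycle d' x' -> exists x, is_cycle d x /\ R x x') ->
  (forall x x', R x x' -> in_image (d n) x <-> in_image (d' n) x') ->
  exists F : {linear homology d n -> homology d' n}, bijective F.
Proof.
case: n R => [|n] R linR tR sR bR; apply: homology_at_iso linR _ _ bR => //.
- by move=> x _; have [x' [_ Rx]] := tR x I; exists x'.
- by move=> x _; have [x' [_ Rx]] := sR x I; exists x'.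
Qed.
End HomologyIso.

End LinearRelations.

(** * Simplicial vector spaces and double complexes *)

Section SimplicialIdentities.
Variable k : fieldType.

(** The pairing of (i, j+1) with (j, i) for i <= j matches the entries of the N x (N+1) rectangle
    above the diagonal with the remaining ones. The induction removes the last row and the last
    column, which cancel against each other. *)
Lemma simplicial_cancel (W : lmodType k) (F : nat -> nat -> W) N :
  (forall i j, (i <= j < N)%N -> F i j.+1 = - F j i) ->
  \sum_(i < N) \sum_(j < N.+1) F i j = 0.
Proof.
elim: N => [|N IH] FN; first by rewrite big_ord0.
rewrite big_ord_recr /=; under eq_bigr do rewrite big_ord_recr /=.
rewrite big_split /= IH => [|i j /andP[ij jN]]; last first.
  by apply: FN; rewrite ij ltnW.
rewrite add0r !big_ord_recr /= [F N N.+1]FN ?leqnn // addrK.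
rewrite -big_split big1 // => i _ /=.
by rewrite FN ?addNr // ltnW ?ltnS ?leqnn // ltnW.
Qed.

Lemma alternating_sum_natural (V W V' W' : lmodType k) n
    (f : 'I_n -> {linear V -> W}) (f' : 'I_n -> {linear V' -> W'})
    (g : {linear V -> V'}) (h : {linear W -> W'}) x :
  (forall i x, f' i (g x) = h (f i x)) ->
  alternating_sum f' (g x) = h (alternating_sum f x).
Proof.
move=> fg; rewrite /alternating_sum linear_sum; apply: eq_bigr => i _.
by rewrite linearZ fg.
Qed.

Lemma sign_preimage (V W : lmodType k) (f : {linear V -> W}) p x y :
  f x = (-1) ^+ p *: y -> f ((-1) ^+ p *: x) = y.
Proof. by rewrite linearZ => /= ->; rewrite scalerA -expr2 sqrr_sign scale1r. Qed.

(** A cone operator h that commutes with the inner faces and is inverted by the last one. As x is a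
    cycle, its faces of positive index sum to minus the 0-th one, so only the failure of h to
    commute with the 0-th face survives, besides x itself. *)
Lemma alternating_sum_cone (U V W : lmodType k) n
    (f : 'I_n.+1 -> {linear V -> U}) (g : 'I_n.+2 -> {linear W -> V})
    (h : {linear V -> W}) (h' : {linear U -> V}) x :
  (forall j : 'I_n, g (lift ord_max (lift ord0 j)) (h x) = h' (f (lift ord0 j) x)) ->
  g ord_max (h x) = x -> alternating_sum f x = 0 ->
  alternating_sum g (h x) =
    (g (lift ord_max ord0) (h x) - h' (f ord0 x)) + (-1) ^+ n.+1 *: x.
Proof.
rewrite /alternating_sum => gS gmax fx; rewrite big_ord_recr /= gmax.
congr (_ + _).
have wE (i : 'I_n.+1) : widen_ord (leqnSn n.+1) i = lift ord_max i.
  by apply: val_inj; rewrite /= /bump leqNgt ltn_ord.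
rewrite big_ord_recl /= expr0 scale1r wE; congr (_ + _).
have: h' (\sum_(i < n.+1) (-1) ^+ i *: f i x) = 0 by rewrite fx linear0.
rewrite big_ord_recl expr0 scale1r linearD => /eqP.
rewrite addr_eq0 => /eqP->; rewrite opprK linear_sum; apply: eq_bigr => j _.
by rewrite wE gS linearZ.
Qed.

Variables (X : nat -> lmodType k).
Variable d : forall q, 'I_q.+2 -> {linear X q.+1 -> X q}.

Definition face_diff q : {linear X q.+1 -> X q} := alternating_sum (d (q := q)).

Lemma face_diffE q (x : X q.+1) :
  face_diff q x = \sum_(i < q.+2) (-1) ^+ i *: d (inord i) x.
Proof. by apply: eq_bigr => i _; rewrite inord_val. Qed.

Lemma face_diff_sqr :
  (forall q i j (x : X q.+2), (i <= j < q.+2)%N ->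
     d (inord i) (d (inord j.+1) x) = d (inord j) (d (inord i) x)) ->
  forall q x, face_diff q (face_diff q.+1 x) = 0.
Proof.
move=> dd q x; rewrite [LHS]face_diffE.
pose F i j := (-1) ^+ (i + j) *: d (inord i : 'I_q.+2) (d (inord j) x).
rewrite -[RHS](@simplicial_cancel _ F q.+2) => [|i j ij].
  apply: eq_bigr => i _; rewrite face_diffE linear_sum scaler_sumr.
  by apply: eq_bigr => j _; rewrite linearZ scalerA /F exprD.
by rewrite /F dd // addnS exprS mulN1r scaleNr addnC.
Qed.

Section ExtraDegeneracy.
Variables (Y : lmodType k) (aug : {linear X 0 -> Y}).
Variables (s0 : {linear Y -> X 0}) (s : forall q, {linear X q -> X q.+1}).
Hypotheses (aug_s0 : forall y, aug (s0 y) = y)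
  (d_s : forall q x, d ord0 (s q x) = x)
  (d1_s0 : forall x, d (lift ord0 ord0) (s 0 x) = s0 (aug x))
  (dS_s : forall q (i : 'I_q.+2) x, d (lift ord0 i) (s q.+1 x) = s q (d i x)).

(** Here s acts as a degeneracy of index -1: the 0-th face undoes it and every other face passes
    through it with its index lowered, so that s contracts the augmented complex. *)
Lemma extra_degeneracy_exact0 x : aug x = 0 -> in_image (face_diff 0) x.
Proof.
move=> ax; exists (s 0 x); rewrite /face_diff /= /alternating_sum.
rewrite !big_ord_recl big_ord0 /= d_s d1_s0 ax.
by rewrite linear0 scaler0 !addr0 expr0 scale1r.
Qed.

Lemma extra_degeneracy_exactS q x :
  face_diff q x = 0 -> in_image (face_diff q.+1) x.
Proof.
move=> dx; exists (s q.+1 x); rewrite /face_diff /= /alternating_sum.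
rewrite big_ord_recl d_s expr0 scale1r.
under eq_bigr => i _.
  rewrite dS_s lift0 exprS mulN1r scaleNr.
  rewrite -linearZ. over.
by rewrite sumrN -linear_sum [X in s q X]dx linear0 subr0.
Qed.
End ExtraDegeneracy.
End SimplicialIdentities.

(** * Comparing the two edges of a double complex *)

Section DoubleComplex.
Variable k : fieldType.

Section HalfComplex.
Variable K : nat -> nat -> lmodType k.
Variable dh : forall p q, {linear K p.+1 q -> K p q}.
Variable dv : forall p q, {linear K p q.+1 -> K p q}.
Variables (A B : nat -> lmodType k).
Variable dA : forall p, {linear A p.+1 -> A p}.
Variable dB : forall q, {linear B q.+1 -> B q}.
Variable ev : forall p, {linear K p 0 -> A p}.
Variable eh : forall q, {linear K 0 q -> B q}.

Hypotheses
  (dhv : forall p q x, dh p q (dv p.+1 q x) = dv p q (dh p q.+1 x))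
  (dA_ev : forall p x, dA p (ev p.+1 x) = ev p (dh p 0 x))
  (dB_eh : forall q x, dB q (eh q.+1 x) = eh q (dv 0 q x))
  (dhh : forall p q x, dh p q (dh p.+1 q x) = 0)
  (ehdh : forall q x, eh q (dh 0 q x) = 0).
Hypotheses
  (ev_onto : forall p y, exists x, ev p x = y)
  (ev_exact : forall p x, ev p x = 0 -> in_image (dv p 0) x)
  (dv_exact : forall p q x, dv p q x = 0 -> in_image (dv p q.+1) x).

Local Notation bifamily := (forall c : nat * nat, K c.1 c.2).

Definition put (x : bifamily) p q (y : K p q) : bifamily :=
  @dfwith _ (fun c : nat * nat => K c.1 c.2) x (p, q) y.

Lemma put_in x p q y : @put x p q y (p, q) = y.
Proof. exact: dfwith_in. Qed.

Lemma put_out x p q y p' q' : (p' == p) && (q' == q) = false ->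
  @put x p q y (p', q') = x (p', q').
Proof. by move=> pq; rewrite /put dfwith_out // eq_sym xpair_eqE pq. Qed.

(** Up to signs, a cycle of the total complex lying over a at one edge and over b at the other. Only
    the entries of x on the antidiagonal p + q = n matter. *)
Definition staircase n (a : A n) (b : B n) :=
  exists x : bifamily,
  [/\ ev n (x (n, 0%N)) = a, eh n (x (0%N, n)) = b &
      forall p q, (p + q).+1 = n -> dh p q (x (p.+1, q)) = dv p q (x (p, q.+1))].

Lemma staircase_linear n : linear_rel (@staircase n).
Proof.
split; first by exists (fun _ => 0); split=> *; rewrite !linear0.
move=> a u v x y [z [<- <- hz]] [t [<- <- ht]].
exists (fun c => a *: z c + t c); split; rewrite ?linearP //.
by move=> p q pq; rewrite !linearP hz ?ht.
Qed.

(** The stairs are built from (n, 0) towards (0, n). Commutation of the squares and the vanishing of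
    dh dh make each dh image a dv cycle, and column exactness provides the next entry. *)
Lemma staircase_total n a : is_cycle dA a ->
  exists b : B n, is_cycle dB b /\ staircase a b.
Proof.
move=> ca.
suff H r : (r <= n)%N -> exists x : bifamily,
    ev n (x (n, 0%N)) = a /\
    forall p q, (q < r)%N -> (p + q).+1 = n ->
      dh p q (x (p.+1, q)) = dv p q (x (p, q.+1)).
  have [x [xa xs]] := H n (leqnn n).
  exists (eh n (x (0%N, n))); split; last first.
    exists x; split=> // p q pq; apply: xs => //.
    by rewrite -pq ltnS leq_addl.
  case: n a ca {H} x xa xs => //= n a ca x xa xs.
  by rewrite dB_eh -xs // ehdh.
elim: r => [_|r IH rn].
  have [z ez] := ev_onto a.
  by exists (put (fun _ => 0) z); rewrite put_in.
have [x [xa xs]] := IH (ltnW rn).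
have [p pn] : exists p, (p + r).+1 = n.
  by exists (n - r.+1)%N; rewrite -addnS subnK.
have [y ey] : exists y, dv p r y = dh p r (x (p.+1, r)).
  case: r rn {IH} xs pn => [|r] rn xs pn.
    apply: ev_exact; rewrite -dA_ev.
    move: a ca x xa xs; rewrite -pn !addn0 /= => a ca x xa _.
    by rewrite xa ca.
  by apply: dv_exact; rewrite -dhv -xs ?dhh // -pn addSnnS.
exists (put x y); split; first by rewrite put_out // andbF.
move=> p' q; rewrite ltnS leq_eqVlt => /predU1P[->|qr] pq.
  have -> : p' = p by apply/eqP; rewrite -(eqn_add2r r) -eqSS pq pn.
  by rewrite put_in put_out ?ey ?[r == _]ltn_eqF ?andbF.
by rewrite !put_out ?xs // ?(@ltn_eqF q r.+1 (ltnW qr)) ?(@ltn_eqF q.+1 r.+1 qr) ?andbF.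
Qed.

(** A lift t of a primitive of a starts a family y of total degree n+1 whose total boundary is x. It
    is extended one column entry at a time by the same exactness, and its last entry gives the
    primitive of b. *)
Lemma staircase_boundary n a b : staircase a b ->
  in_image (dA n) a -> in_image (dB n) b.
Proof.
move=> [x [xa <- xs]] [a' a'a].
have [t et] := ev_onto a'.
suff H r : (r <= n)%N -> exists y : bifamily,
    forall p q, (q <= r)%N -> (p + q)%N = n ->
      x (p, q) = dh p q (y (p.+1, q)) + dv p q (y (p, q.+1)).
  have [y ys] := H n (leqnn n); exists (eh n.+1 (y (0%N, n.+1))).
  by rewrite dB_eh ys // linearD ehdh add0r.
elim: r => [_|r IH rn].
  have [z ez] : exists z, dv n 0 z = x (n, 0%N) - dh n 0 t.
    by apply: ev_exact; rewrite linearB xa -dA_ev et a'a subrr.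
  exists (put (put (fun=> 0) z) t) => p q.
  rewrite leqn0 => /eqP->; rewrite addn0 => ->.
  by rewrite put_in put_out ?andbF // put_in ez addrC subrK.
have [y ys] := IH (ltnW rn).
have [p pn] : exists p, (p + r.+1)%N = n by exists (n - r.+1)%N; rewrite subnK.
have [z ez] : exists z, dv p r.+1 z = x (p, r.+1) - dh p r.+1 (y (p.+1, r.+1)).
  apply: dv_exact; rewrite linearB -dhv -xs -?addnS // -linearB.
  by rewrite ys // ?addSnnS // addrK dhh.
exists (put y z) => p' q.
rewrite leq_eqVlt => /predU1P[->|qr] pq.
  have -> : p' = p by apply/eqP; rewrite -(eqn_add2r r.+1) pq pn.
  by rewrite put_in put_out ?(ltn_eqF (ltnSn _)) ?andbF // ez addrC subrK.
by rewrite !put_out ?ys // ?(@ltn_eqF q r.+2 (ltnW qr)) ?(@ltn_eqF q.+1 r.+2 qr) ?andbF.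
Qed.
End HalfComplex.

Section Iso.
Variable K : nat -> nat -> lmodType k.
Variable dh : forall p q, {linear K p.+1 q -> K p q}.
Variable dv : forall p q, {linear K p q.+1 -> K p q}.
Variables (A B : nat -> lmodType k).
Variable dA : forall p, {linear A p.+1 -> A p}.
Variable dB : forall q, {linear B q.+1 -> B q}.
Variable ev : forall p, {linear K p 0 -> A p}.
Variable eh : forall q, {linear K 0 q -> B q}.

(* The squares commute, rather than anticommute: hence no signs. *)
Hypotheses
  (dhv : forall p q x, dh p q (dv p.+1 q x) = dv p q (dh p q.+1 x))
  (dA_ev : forall p x, dA p (ev p.+1 x) = ev p (dh p 0 x))
  (dB_eh : forall q x, dB q (eh q.+1 x) = eh q (dv 0 q x))
  (dhh : forall p q x, dh p q (dh p.+1 q x) = 0)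
  (ehdh : forall q x, eh q (dh 0 q x) = 0)
  (dvv : forall p q x, dv p q (dv p q.+1 x) = 0)
  (evdv : forall p x, ev p (dv p 0 x) = 0).
Hypotheses
  (ev_onto : forall p y, exists x, ev p x = y)
  (ev_exact : forall p x, ev p x = 0 -> in_image (dv p 0) x)
  (dv_exact : forall p q x, dv p q x = 0 -> in_image (dv p q.+1) x)
  (eh_onto : forall q y, exists x, eh q x = y)
  (eh_exact : forall q x, eh q x = 0 -> in_image (dh 0 q) x)
  (dh_exact : forall p q x, dh p q x = 0 -> in_image (dh p.+1 q) x).

Lemma staircase_swap n a b : staircase dh dv ev eh a b <->
  @staircase (fun p q => K q p) (fun p q => dv q p) (fun p q => dh q p)
    B A eh ev n b a.
Proof.
split=> -[x [xa xb xs]].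
  exists (fun c => x (c.2, c.1)); split=> // p q pq.
  by rewrite xs // addnC.
exists (fun c => x (c.2, c.1)); split=> // p q pq.
by rewrite (xs q p) // addnC.
Qed.

Lemma double_complex_iso n :
  exists F : {linear homology dA n -> homology dB n}, bijective F.
Proof.
apply: (homology_iso (R := @staircase K dh dv A B ev eh n)).
- exact: staircase_linear.
- by move=> x; apply: staircase_total.
- move=> b cb.
  have [a [ca /staircase_swap sab]] := @staircase_total (fun p q => K q p)
    (fun p q => dv q p) (fun p q => dh q p) B A dB dA eh ev
    (fun p q x => esym (dhv x)) dB_eh dA_ev (fun p q => @dvv q p) evdv
    eh_onto eh_exact (fun p q => @dh_exact q p) n b cb.
  by exists a.
- move=> a b sab; split; first exact: staircase_boundary sab.
  move/staircase_swap: sab; apply: staircase_boundary => // p q.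
  exact: dh_exact.
Qed.
End Iso.
End DoubleComplex.

(** * Free algebras *)

Section WordSpan.
Variable k : fieldType.

Definition spanning (V : lmodType k) (G : V -> Prop) :=
  forall S : V -> Prop, subspace S -> (forall v, G v -> S v) -> forall v, S v.

Lemma spanning_gen (X : choiceType) (R : {malg k[X]} -> Prop) :
  spanning (fun y => exists x, y = gen R x).
Proof.
by move=> S sS SG; apply: presented_ind => // x; apply: SG; exists x.
Qed.

Lemma linear_spanning_eq (V W : lmodType k) (G : V -> Prop)
    (f g : {linear V -> W}) : spanning G ->
  (forall v, G v -> f v = g v) -> f =1 g.
Proof.
move=> sG; apply: sG; split; first by rewrite !linear0.
by move=> a u v fu fv; rewrite !linearP fu fv.
Qed.

Lemma word_multilinear_ind (V W : lmodType k) (G : V -> Prop)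
    (F : seq V -> W) (S : W -> Prop) : spanning G ->
  word_multilinear F -> subspace S ->
  (forall v, (forall x, x \in v -> G x) -> S (F v)) -> forall v, S (F v).
Proof.
move=> sG mF [S0 SD] FG v.
(* The letters are treated from left to right; u collects those already known to lie in [G]. *)
suff H u w : (forall x, x \in u -> G x) -> S (F (u ++ w)) by apply: (H [::]).
elim: w u => [|x w IH] u Gu; first by rewrite cats0; apply: FG.
apply: (sG (fun x => S (F (u ++ x :: w)))) => [|{}x Gx].
  split; last by move=> a y z Fy Fz; rewrite mF; apply: SD.
  by rewrite (scaleD_fun0 (f := fun y => F (u ++ y :: w))).
rewrite -cat_rcons; apply: IH => y; rewrite mem_rcons inE.
by case/predU1P => [->|/Gu].
Qed.

Lemma all_gen_words (X : choiceType) (R : {malg k[X]} -> Prop) ys :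
  (forall y, y \in ys -> exists x, y = gen R x) ->
  exists xs, ys = [seq gen R x | x <- xs].
Proof.
elim: ys => [_|y ys IH gys]; first by exists [::].
have [x ->] : exists x, y = gen R x by apply: gys; rewrite inE eqxx.
have [|xs ->] := IH; last by exists (x :: xs).
by move=> z zy; apply: gys; rewrite inE zy orbT.
Qed.

End WordSpan.

Section Bilinear.
Variables (k : fieldType) (V : lmodType k) (mul : V -> V -> V).
Hypotheses (linl : forall a x y z, mul (a *: x + y) z = a *: mul x z + mul y z)
  (linr : forall a x y z, mul z (a *: x + y) = a *: mul z x + mul z y).

Definition bilinear_l_fun z x := mul z x.
Lemma bilinear_l_is_linear z : linear (bilinear_l_fun z).
Proof. by move=> a x y; apply: linr. Qed.
Definition bilinear_l z : {linear V -> V} :=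
  HB.pack (bilinear_l_fun z)
    (GRing.isLinear.Build k V V _ (bilinear_l_fun z) (bilinear_l_is_linear z)).

Definition bilinear_r_fun z x := mul x z.
Lemma bilinear_r_is_linear z : linear (bilinear_r_fun z).
Proof. by move=> a x y; apply: linl. Qed.
Definition bilinear_r z : {linear V -> V} :=
  HB.pack (bilinear_r_fun z)
    (GRing.isLinear.Build k V V _ (bilinear_r_fun z) (bilinear_r_is_linear z)).

Variables (G : V -> Prop) (sG : spanning G).

Lemma bilinear_assoc : (forall x y z, G x -> G y -> G z ->
  mul x (mul y z) = mul (mul x y) z) -> associative mul.
Proof.
move=> mA.
have m0l z : mul 0 z = 0.
  by apply: (scaleD_fun0 (f := mul^~ z)) => a x y; apply: linl.
have m0r z : mul z 0 = 0.
  by apply: (scaleD_fun0 (f := mul z)) => a x y; apply: linr.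
move=> x y z; move: x; apply: sG => [|x Gx].
  split=> [|a x x' Ex Ex']; first by rewrite !m0l.
  by rewrite !linl Ex Ex'.
move: y; apply: sG => [|y Gy].
  split=> [|a y y' Ey Ey']; first by rewrite !(m0l, m0r).
  by rewrite !(linl, linr) Ey Ey'.
move: z; apply: sG => [|z Gz]; last exact: mA.
split=> [|a z z' Ez Ez']; first by rewrite !m0r.
by rewrite !linr Ez Ez'.
Qed.

Lemma bilinear_morph (W : lmodType k) (mul' : W -> W -> W)
    (linl' : forall a x y z, mul' (a *: x + y) z = a *: mul' x z + mul' y z)
    (linr' : forall a x y z, mul' z (a *: x + y) = a *: mul' z x + mul' z y)
    (f : {linear V -> W}) :
  (forall x y, G x -> G y -> f (mul x y) = mul' (f x) (f y)) ->
  forall x y, f (mul x y) = mul' (f x) (f y).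
Proof.
move=> fM.
have m0l z : mul 0 z = 0.
  by apply: (scaleD_fun0 (f := mul^~ z)) => a x y; apply: linl.
have m0r z : mul z 0 = 0.
  by apply: (scaleD_fun0 (f := mul z)) => a x y; apply: linr.
have m0l' z : mul' 0 z = 0.
  by apply: (scaleD_fun0 (f := mul'^~ z)) => a x y; apply: linl'.
have m0r' z : mul' z 0 = 0.
  by apply: (scaleD_fun0 (f := mul' z)) => a x y; apply: linr'.
move=> x y; move: x; apply: sG => [|x Gx].
  split=> [|a x x' Ex Ex']; first by rewrite m0l linear0 m0l'.
  by rewrite linl !linearP linl' Ex Ex'.
move: y; apply: sG => [|y Gy]; last exact: fM.
split=> [|a y y' Ey Ey']; first by rewrite m0r linear0 m0r'.
by rewrite linr !linearP linr' Ey Ey'.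
Qed.
End Bilinear.

Section TensorFunctor.
Variable k : fieldType.
Implicit Types U V W : lmodType k.

Definition word V (v : seq V) : T V := gen (@T_rel k V) v.

Lemma word_is_multilinear V : word_multilinear (@word V).
Proof. exact: T_gen_multilinear. Qed.

Lemma linear_T_eq V W (f g : {linear T V -> W}) :
  (forall v, f (word v) = g (word v)) -> f =1 g.
Proof. exact: linear_presented_eq. Qed.

Lemma T_ind V (S : T V -> Prop) : subspace S -> (forall v, S (word v)) ->
  forall x, S x.
Proof. exact: presented_ind. Qed.

Lemma spanning_word V : spanning (fun y : T V => exists v, y = word v).
Proof. exact: spanning_gen. Qed.

Lemma all_words V (ys : seq (T V)) : (forall y, y \in ys -> exists v, y = word v) ->
  exists ws, ys = map (@word V) ws.
Proof. exact: all_gen_words. Qed.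

Lemma T_liftE V W (F : seq V -> W) (mF : word_multilinear F) v :
  T_lift mF (word v) = F v.
Proof. exact: pliftE. Qed.

Lemma T_mapE V W (f : {linear V -> W}) v : T_map f (word v) = word (map f v).
Proof. exact: T_liftE. Qed.

Lemma T_map_comp U V W (h : {linear U -> W}) (g : {linear V -> W})
    (f : {linear U -> V}) : (forall x, h x = g (f x)) ->
  forall x, T_map h x = T_map g (T_map f x).
Proof.
move=> hgf x.
apply: (linear_T_eq (f := T_map h) (g := T_map g \o T_map f)) => v.
by rewrite /= !T_mapE (eq_map hgf) map_comp.
Qed.

Lemma T_map_square U V V' W (g : {linear V -> W}) (f : {linear U -> V})
    (g' : {linear V' -> W}) (f' : {linear U -> V'}) :
  (forall x, g (f x) = g' (f' x)) ->
  forall x, T_map g (T_map f x) = T_map g' (T_map f' x).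
Proof.
move=> gf x.
apply: (linear_T_eq (f := T_map g \o T_map f) (g := T_map g' \o T_map f')) => v.
by rewrite /= !T_mapE -!map_comp (eq_map gf).
Qed.

Lemma T_map_id V (f : {linear V -> V}) : (forall v, f v = v) ->
  forall x, T_map f x = x.
Proof.
move=> fi x; apply: (linear_T_eq (f := T_map f) (g := idfun)) => v /=.
by rewrite T_mapE (eq_map fi) map_id.
Qed.

Lemma T_muE V ws : T_mu V (word (map (@word V) ws)) = word (flatten ws).
Proof. by apply: etrans (pliftE _ _) _; apply: mlext_gen => n; apply: T_concat_relators. Qed.

Lemma spanning_T V (G : V -> Prop) : spanning G ->
  spanning (fun y : T V => exists v, y = word v /\ forall x, x \in v -> G x).
Proof.
move=> sG S sS SG; apply: T_ind => //.
apply: (word_multilinear_ind sG (@word_is_multilinear V) sS) => v Gv.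
by apply: SG; exists v.
Qed.

Lemma spanning_words_words V :
  spanning (fun y : T (T V) => exists ws, y = word (map (@word V) ws)).
Proof.
move=> S sS SG; apply: (spanning_T (@spanning_word V)) => // _ [v [-> Gv]].
by have [ws ->] := all_words Gv; apply: SG; exists ws.
Qed.

Lemma linear_TT_eq V W (f g : {linear T (T V) -> W}) :
  (forall ws, f (word (map (@word _) ws)) = g (word (map (@word _) ws))) -> f =1 g.
Proof.
move=> fg; apply: (linear_spanning_eq (@spanning_words_words V)) => _ [ws ->].
exact: fg.
Qed.

Definition T_unit_fun V (x : V) : T V := word [:: x].
Lemma T_unit_is_linear V : linear (@T_unit_fun V).
Proof. by move=> a x y; apply: (@word_is_multilinear V [::] [::]). Qed.
HB.instance Definition _ V :=
  GRing.isLinear.Build k V (T V) _ (@T_unit_fun V) (@T_unit_is_linear V).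
Definition T_unit V : {linear V -> T V} := @T_unit_fun V.

Lemma T_unit_natural V W (f : {linear V -> W}) x :
  T_map f (T_unit V x) = T_unit W (f x).
Proof. exact: T_mapE. Qed.

Lemma T_mu_unit V x : T_mu V (T_unit (T V) x) = x.
Proof.
apply: (linear_T_eq (f := T_mu V \o T_unit (T V)) (g := idfun)) => v.
by rewrite /= (T_muE [:: v]) /= cats0.
Qed.

Lemma T_mu_map_unit V x : T_mu V (T_map (T_unit V) x) = x.
Proof.
apply: (linear_T_eq (f := T_mu V \o T_map (T_unit V)) (g := idfun)) => v.
rewrite /= T_mapE (_ : map _ _ = map (@word _) [seq [:: x] | x <- v]); last first.
  by rewrite -map_comp.
by rewrite T_muE flatten_seq1.
Qed.

Lemma T_mu_natural V W (f : {linear V -> W}) x :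
  T_mu W (T_map (T_map f) x) = T_map f (T_mu V x).
Proof.
apply: (linear_TT_eq (f := T_mu W \o T_map (T_map f)) (g := T_map f \o T_mu V)).
move=> ws; rewrite /= T_muE !T_mapE map_flatten.
have -> : map (T_map f) (map (@word _) ws) = map (@word W) (map (map f) ws).
  by rewrite -!map_comp; apply: eq_map => w; apply: T_mapE.
by rewrite T_muE.
Qed.
End TensorFunctor.

(** * Algebra homomorphisms and the free algebra on a vector space *)

Section AlgebraMaps.
Variable k : fieldType.

Record algHom (A B : unitalAlgebra k) := AlgHom {
  alg_hom :> {linear A -> B};
  alg_homM : forall x y, alg_hom (alg_mul x y) = alg_mul (alg_hom x) (alg_hom y);
  alg_hom1 : alg_hom (alg_one A) = alg_one B }.

Lemma alg_hom_prod A B (f : algHom A B) s :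
  f (alg_prod s) = alg_prod (map f s).
Proof. by elim: s => [|x s IH] /=; rewrite ?alg_hom1 // alg_homM IH. Qed.

Lemma T_actionE (A : unitalAlgebra k) v : T_action A (word v) = alg_prod v.
Proof. exact: T_liftE. Qed.

Lemma T_action_unit (A : unitalAlgebra k) x : T_action A (T_unit A x) = x.
Proof. by rewrite T_actionE /= alg_mulr1. Qed.

Lemma T_action_natural A B (f : algHom A B) x :
  T_action B (T_map f x) = f (T_action A x).
Proof.
apply: (linear_T_eq (f := T_action B \o T_map f) (g := f \o T_action A)) => v.
by rewrite /= T_mapE !T_actionE alg_hom_prod.
Qed.

Section FreeAlgebra.
Variable V : lmodType k.

Definition T_mul (x y : T V) : T V := T_mu V (word [:: x; y]).

Lemma T_mul_linl a x y z : T_mul (a *: x + y) z = a *: T_mul x z + T_mul y z.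
Proof. by rewrite /T_mul (word_is_multilinear [::] [:: z]) linearP. Qed.

Lemma T_mul_linr a x y z : T_mul z (a *: x + y) = a *: T_mul z x + T_mul z y.
Proof. by rewrite /T_mul (word_is_multilinear [:: z] [::]) linearP. Qed.

Lemma T_mul_word u v : T_mul (word u) (word v) = word (u ++ v).
Proof. by rewrite /T_mul (T_muE [:: u; v]) /= cats0. Qed.

Lemma T_mulA : associative T_mul.
Proof.
apply: (bilinear_assoc T_mul_linl T_mul_linr (@spanning_word _ V)).
by move=> _ _ _ [u ->] [v ->] [w ->]; rewrite !T_mul_word catA.
Qed.

Lemma T_mul1 : left_id (word [::]) T_mul.
Proof.
move=> x; apply: (linear_spanning_eq (f := bilinear_l T_mul_linr (word [::]))
  (g := idfun) (@spanning_word _ V)) => _ [v ->].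
exact: T_mul_word.
Qed.

Lemma T_mulr1 : right_id (word [::]) T_mul.
Proof.
move=> x; apply: (linear_spanning_eq (f := bilinear_r T_mul_linl (word [::]))
  (g := idfun) (@spanning_word _ V)) => _ [v ->].
by rewrite -[v in RHS]cats0; apply: T_mul_word.
Qed.

Definition free_alg : unitalAlgebra k :=
  UnitalAlgebra T_mulA T_mul1 T_mulr1 T_mul_linl T_mul_linr.

Lemma free_alg_prod_words ws :
  alg_prod (map (@word _ V) ws : seq free_alg) = word (flatten ws).
Proof. by elim: ws => //= w ws ->; apply: T_mul_word. Qed.

Lemma T_action_free x : T_action free_alg x = T_mu V x.
Proof.
apply: (linear_TT_eq (f := T_action free_alg) (g := T_mu V)) => ws.
rewrite T_muE; exact: etrans (T_actionE (A := free_alg) _) (free_alg_prod_words ws).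
Qed.

End FreeAlgebra.

Section Maps.
Variables (V : lmodType k).

Lemma multiplicative_words (B : unitalAlgebra k) (f : {linear T V -> B}) :
  (forall u v, f (word (u ++ v)) = alg_mul (f (word u)) (f (word v))) ->
  forall x y, f (T_mul x y) = alg_mul (f x) (f y).
Proof.
move=> fM; apply: (@bilinear_morph k _ _ (@T_mul_linl V) (@T_mul_linr V) _
  (@spanning_word _ V) B _ (@alg_mul_linl k B) (@alg_mul_linr k B) f).
by move=> _ _ [u ->] [v ->]; rewrite T_mul_word.
Qed.

Lemma T_map_mul (W : lmodType k) (f : {linear V -> W}) x y :
  T_map f (T_mul x y) = T_mul (T_map f x) (T_map f y).
Proof.
apply: (@multiplicative_words (free_alg W)) => u v.
by rewrite !T_mapE map_cat; apply/esym/T_mul_word.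
Qed.

Definition free_alg_map (W : lmodType k) (f : {linear V -> W}) :
    algHom (free_alg V) (free_alg W) :=
  @AlgHom (free_alg V) (free_alg W) (T_map f) (T_map_mul f)
    (T_mapE f [::]).
End Maps.

Lemma T_action_mul (A : unitalAlgebra k) (x y : T A) :
  T_action A (T_mul x y) = alg_mul (T_action A x) (T_action A y).
Proof.
by apply: multiplicative_words => u v; rewrite !T_actionE alg_prod_cat.
Qed.

Definition action_hom (A : unitalAlgebra k) : algHom (free_alg A) A :=
  @AlgHom (free_alg A) A (T_action A) (@T_action_mul A) (T_actionE (A := A) [::]).

Lemma T_mu_mul (V : lmodType k) (x y : T (T V)) :
  T_mu V (T_mul x y) = T_mul (T_mu V x) (T_mu V y).
Proof. by rewrite -!T_action_free; apply: (@T_action_mul (free_alg V)). Qed.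

Lemma T_mu1 (V : lmodType k) : T_mu V (word [::]) = word [::].
Proof. exact: (T_muE [::]). Qed.

Definition mu_hom (V : lmodType k) : algHom (free_alg (T V)) (free_alg V) :=
  @AlgHom (free_alg (T V)) (free_alg V) (T_mu V) (@T_mu_mul V) (T_mu1 V).

(** On a free algebra the T-action is mu, and mu is itself an algebra homomorphism; associativity of
    the monad is then naturality of the action along mu. *)
Lemma T_mu_assoc (V : lmodType k) (x : T (T (T V))) :
  T_mu V (T_map (T_mu V) x) = T_mu V (T_mu (T V) x).
Proof.
exact: etrans (esym (T_action_free _)) (etrans (T_action_natural (mu_hom V) x)
  (congr1 (T_mu V) (T_action_free x))).
Qed.
End AlgebraMaps.

(** * The free resolution of an algebra *)

Section FreeResolution.
Variable k : fieldType.

Section Faces.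
Variable A : unitalAlgebra k.

Lemma Tpow_face0 p : Tpow_face A p 0 = Tpow_action A p.
Proof. by case: p. Qed.

(** Associativity of the action when j = 0, naturality of mu otherwise. This makes every face a map
    of T-algebras. *)
Lemma Tpow_action_face p j x : (j <= p)%N ->
  Tpow_action A p (T_map (Tpow_face A p j) x) =
  Tpow_face A p j (T_mu (Tpow A p) x).
Proof.
case: p j x => [|p] [|j] x jp.
- exact: etrans (T_action_natural (action_hom A) x) (congr1 _ (T_action_free x)).
- by exfalso; move: jp.
- exact: T_mu_assoc.
- exact: T_mu_natural.
Qed.

Lemma Tpow_faceC p i j x : (i <= j <= p)%N ->
  Tpow_face A p i (Tpow_face A p.+1 j.+1 x) =
  Tpow_face A p j (Tpow_face A p.+1 i x).
Proof.
elim: p i j x => [|p IH] [|i] j x.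
- move=> jp; rewrite !Tpow_face0; exact: Tpow_action_face.
- by move=> /andP[ij j0]; exfalso; move: (leq_trans ij j0).
- move=> jp; rewrite !Tpow_face0; exact: Tpow_action_face.
case: j => [|j] ij; first by exfalso; move: ij.
rewrite !ltnS in ij.
by apply: (T_map_square (f := Tpow_face A p.+1 j.+1)) => y; apply: IH.
Qed.

(* The algebra T^(q+1) A. *)
Definition res_alg q : unitalAlgebra k := free_alg (Tpow A q).

Lemma res_face_hom q i : (i < q.+2)%N ->
  { f : algHom (res_alg q.+1) (res_alg q) | f =1 Tpow_face A q.+1 i }.
Proof.
case: i => [|i] iq; first by exists (mu_hom (Tpow A q)).
by exists (free_alg_map (Tpow_face A q i)).
Qed.

Definition res_face q (i : 'I_q.+2) : algHom (res_alg q.+1) (res_alg q) :=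
  sval (res_face_hom (ltn_ord i)).

Lemma res_faceE q (i : 'I_q.+2) x : res_face i x = Tpow_face A q.+1 i x.
Proof. by rewrite /res_face; case: res_face_hom. Qed.

Definition res_augment : algHom (res_alg 0) A := action_hom A.

Lemma res_faceC q i j x : (i <= j < q.+2)%N ->
  res_face (inord i : 'I_q.+2) (res_face (inord j.+1 : 'I_q.+3) x) =
  res_face (inord j : 'I_q.+2) (res_face (inord i : 'I_q.+3) x).
Proof.
move=> /andP[ij jq]; have iq := leq_ltn_trans ij jq.
rewrite (res_faceE (inord i : 'I_q.+2)) (res_faceE (inord j : 'I_q.+2)).
rewrite (res_faceE (inord i : 'I_q.+3)) (res_faceE (inord j.+1 : 'I_q.+3)).
rewrite !inordK // ?(leq_trans iq) //.
by apply: (@Tpow_faceC q.+1 i j x); rewrite ij.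
Qed.

Lemma res_augment_face x :
  res_augment (res_face ord0 x) = res_augment (res_face (lift ord0 ord0) x).
Proof.
rewrite (res_faceE ord0) (res_faceE (lift ord0 ord0)).
apply/esym; exact: (@Tpow_faceC 0 0 0 x isT).
Qed.

(** The unit of the outermost T is the extra degeneracy of the resolution. It is linear but not
    multiplicative, so it acts on both complexes only through their extensions to linear maps,
    [bar_lmap] and [flat_map]. *)
Lemma res_face0_unit q x : res_face (ord0 : 'I_q.+2) (T_unit (Tpow A q.+1) x) = x.
Proof. by rewrite (res_faceE ord0); apply: T_mu_unit. Qed.

Lemma res_face1_unit x :
  res_face (lift ord0 ord0 : 'I_2) (T_unit (Tpow A 1) x) =
  T_unit (Tpow A 0) (res_augment x).
Proof.
rewrite (res_faceE (lift ord0 ord0)).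
exact: (T_unit_natural (Tpow_face A 0 0)).
Qed.

Lemma res_faceS_unit q (i : 'I_q.+2) x :
  res_face (lift ord0 i) (T_unit (Tpow A q.+2) x) =
  T_unit (Tpow A q.+1) (res_face i x).
Proof.
rewrite (res_faceE (lift ord0 i)) (res_faceE i) lift0.
exact: (T_unit_natural (Tpow_face A q.+1 i)).
Qed.

Lemma res_augment_unit x : res_augment (T_unit (Tpow A 0) x) = x.
Proof. exact: T_action_unit. Qed.
End Faces.

Section Functoriality.
Variables (A B : unitalAlgebra k) (f : {linear A -> B}).

Fixpoint Tpow_map p : {linear Tpow A p -> Tpow B p} :=
  if p is p'.+1 then T_map (Tpow_map p') else f.
End Functoriality.

Lemma Tpow_map_face (A B : unitalAlgebra k) (f : algHom A B) p i x :
  (i <= p)%N ->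
  Tpow_face B p i (Tpow_map f p.+1 x) = Tpow_map f p (Tpow_face A p i x).
Proof.
elim: p i x => [|p IH] [|i] x ip //=.
- exact: T_action_natural.
- exact: T_mu_natural.
by apply: (T_map_square (f := Tpow_map f p.+1)) => y; apply: IH.
Qed.

Section Abelianization.

(** These relators are the products [x, y] z. Their span is already the two-sided commutator ideal,
    because w [x, y] = [w x, y] - [w, y] x. *)
Inductive comm_rel (A : unitalAlgebra k) : A -> Prop :=
  CommRel x y z : comm_rel (alg_prod [:: x; y; z] - alg_prod [:: y; x; z]).

Definition ab (A : unitalAlgebra k) : lmodType k := quotmod (@comm_rel A).
Definition to_ab (A : unitalAlgebra k) : {linear A -> ab A} := qpi (@comm_rel A).

(** A relator is an exchange of two adjacent blocks at the head of a product, and such exchanges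
    generate all permutations. *)
Lemma to_ab_perm (A : unitalAlgebra k) (s t : seq A) :
  perm_eq s t -> to_ab A (alg_prod s) = to_ab A (alg_prod t).
Proof.
apply: (catCA_perm_subst (F := fun s => to_ab A (alg_prod s))) => s1 s2 s3.
apply/(qpiP (@comm_rel A)); apply: sub_spanned.
have := CommRel (alg_prod s1) (alg_prod s2) (alg_prod s3).
by rewrite !alg_prod_cat /= !alg_mulr1.
Qed.

Section Map.
Variables (A B : unitalAlgebra k) (f : algHom A B).

Lemma ab_map_subproof r : comm_rel r -> (to_ab B \o f) r = 0.
Proof.
case=> x y z.
change (to_ab B (f (alg_prod [:: x; y; z] - alg_prod [:: y; x; z])) = 0).
by rewrite linearB !alg_hom_prod; apply: qpi_rel; apply: CommRel.
Qed.

Definition ab_map : {linear ab A -> ab B} := qlift ab_map_subproof.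

Lemma ab_mapE x : ab_map (to_ab A x) = to_ab B (f x).
Proof. exact: qliftE ab_map_subproof x. Qed.
End Map.

Lemma to_ab_eq0 (A : unitalAlgebra k) (S : A -> Prop) x : subspace S ->
  (forall x y z, S (alg_prod [:: x; y; z] - alg_prod [:: y; x; z])) ->
  to_ab A x = 0 -> S x.
Proof.
move=> sS Sc; rewrite -[0](linear0 (to_ab A)) => /qpiP; rewrite subr0.
by apply: spanned_ind => // _ [].
Qed.

Lemma to_ab_onto (A : unitalAlgebra k) y : exists x, to_ab A x = y.
Proof. by exists (qrepr y); apply: qreprK. Qed.
End Abelianization.
End FreeResolution.

(** * Permutations and blocks *)

Section Permutations.

Definition perms n := permutations (iota 0 n).

Lemma mem_perms n g : (g \in perms n) = is_oneline n g.
Proof. exact: mem_permutations. Qed.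

Lemma size_perms n : size (perms n) = n`!.
Proof. by rewrite size_permutations ?iota_uniq ?size_iota. Qed.

Lemma sum_perms (V : nmodType) n (f : seq nat -> seq nat) (F : seq nat -> V) :
  (forall g, is_oneline n g -> is_oneline n (f g)) ->
  {in is_oneline n &, injective f} ->
  \sum_(g <- perms n) F (f g) = \sum_(g <- perms n) F g.
Proof.
move=> fn fi; rewrite -(big_map f xpredT F); apply: perm_big.
have u : uniq (map f (perms n)).
  rewrite map_inj_in_uniq ?permutations_uniq // => g h.
  by rewrite !mem_perms; apply: fi.
apply: uniq_perm => //; first exact: permutations_uniq.
have sub : {subset map f (perms n) <= perms n}.
  by move=> _ /mapP[g gn ->]; rewrite mem_perms; apply: fn; rewrite -mem_perms.
by have [|_] := uniq_min_size u sub; first by rewrite size_map.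
Qed.

Lemma oneline_reindex_inj n h : is_oneline n h ->
  {in is_oneline n &, injective (reindex 0%N h)}.
Proof.
move=> hh g g' hg hg' /eqP; rewrite eq_sym => /eqP gg.
have hu : uniq h by rewrite (perm_uniq hh) iota_uniq.
apply: (@eq_from_nth _ 0%N) => [|i ig].
  by rewrite !(@is_oneline_size n).
have := congr1 (fun s => nth 0%N s i) gg.
have ig' : (i < size g')%N by rewrite (@is_oneline_size n) // -(@is_oneline_size n g).
rewrite /reindex !(nth_map 0%N) // => /eqP; rewrite nth_uniq //.
- by move/eqP.
- by rewrite (is_oneline_size hh) (is_oneline_lt hg') // mem_nth.
- by rewrite (is_oneline_size hh) (is_oneline_lt hg) // mem_nth.
Qed.

(** The block permutation determined by the sizes alone. It is what operad composition becomes when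
    the inner permutations are identities, as they are on the image of T in D. *)
Definition blocks (h ns : seq nat) := operad_comp h (map (iota 0) ns).

Lemma reindex_blocks (X : Type) (x0 : X) (w : seq (seq X)) h :
  is_oneline (size w) h ->
  reindex x0 (flatten w) (blocks h (shape w)) = flatten (reindex [::] w h).
Proof.
move=> hh; pose ts := map (iota 0) (shape w).
have sz : map size ts = shape w.
  by rewrite -map_comp map_id_in // => n _; rewrite /= size_iota.
rewrite -(@reindex_permute_blocks _ x0 w h ts) //; last first.
  by rewrite !size_map.
rewrite /permute_blocks /blocks; congr (reindex _ _ (operad_comp _ _)).
by rewrite -[in LHS]sz -map_comp.
Qed.

Lemma is_oneline_blocks h ns : is_oneline (size ns) h ->
  is_oneline (sumn ns) (blocks h ns).
Proof.
move=> hh; have -> : sumn ns = size (flatten (map (iota 0) ns)).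
  rewrite size_flatten; congr sumn; rewrite /shape -map_comp.
  by rewrite map_id_in // => n _; rewrite /= size_iota.
apply: is_oneline_operad_comp; first by rewrite size_map.
by move=> _ /mapP[n _ ->]; rewrite size_iota is_oneline_iota.
Qed.

Lemma reindex_iota n h : is_oneline n h -> reindex 0%N (iota 0 n) h = h.
Proof.
move=> hh; rewrite -[RHS]map_id; apply/eq_in_map => i ih.
by rewrite nth_iota // (is_oneline_lt hh).
Qed.

Lemma blocksE h w : is_oneline (size w) h -> flatten w = iota 0 (size (flatten w)) ->
  blocks h (shape w) = flatten (reindex [::] w h).
Proof.
move=> hh ww; rewrite -(reindex_blocks 0%N) // ww reindex_iota //.
by rewrite size_flatten; apply: is_oneline_blocks; rewrite size_map.
Qed.

Lemma blocks_nseq1 n h : is_oneline n h -> blocks h (nseq n 1%N) = h.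
Proof.
move=> hh; have := @blocksE h (map (fun i => [:: i]) (iota 0 n)).
rewrite size_map size_iota flatten_seq1 size_iota => /(_ hh erefl).
have -> : shape [seq [:: i] | i <- iota 0 n] = nseq n 1%N.
  rewrite /shape -map_comp (eq_map (g := fun=> 1%N)) //.
  by rewrite -[in RHS](size_iota 0 n); elim: (iota 0 n) => //= _ s ->.
move->; rewrite -[RHS]flatten_seq1; congr flatten; apply/eq_in_map => i ih.
by rewrite (nth_map 0%N) ?size_iota ?nth_iota // (is_oneline_lt hh).
Qed.

Lemma flatten_map_flatten (X : Type) (W : seq (seq (seq X))) :
  flatten (map flatten W) = flatten (flatten W).
Proof. by elim: W => //= ws W IH; rewrite flatten_cat IH. Qed.

(** Both sides list the entries of one interval cut into nested blocks, so each reduces to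
    flattening the same doubly nested list. This is the combinatorial content of the associativity
    of the T-action on D. *)
Lemma blocks_blocks (X : Type) (wss : seq (seq (seq X))) h :
  is_oneline (size wss) h ->
  blocks (blocks h (shape wss)) (shape (flatten wss)) =
  blocks h [seq size (flatten ws) | ws <- wss].
Proof.
move=> hh; set ms := shape (flatten wss).
(* A numerical model of [wss]: the interval is cut along the inner sizes, and then grouped along the
   outer ones. *)
pose w := reshape ms (iota 0 (sumn ms)).
have sw : shape w = ms by rewrite reshapeKl ?size_iota.
have fw : flatten w = iota 0 (sumn ms) by rewrite reshapeKr ?size_iota.
have szw : size w = sumn (shape wss).
  by rewrite -(size_map size) -/(shape w) sw size_map size_flatten.
pose W := reshape (shape wss) w.
have sW : shape W = shape wss by rewrite reshapeKl ?szw.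
have fW : flatten W = w by rewrite reshapeKr ?szw.
have szW : size W = size wss by rewrite -(size_map size) -/(shape W) sW size_map.
have -> : [seq size (flatten ws) | ws <- wss] = shape (map flatten W).
  (* The total sizes depend only on the two shapes, which [wss] shares with its model. *)
  have E (Y : Type) (zss : seq (seq (seq Y))) : [seq size (flatten ws) | ws <- zss] =
      map sumn (reshape (shape zss) (shape (flatten zss))).
    elim: zss => //= zs zss IH; rewrite /shape map_cat take_size_cat ?size_map //.
    by rewrite drop_size_cat ?size_map // IH size_flatten.
  by rewrite /shape -map_comp (E _ W) (E _ wss) fW sw sW.
rewrite -[in LHS]sw blocksE ?sw ?fw ?size_iota //; last first.
  by rewrite szw; apply: is_oneline_blocks; rewrite size_map.
rewrite -[w in LHS]fW -[in LHS]sW reindex_blocks ?szW //.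
rewrite blocksE ?size_map ?szW //; last first.
  by rewrite flatten_map_flatten fW fw size_iota.
rewrite /reindex.
have -> : [seq nth [::] [seq flatten i | i <- W] a | a <- h] =
   map flatten [seq nth [::] W a | a <- h].
  rewrite -map_comp; apply/eq_in_map => a ah.
  by rewrite (nth_map [::]) // szW (is_oneline_lt hh).
by rewrite flatten_map_flatten.
Qed.
End Permutations.

(** * The functor D *)

Section DFunctor.
Variables (k : fieldType) (q : nat).
Implicit Types (U V W : lmodType k) (s : q.+1.-tuple (seq nat)).

Definition valid_simplex n s := all (is_oneline n) s.

Lemma Dsym_invalid V s (v : seq V) :
  ~~ valid_simplex (size v) s -> Dsym s v = 0.
Proof. by move=> sv; rewrite /Dsym /symb insubN ?linear0. Qed.

Lemma Dsym_multilinear V s : word_multilinear (@Dsym k q V s).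
Proof. by move=> u w a x y; apply: Dsym_lin. Qed.

Lemma gen_symbol V (c : symbol q V) :
  gen (@D_rel k q V) c = Dsym (val c).1 (val c).2.
Proof. by case: c => -[s v] sv; rewrite /Dsym /symb insubT. Qed.

Lemma D_ind V (S : D q V -> Prop) : subspace S ->
  (forall s v, valid_simplex (size v) s -> S (Dsym s v)) -> forall x, S x.
Proof.
move=> sS SD; apply: presented_ind => // c.
by rewrite gen_symbol; apply: SD; apply: valP c.
Qed.

Lemma D_spanning_ind V (G : V -> Prop) (S : D q V -> Prop) :
  spanning G -> subspace S ->
  (forall s v, valid_simplex (size v) s -> (forall x, x \in v -> G x) ->
     S (Dsym s v)) -> forall x, S x.
Proof.
move=> sG sS SG; apply: D_ind => // s v _.
apply: (word_multilinear_ind sG (@Dsym_multilinear V s) sS) => {}v Gv.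
case: (boolP (valid_simplex (size v) s)) => sv; first exact: SG.
by rewrite Dsym_invalid //; apply: sS.1.
Qed.

Lemma D_mapE V W (f : {linear V -> W}) s v :
  D_map q f (Dsym s v) = Dsym s (map f v).
Proof.
case: (boolP (valid_simplex (size v) s)) => sv; first exact: D_liftE.
by rewrite !Dsym_invalid ?linear0 // size_map.
Qed.

Lemma D_map_square U V V' W (g : {linear V -> W}) (f : {linear U -> V})
    (g' : {linear V' -> W}) (f' : {linear U -> V'}) :
  (forall x, g (f x) = g' (f' x)) ->
  forall x, D_map q g (D_map q f x) = D_map q g' (D_map q f' x).
Proof.
move=> gf x.
move: x; apply: D_ind => [|s v sv].
  by apply: eq_subspace => a u v; rewrite ?linearP.
by rewrite !D_mapE -!map_comp (eq_map gf).
Qed.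

Lemma D_map_comp U V W (h : {linear U -> W}) (g : {linear V -> W})
    (f : {linear U -> V}) : (forall x, h x = g (f x)) ->
  forall x, D_map q h x = D_map q g (D_map q f x).
Proof.
move=> hgf x.
move: x; apply: D_ind => [|s v sv].
  by apply: eq_subspace => a u v; rewrite ?linearP.
by rewrite !D_mapE (eq_map hgf) map_comp.
Qed.

Lemma D_map_id V (f : {linear V -> V}) : (forall v, f v = v) ->
  forall x, D_map q f x = x.
Proof.
move=> fi x; move: x; apply: D_ind => [|s v sv].
  by apply: eq_subspace => a u v; rewrite ?linearP.
by rewrite D_mapE (eq_map fi) map_id.
Qed.

Lemma D_muE V s (cs : seq (symbol q V)) : valid_simplex (size cs) s ->
  D_mu q V (Dsym s [seq Dsym (val c).1 (val c).2 | c <- cs]) = D_comp s cs.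
Proof.
move=> hs; have -> : [seq Dsym (val c).1 (val c).2 | c <- cs] =
    [seq gen (@D_rel k q V) c | c <- cs].
  by apply: eq_map => c; rewrite gen_symbol.
apply: etrans (D_liftE _ _) _; first by rewrite size_map.
(* [mlext_gen] wants relators killed in words of every length, whereas [D_comp s] is known to kill
   them only in words of length [size cs]. Elsewhere it is replaced by 0. *)
pose g (ds : seq (symbol q V)) : D q V :=
  if size ds == size cs then D_comp s ds else 0.
have gE ds : size ds = size cs -> D_comp s ds = g ds by rewrite /g => ->; rewrite eqxx.
rewrite gE //= -[RHS](@mlext_gen _ _ _ (@D_rel k q V)); last first.
  move=> n xs ys r sxy Rr; have [ns|ns] := eqVneq n.+1 (size cs).
    have hs' : valid_simplex n.+1 s by rewrite ns.
    apply: etrans _ (D_comp_relators hs' sxy Rr).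
    by apply: eq_linext => x; rewrite -gE // size_cat /= addnS -size_cat sxy ns.
  apply: etrans _ (linext0 _ r); apply: eq_linext => x; rewrite /g.
  by rewrite size_cat /= addnS -size_cat sxy (negbTE ns).
by apply: eq_mlext_free => xs; rewrite !size_map; apply: gE.
Qed.

Definition block_simplex s ns : q.+1.-tuple (seq nat) :=
  [tuple blocks (tnth s r) ns | r < q.+1].

Lemma valid_tnth n s r : valid_simplex n s -> is_oneline n (tnth s r).
Proof. by move/allP; apply; apply: mem_tnth. Qed.

Lemma valid_block_simplex s ns : valid_simplex (size ns) s ->
  valid_simplex (sumn ns) (block_simplex s ns).
Proof.
move=> hs; apply/allP => _ /mapP[r _ ->]; apply: is_oneline_blocks.
exact: valid_tnth.
Qed.

Lemma T_to_DE V (v : seq V) : T_to_D q V (word v) = Dsym (id_simplex q (size v)) v.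
Proof. exact: T_liftE. Qed.

Lemma D_actE V s (ws : seq (seq V)) : valid_simplex (size ws) s ->
  D_act q V (Dsym s (map (@word k V) ws)) =
  Dsym (block_simplex s (shape ws)) (flatten ws).
Proof.
move=> hs; rewrite /D_act /=.
have vw (w : seq V) : is_symbol (id_simplex q (size w), w).
  by rewrite /is_symbol all_nseq is_oneline_iota orbT.
pose c w : symbol q V := Sub (id_simplex q (size w), w) (vw w).
apply: (etrans (congr1 (D_mu q V) (D_mapE _ _ _))).
have -> : map (T_to_D q V) (map (@word k V) ws) =
    [seq Dsym (val d).1 (val d).2 | d <- map c ws].
  by rewrite -!map_comp; apply: eq_map => w; apply: T_to_DE.
rewrite D_muE ?size_map // /D_comp.
have -> : symbol_word (map c ws) = flatten ws.
  by rewrite /symbol_word -map_comp /= map_id.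
congr Dsym; apply: eq_from_tnth => r; rewrite !tnth_mktuple.
congr operad_comp; rewrite /symbol_perms -!map_comp; apply: eq_map => w /=.
by rewrite (tnth_nth [::]) nth_nseq ltn_ord.
Qed.

Lemma D_act_natural V W (f : {linear V -> W}) x :
  D_act q W (D_map q (T_map f) x) = D_map q f (D_act q V x).
Proof.
move: x; apply: (D_spanning_ind (@spanning_word k V)) => [|s v sv Gv].
  by apply: eq_subspace => a u v; rewrite ?linearP.
have [ws wv] := all_words Gv; move: sv; rewrite {}wv size_map => sv.
rewrite (D_actE sv) !D_mapE.
have -> : map (T_map f) (map (@word _ V) ws) = map (@word _ W) (map (map f) ws).
  by rewrite -!map_comp; apply: eq_map => w; apply: T_mapE.
rewrite D_actE ?size_map // map_flatten; congr Dsym.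
by rewrite /shape -map_comp (eq_map (g := size)) // => w; rewrite /= size_map.
Qed.

Lemma D_act_assoc V x :
  D_act q V (D_map q (T_mu V) x) = D_act q V (D_act q (T V) x).
Proof.
move: x; apply: (D_spanning_ind (@spanning_words_words k V)) => [|s v sv Gv].
  by apply: eq_subspace => a u v; rewrite ?linearP.
have [wss vE] : exists wss, v = map (fun ws => word (map (@word k V) ws)) wss.
  elim: v Gv {sv} => [|y v IH] Gv; first by exists [::].
  have [|ws ->] := Gv y; first by rewrite inE eqxx.
  have [|wss ->] := IH; last by exists (ws :: wss).
  by move=> x' xv; apply: Gv; rewrite inE xv orbT.
move: sv; rewrite {}vE size_map => sv; rewrite D_mapE -map_comp.
have -> : map (T_mu V \o (fun ws => word (map (@word k V) ws))) wss =
    map (@word k V) (map flatten wss).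
  by rewrite -map_comp; apply: eq_map => ws; apply: T_muE.
rewrite D_actE ?size_map //.
have -> : map (fun ws => word (map (@word k V) ws)) wss =
    map (@word k (T V)) (map (map (@word k V)) wss) by rewrite -map_comp.
rewrite D_actE ?size_map // -map_flatten.
have -> : shape (map (map (@word k V)) wss) = shape wss.
  by rewrite /shape -map_comp; apply: eq_map => w; rewrite /= size_map.
rewrite D_actE; last first.
  by rewrite size_flatten; apply: valid_block_simplex; rewrite size_map.
rewrite flatten_map_flatten; congr Dsym; apply: eq_from_tnth => r.
rewrite !tnth_mktuple blocks_blocks; last exact: valid_tnth.
by rewrite /shape -map_comp.
Qed.

Lemma D_act_unit V x : D_act q V (D_map q (T_unit V) x) = x.
Proof.
move: x; apply: D_ind => [|s v sv].
  by apply: eq_subspace => a u v; rewrite ?linearP.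
rewrite D_mapE.
have -> : map (T_unit V) v = map (@word k V) [seq [:: x] | x <- v].
  by rewrite -map_comp.
rewrite D_actE ?size_map // flatten_seq1; congr Dsym.
apply: eq_from_tnth => r; rewrite tnth_mktuple.
have -> : shape [seq [:: x] | x <- v] = nseq (size v) 1%N.
  by elim: (v) => //= _ u ->.
by apply: blocks_nseq1; apply: valid_tnth.
Qed.
End DFunctor.

Section Faces.
Variables (k : fieldType) (q : nat).
Implicit Types (V W : lmodType k).

Lemma D_faceE V (i : 'I_q.+2) s (v : seq V) : valid_simplex (size v) s ->
  D_face V i (Dsym s v) = Dsym (delete i s) v.
Proof. by move=> sv; apply: D_liftE. Qed.

Lemma D_face_natural V W (f : {linear V -> W}) (i : 'I_q.+2) x :
  D_face W i (D_map q.+1 f x) = D_map q f (D_face V i x).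
Proof.
move: x; apply: D_ind => [|s v sv].
  by apply: eq_subspace => a u v; rewrite ?linearP.
by rewrite D_mapE !D_faceE ?size_map // D_mapE.
Qed.

Lemma D_face_act V (i : 'I_q.+2) x :
  D_face V i (D_act q.+1 V x) = D_act q V (D_face (T V) i x).
Proof.
move: x; apply: (D_spanning_ind (@spanning_word k V)) => [|s v sv Gv].
  by apply: eq_subspace => a u v; rewrite ?linearP.
have [ws wv] := all_words Gv; move: sv; rewrite {}wv size_map => sv.
rewrite (D_actE sv) !D_faceE ?size_map // ?D_actE //.
- by congr Dsym; apply: eq_from_tnth => r; rewrite !tnth_mktuple.
- exact: all_delete.
- by rewrite size_flatten; apply: valid_block_simplex; rewrite size_map.
Qed.
End Faces.

Lemma D_faceC (k : fieldType) q (V : lmodType k) (i j : nat) (x : D q.+2 V) :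
  (i <= j < q.+2)%N ->
  D_face V (inord i : 'I_q.+2) (D_face V (inord j.+1 : 'I_q.+3) x) =
  D_face V (inord j : 'I_q.+2) (D_face V (inord i : 'I_q.+3) x).
Proof.
move=> /andP[ij jq].
move: x; apply: D_ind => [|s v sv].
  by apply: eq_subspace => a u v; rewrite ?linearP.
rewrite !(D_faceE _ sv) !D_faceE; try exact: all_delete.
congr Dsym; apply: eq_from_tnth => r.
rewrite !tnth_mktuple; congr tnth; apply: val_inj => /=.
rewrite !inordK //; try lia; try exact: (leq_trans (leq_ltn_trans ij jq)).
  by rewrite /bump; case: (leqP i r); case: (leqP j r) => /=; lia.
Qed.

(** * Averaging *)

Section Averaging.
Variables (k : fieldType) (char0 : [pchar k] =i pred0) (q : nat).
Implicit Types (U V W : lmodType k) (s : q.+1.-tuple (seq nat)).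

Lemma fact_neq0 n : (n`!)%:R != 0 :> k.
Proof. by have/pcharf0P-> := char0; rewrite -lt0n fact_gt0. Qed.

Definition append_perm s g : q.+2.-tuple (seq nat) := [tuple of rcons s g].

Lemma valid_append n s g : valid_simplex n s -> is_oneline n g ->
  valid_simplex n (append_perm s g).
Proof. by move=> vs vg; rewrite /valid_simplex /= all_rcons vg. Qed.

(** Appending one fixed permutation is not compatible with the relation [h s; v] = [s; v h]. Summing
    over all g is, since left multiplication by h permutes the summands; dividing by n! makes the
    last face a left inverse. *)
Definition average_fun V s (v : seq V) : D q.+1 V :=
  ((size v)`!%:R)^-1 *: \sum_(g <- perms (size v)) Dsym (append_perm s g) v.

Lemma average_compatible V : D_compatible (@average_fun V).
Proof.
split=> [s u w a x y _|s v h vs vh].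
  rewrite /average_fun !size_cat /= scalerA mulrC -scalerA -scalerDr.
  congr (_ *: _); rewrite scaler_sumr -big_split; apply: eq_bigr => g _.
  exact: Dsym_lin.
rewrite /average_fun size_reindex (is_oneline_size vh); congr (_ *: _).
rewrite -(@sum_perms _ _ (reindex 0%N h)); last exact (oneline_reindex_inj vh).
  rewrite big_seq [RHS]big_seq; apply: eq_bigr => g; rewrite mem_perms => vg.
  rewrite -(Dsym_equiv (valid_append vs vg) vh); congr Dsym.
  by apply: val_inj; rewrite /= map_rcons.
by move=> g; apply: is_oneline_reindex.
Qed.

Definition average V : {linear D q V -> D q.+1 V} := D_lift (average_compatible V).

Lemma averageE V s (v : seq V) : valid_simplex (size v) s ->
  average V (Dsym s v) = average_fun s v.
Proof. exact: D_liftE. Qed.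

Lemma average_natural V W (f : {linear V -> W}) x :
  average W (D_map q f x) = D_map q.+1 f (average V x).
Proof.
move: x; apply: D_ind => [|s v vs].
  by apply: eq_subspace => a u v; rewrite ?linearP.
rewrite D_mapE !averageE ?size_map // /average_fun linear_scale_sum size_map.
by congr (_ *: _); apply: eq_bigr => g _; rewrite D_mapE.
Qed.

Lemma delete_last s g : delete ord_max (append_perm s g) = s.
Proof.
apply: eq_from_tnth => r; rewrite tnth_mktuple !(tnth_nth [::]) /=.
by rewrite nth_rcons size_tuple /bump (leqNgt q.+1 r) ltn_ord /= add0n ltn_ord.
Qed.

Lemma average_face_last V x : D_face V ord_max (average V x) = x.
Proof.
move: x; apply: D_ind => [|s v vs].
  by apply: eq_subspace => a u v; rewrite ?linearP.
rewrite averageE // linear_scale_sum big_seq.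
rewrite (eq_bigr (fun=> Dsym s v)) => [|g]; last first.
  rewrite mem_perms => vg.
  by rewrite D_faceE; [rewrite delete_last | apply: valid_append].
rewrite -big_seq big_const_seq count_predT iter_addr_0 size_perms.
by rewrite -scaler_nat scalerA mulVf ?fact_neq0 // scale1r.
Qed.
End Averaging.

(** A face other than the last one leaves the appended permutation in place. *)
Lemma average_face (k : fieldType) q (V : lmodType k) (i : 'I_q.+2) (x : D q.+1 V) :
  D_face V (lift ord_max i) (average q.+1 V x) = average q V (D_face V i x).
Proof.
move: x; apply: D_ind => [|s v vs].
  by apply: eq_subspace => a u v; rewrite ?linearP.
rewrite averageE // D_faceE // averageE; last exact: all_delete.
rewrite linear_scale_sum; congr (_ *: _); rewrite big_seq [RHS]big_seq.
apply: eq_bigr => g; rewrite mem_perms => vg.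
rewrite D_faceE; last exact: valid_append.
congr Dsym; apply: eq_from_tnth => r; rewrite tnth_mktuple !(tnth_nth [::]) /=.
have lt : (i < q.+2)%N by []; have ltr := ltn_ord r.
rewrite !nth_rcons /bump !size_tuple ?card_ord [(q.+2 <= i)%N]leqNgt lt add0n.
have [rq|rq] := ltnP r q.+1.
  rewrite (_ : ((i <= r) + r < q.+2)%N); last by case: (i <= r)%N; lia.
  have := tnth_nth [::] (delete i s) (Ordinal rq).
  by rewrite tnth_mktuple (tnth_nth [::]) => <-.
have -> : r = q.+1 :> nat by lia.
by rewrite (_ : (i <= q.+1)%N) // add1n !ltnn !eqxx.
Qed.

(** * Simplicial identities and functoriality of the bar construction *)

Section BarIdentities.
Variable k : fieldType.

Section Algebra.
Variable A : unitalAlgebra k.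

Lemma bar_hface_face q p j (i : 'I_q.+2) x :
  D_face (Tpow A p) i (bar_hface A q.+1 p j x) =
  bar_hface A q p j (D_face (Tpow A p.+1) i x).
Proof. by case: j => [|j]; [apply: D_face_act | apply: D_face_natural]. Qed.

Lemma bar_hfaceC q p i j x : (i <= j <= p.+1)%N ->
  bar_hface A q p i (bar_hface A q p.+1 j.+1 x) =
  bar_hface A q p j (bar_hface A q p.+1 i x).
Proof.
case: i j => [|i] [|j] ij.
- exact: D_act_assoc.
- exact: (D_act_natural (Tpow_face A p j)).
- by exfalso; move: ij.
- apply: (D_map_square (f := Tpow_face A p.+1 j.+1) (f' := Tpow_face A p.+1 i)).
  by move=> y; apply: Tpow_faceC.
Qed.

Lemma bar_faceE p (i : 'I_p.+2) x :
  bar_face A i x = D_face (Tpow A p) i (bar_hface A p.+1 p i x).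
Proof. by []. Qed.

Lemma bar_faceC p i j (x : bar A p.+2) : (i <= j < p.+2)%N ->
  bar_face A (inord i : 'I_p.+2) (bar_face A (inord j.+1 : 'I_p.+3) x) =
  bar_face A (inord j : 'I_p.+2) (bar_face A (inord i : 'I_p.+3) x).
Proof.
move=> /andP[ij jp]; have ip := leq_ltn_trans ij jp.
have E (c : 'I_p.+2) (d : 'I_p.+3) : bar_face A c (bar_face A d x) =
    D_face (Tpow A p) c (D_face (Tpow A p) d
      (bar_hface A p.+2 p c (bar_hface A p.+2 p.+1 d x))).
  exact (congr1 (D_face (Tpow A p) c) (esym (@bar_hface_face p.+1 p c d _))).
rewrite (E (inord i) (inord j.+1)) (E (inord j) (inord i)).
have H : bar_hface A p.+2 p (inord i : 'I_p.+2)
      (bar_hface A p.+2 p.+1 (inord j.+1 : 'I_p.+3) x) =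
    bar_hface A p.+2 p (inord j : 'I_p.+2)
      (bar_hface A p.+2 p.+1 (inord i : 'I_p.+3) x).
  rewrite (inordK ip) (inordK (jp : (j.+1 < p.+3)%N)) (inordK jp).
  rewrite (inordK (leqW ip)).
  by apply: bar_hfaceC; rewrite ij.
have ijp : (i <= j < p.+2)%N by rewrite ij.
exact (etrans (D_faceC _ ijp) (congr1 (fun y =>
  D_face (Tpow A p) (inord j : 'I_p.+2) (D_face (Tpow A p) (inord i : 'I_p.+3) y)) H)).
Qed.

Lemma bar_diff_sqr p x : bar_diff A p (bar_diff A p.+1 x) = 0.
Proof.
exact: (@face_diff_sqr k (bar A) (@bar_face k A)
  (fun q i j x => @bar_faceC q i j x)).
Qed.
End Algebra.

Section Map.
Variables (A B : unitalAlgebra k) (f : algHom A B).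

Definition bar_map p : {linear bar A p -> bar B p} := D_map p (Tpow_map f p).

Lemma bar_map_face p (i : 'I_p.+2) x :
  bar_face B i (bar_map p.+1 x) = bar_map p (bar_face A i x).
Proof.
apply: etrans _ (D_face_natural (Tpow_map f p) i _).
congr (D_face _ _ _).
case: i => -[|i] ip; first exact: (D_act_natural (Tpow_map f p)).
apply: (D_map_square (f := Tpow_map f p.+1) (f' := Tpow_face A p i)) => y.
exact: Tpow_map_face.
Qed.

Lemma bar_map_diff p x :
  bar_diff B p (bar_map p.+1 x) = bar_map p (bar_diff A p x).
Proof.
by apply: (alternating_sum_natural (g := bar_map p.+1)) => i y; apply: bar_map_face.
Qed.
End Map.
End BarIdentities.

(** * The bar construction in degree zero *)

Section BarDegreeZero.
Variables (k : fieldType) (B : unitalAlgebra k).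

Lemma perm_reindex (X : eqType) (x0 : X) (v : seq X) h :
  is_oneline (size v) h -> perm_eq (reindex x0 v h) v.
Proof.
move=> vh; rewrite -[X in perm_eq _ X](take_size v) -(map_nth_iota0 x0) //.
exact: perm_map.
Qed.

Lemma bar_to_ab_compatible :
  D_compatible (fun (s : 1.-tuple (seq nat)) (v : seq B) => to_ab B (alg_prod v)).
Proof.
split=> [s u w a x y _|s v h vs vh]; first by rewrite alg_prod_multilinear linearP.
by apply/esym/to_ab_perm/perm_reindex.
Qed.

Definition bar_to_ab : {linear bar B 0 -> ab B} := D_lift bar_to_ab_compatible.

Lemma bar_to_abE (s : 1.-tuple (seq nat)) v : valid_simplex (size v) s ->
  bar_to_ab (Dsym s v) = to_ab B (alg_prod v).
Proof. exact: D_liftE. Qed.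

Lemma bar_diff0E (s : 2.-tuple (seq nat)) (ws : seq (seq B)) :
  valid_simplex (size ws) s ->
  bar_diff B 0 (Dsym s (map (@word k B) ws)) =
  Dsym (delete ord0 (block_simplex s (shape ws))) (flatten ws) -
  Dsym (delete ord_max s) (map (@alg_prod k B) ws).
Proof.
move=> vs; have d0 : bar_face B ord0 (Dsym s (map (@word k B) ws)) =
    Dsym (delete ord0 (block_simplex s (shape ws))) (flatten ws).
  apply: etrans (congr1 (D_face B ord0) (D_actE vs)) _.
  apply: D_faceE; rewrite size_flatten; apply: valid_block_simplex.
  by rewrite size_map.
have d1 : bar_face B ord_max (Dsym s (map (@word k B) ws)) =
    Dsym (delete ord_max s) (map (@alg_prod k B) ws).
  apply: etrans (congr1 (D_face B ord_max) (D_mapE (T_action B) _ _)) _.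
  rewrite (_ : map (T_action B) _ = map (@alg_prod k B) ws); last first.
    by rewrite -map_comp; apply: eq_map => w; apply: T_actionE.
  by apply: D_faceE; rewrite size_map.
rewrite -d0 -d1; apply: etrans (big_ord_recl _ _) _; rewrite big_ord1.
rewrite expr0 scale1r (_ : lift ord0 ord0 = ord_max); last exact: val_inj.
by rewrite expr1 scaleN1r.
Qed.

Lemma bar_to_ab_diff x : bar_to_ab (bar_diff B 0 x) = 0.
Proof.
move: x; apply: (D_spanning_ind (@spanning_word k B)) => [|s v vs Gv].
  by apply: eq_subspace => a u v; rewrite ?linearP // scaler0 addr0.
have [ws wv] := all_words Gv; move: vs; rewrite {}wv size_map => vs.
have v0 : valid_simplex (size (flatten ws))
    (delete ord0 (block_simplex s (shape ws))).
  by apply: all_delete; rewrite size_flatten; apply: valid_block_simplex;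
    rewrite size_map.
have v1 : valid_simplex (size (map (@alg_prod k B) ws)) (delete ord_max s).
  by apply: all_delete; rewrite size_map.
rewrite (bar_diff0E vs) linearB (bar_to_abE v0) (bar_to_abE v1).
by rewrite alg_prod_flatten subrr.
Qed.

Lemma bar_to_ab_onto y : exists x, bar_to_ab x = y.
Proof.
have [x <-] := to_ab_onto y; exists (Dsym (id_simplex 0 1) [:: x]).
by rewrite bar_to_abE //= alg_mulr1.
Qed.

Let bnd := in_image (bar_diff B 0).
Let bnd_subspace : subspace bnd. Proof. exact: in_image_subspace. Qed.

Definition bar_point_fun (x : B) : bar B 0 := Dsym (id_simplex 0 1) [:: x].
Lemma bar_point_is_linear : linear bar_point_fun.
Proof. by move=> a x y; apply: (Dsym_multilinear (id_simplex 0 1) [::] [::]). Qed.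
HB.instance Definition _ :=
  GRing.isLinear.Build k B (bar B 0) _ bar_point_fun bar_point_is_linear.
Definition bar_point : {linear B -> bar B 0} := bar_point_fun.

(** The edge of E Sigma_n from s to the identity, carried by one-letter words, on which both the
    T-action on D and the product of B do nothing. *)
Lemma Dsym_homologous (s : 1.-tuple (seq nat)) (v : seq B) :
  valid_simplex (size v) s -> bnd (Dsym (id_simplex 0 (size v)) v - Dsym s v).
Proof.
move=> vs; pose ws := [seq [:: x] | x <- v].
pose t : 2.-tuple (seq nat) := [tuple tnth s ord0; iota 0 (size v)].
have vt : valid_simplex (size ws) t.
  by rewrite size_map /valid_simplex /= is_oneline_iota (valid_tnth _ vs).
exists (Dsym t (map (@word k B) ws)); rewrite bar_diff0E // flatten_seq1.
have -> : map (@alg_prod k B) ws = v.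
  by rewrite -map_comp -[RHS]map_id; apply: eq_map => x /=; rewrite alg_mulr1.
have -> : shape ws = nseq (size v) 1%N by rewrite /ws; elim: (v) => //= _ u ->.
congr (Dsym _ _ - Dsym _ _); apply: eq_from_tnth => r;
  rewrite ord1 tnth_mktuple.
  rewrite tnth_mktuple (tnth_nth [::]) /= blocks_nseq1 ?is_oneline_iota //.
by rewrite [LHS](tnth_nth [::]).
Qed.

(** The word v taken as a single letter of D: one face spreads it out into its letters, the other
    multiplies them. *)
Lemma Dsym_prod_homologous (v : seq B) :
  bnd (Dsym (id_simplex 0 (size v)) v - bar_point (alg_prod v)).
Proof.
exists (Dsym (id_simplex 1 1) (map (@word k B) [:: v])).
rewrite bar_diff0E //= cats0; congr (Dsym _ _ - Dsym _ _);
  apply: eq_from_tnth => r; rewrite ord1 tnth_mktuple.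
  rewrite tnth_mktuple !(tnth_nth [::]) /= /blocks /operad_comp /= cats0.
  by rewrite map_id.
by rewrite !(tnth_nth [::]).
Qed.

(** Modulo boundaries a symbol can be brought to the identity simplex and multiplied out, so every
    chain is homologous to a point of B with the same class in [ab B]. It remains to see that points
    in the commutator ideal bound. *)
Lemma bar_to_ab_exact x : bar_to_ab x = 0 -> bnd x.
Proof.
have comm (a b c : B) : bnd (bar_point (alg_prod [:: a; b; c]) -
    bar_point (alg_prod [:: b; a; c])).
  (* The transposition of the first two positions. Moved from the simplex to the word by
     equivariance, it turns abc into bac. *)
  pose h := [:: 1; 0; 2]%N.
  have H1 := Dsym_prod_homologous [:: a; b; c].
  have H2 := Dsym_prod_homologous [:: b; a; c].
  have H3 : bnd (Dsym (id_simplex 0 3) [:: a; b; c] -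
      Dsym (left_mul h (id_simplex 0 3)) [:: a; b; c]).
    exact: (@Dsym_homologous (left_mul h (id_simplex 0 3)) [:: a; b; c]).
  rewrite (@Dsym_equiv _ _ _ (id_simplex 0 3) [:: a; b; c] h) // in H3.
  have E (V : zmodType) (p q u v : V) : u - v = (p - q - (p - u)) + (q - v).
    by rewrite opprB [p - q + _]addrC [u - p + _]addrA subrK addrA subrK.
  rewrite (E _ (Dsym (id_simplex 0 3) [:: a; b; c])
               (Dsym (id_simplex 0 3) [:: b; a; c])).
  exact: (subspaceD bnd_subspace (subspaceB bnd_subspace H3 H1) H2).
suff [y [xy xb]] : exists y, bar_to_ab x = to_ab B y /\ bnd (x - bar_point y).
  rewrite xy => y0; rewrite -(subrK (bar_point y) x).
  apply: subspaceD => //.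
  apply: (@to_ab_eq0 k B (fun y => bnd (bar_point y))) y0 => [|a b c].
    split; first by rewrite linear0; apply: bnd_subspace.1.
    by move=> a u v bu bv; rewrite linearP; apply: bnd_subspace.2.
  by rewrite linearB; apply: comm.
move: x; apply: D_ind => [|s v vs].
  split; first by exists 0; rewrite !linear0 ?subr0 ?addr0; split=> //; apply: bnd_subspace.1.
  move=> a u v [y [uy ub]] [z [vz vb]]; exists (a *: y + z).
  rewrite (linearP bar_to_ab) (linearP (to_ab B)) (linearP bar_point) uy vz; split=> //.
  rewrite opprD addrACA -scalerBr; exact: bnd_subspace.2.
exists (alg_prod v); split; first exact: bar_to_abE.
have := subspaceB bnd_subspace (Dsym_prod_homologous v) (Dsym_homologous vs).
by rewrite opprB addrC addrA subrK.
Qed.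
End BarDegreeZero.

(** * The bar construction of a free algebra *)

Section ActionDefect.
Variables (k : fieldType) (char0 : [pchar k] =i pred0) (p : nat).

(* The averaging map commutes with every structure map of the bar construction
   but the action of T on D. *)
Definition act_defect (V : lmodType k) (u : D p (T V)) : D p.+1 V :=
  D_act p.+1 V (average p (T V) u) - average p V (D_act p V u).

Lemma act_defect_natural (V W : lmodType k) (f : {linear V -> W}) u :
  act_defect (D_map p (T_map f) u) = D_map p.+1 f (act_defect u).
Proof.
rewrite /act_defect linearB; congr (_ - _).
  by rewrite average_natural; apply: D_act_natural.
by rewrite D_act_natural; apply: average_natural.
Qed.

(** One-letter words leave the action nothing to compose, and averaging is natural. This is where
    the iteration of the error terms stops. *)
Lemma act_defect_unit (V : lmodType k) z :
  act_defect (D_map p (T_unit V) z) = 0.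
Proof. by rewrite /act_defect average_natural !D_act_unit subrr. Qed.
End ActionDefect.

Section FreeBar.
Variables (k : fieldType) (char0 : [pchar k] =i pred0) (V : lmodType k).

Local Notation FV := (free_alg V).
Local Notation W := (Tpow FV).

(** Available because the algebra is free: the unit V -> T V is inserted below all p+1 layers of T,
    giving a degeneracy on the side opposite to the T-action on D. *)
Fixpoint sigma p : {linear W p -> W p.+1} :=
  if p is p'.+1 then T_map (sigma p') else T_map (T_unit V).

Lemma sigma_face_last p x : Tpow_face FV p p (sigma p x) = x.
Proof.
elim: p x => [|p IH] x.
  exact: etrans (T_action_free _) (T_mu_map_unit x).
have idP (U : lmodType k) : forall y : T U, T_map idfun y = y by exact: T_map_id.
apply: etrans _ (idP _ x); symmetry.
by apply: T_map_comp => y; rewrite IH.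
Qed.

Lemma sigma_face p i x : (i <= p)%N ->
  Tpow_face FV p.+1 i (sigma p.+1 x) = sigma p (Tpow_face FV p i x).
Proof.
elim: p i x => [|p IH] [|i] x ip.
- apply: etrans (T_mu_natural (T_unit V) x) _.
  exact (congr1 (T_map (T_unit V)) (esym (T_action_free x))).
- by exfalso; move: ip.
- exact: (T_mu_natural (sigma p)).
- apply: (T_map_square (f := sigma p.+1) (f' := Tpow_face FV p i)) => y.
  exact: IH.
Qed.

Definition cone p (x : bar FV p) : bar FV p.+1 :=
  average p (W p.+1) (D_map p (sigma p) x).

Lemma cone_is_linear p : linear (@cone p).
Proof.
move=> a x y; rewrite /cone (linearP (D_map p (sigma p))).
by rewrite (linearP (average p (W p.+1))).
Qed.
HB.instance Definition _ p :=
  GRing.isLinear.Build k (bar FV p) (bar FV p.+1) _ (@cone p) (@cone_is_linear p).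

Lemma cone_face_last p x : bar_face FV ord_max (cone x) = x :> bar FV p.
Proof.
have E : bar_face FV ord_max (cone x) = D_face (W p) ord_max
    (D_map p.+1 (Tpow_face FV p p) (cone x)).
  have vm : val (ord_max : 'I_p.+2) = p.+1 by [].
  exact (etrans (bar_faceE ord_max (cone x)) (congr1 (fun n =>
    D_face (W p) ord_max (bar_hface FV p.+1 p n (cone x))) vm)).
have F : D_map p (Tpow_face FV p p) (D_map p (sigma p) x) = x.
  apply: etrans (esym (D_map_comp (h := idfun) _ x)) _.
    by move=> y; apply/esym/sigma_face_last.
  exact: D_map_id.
rewrite {}E /cone.
apply: etrans (congr1 (D_face (W p) ord_max)
  (esym (average_natural (Tpow_face FV p p) _))) _.
by rewrite F; apply: average_face_last.
Qed.

Lemma cone_faceS p (j : 'I_p.+1) x :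
  bar_face FV (lift ord_max (lift ord0 j) : 'I_p.+3) (cone x) =
  cone (bar_face FV (lift ord0 j : 'I_p.+2) x).
Proof.
have jp := ltn_ord j; set i : 'I_p.+2 := lift ord0 j.
have E : bar_face FV (lift ord_max i) (cone x) =
    D_face (W p.+1) (lift ord_max i)
      (D_map p.+2 (Tpow_face FV p.+1 j) (cone x)).
  have vi : val (lift ord_max i : 'I_p.+3) = j.+1 by rewrite /= /bump; lia.
  exact (etrans (bar_faceE (lift ord_max i) (cone x)) (congr1 (fun n =>
    D_face (W p.+1) (lift ord_max i) (bar_hface FV p.+2 p.+1 n (cone x))) vi)).
apply: (etrans E); rewrite /cone.
have E2 : D_map p.+2 (Tpow_face FV p.+1 j)
      (average p.+1 (W p.+2) (D_map p.+1 (sigma p.+1) x)) =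
    average p.+1 (W p.+1) (D_map p.+1 (sigma p) (D_map p.+1 (Tpow_face FV p j) x)).
  apply: etrans (esym (average_natural _ _)) _.
  apply: (congr1 (average p.+1 (W p.+1))).
  by apply: D_map_square => y; apply: sigma_face.
rewrite {}E2 average_face; apply: (congr1 (average p (W p.+1))).
exact: D_face_natural.
Qed.

(** The 0-th face is the only one involving the action of T on D, so its failure to commute with the
    cone is exactly an action defect. *)
Lemma cone_face0 p x :
  bar_face FV (lift ord_max (ord0 : 'I_p.+2) : 'I_p.+3) (cone x) -
    cone (bar_face FV (ord0 : 'I_p.+2) x) =
  act_defect (D_face (W p.+2) ord0 (D_map p.+1 (sigma p.+1) x)).
Proof.
set u := D_face (W p.+2) ord0 (D_map p.+1 (sigma p.+1) x).
pose c : 'I_p.+3 := lift ord_max (ord0 : 'I_p.+2).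
have c0 : val c = 0%N by [].
have E1 : bar_face FV c (cone x) = D_act p.+1 (W p.+1) (average p (W p.+2) u).
  have E : bar_face FV c (cone x) =
      D_face (W p.+1) c (D_act p.+2 (W p.+1) (cone x)).
    exact (etrans (bar_faceE c (cone x)) (congr1 (fun n =>
      D_face (W p.+1) c (bar_hface FV p.+2 p.+1 n (cone x))) c0)).
  apply: (etrans E); apply: etrans (D_face_act _ _) _.
  apply: (congr1 (D_act p.+1 (W p.+1))); exact: average_face.
have E2 : cone (bar_face FV (ord0 : 'I_p.+2) x) =
    average p (W p.+1) (D_act p (W p.+1) u).
  have E : bar_face FV (ord0 : 'I_p.+2) x = D_act p (W p) (D_face (W p.+1) ord0 x).
    exact (etrans (bar_faceE ord0 x) (D_face_act ord0 x)).
  rewrite {}E /cone; apply: (congr1 (average p (W p.+1))).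
  apply: etrans (esym (D_act_natural (sigma p) _)) _.
  apply: (congr1 (D_act p (W p.+1))).
  exact (esym (D_face_natural (sigma p.+1) ord0 x)).
exact (congr2 (fun a b => a - b) E1 E2).
Qed.

Lemma bar_diff_cone p (x : bar FV p.+1) : bar_diff FV p x = 0 ->
  bar_diff FV p.+1 (cone x) =
  act_defect (D_face (W p.+2) ord0 (D_map p.+1 (sigma p.+1) x)) + (-1) ^+ p *: x.
Proof.
(* The cone lemma produces the exponent p+2. *)
move=> dx; have pE : (-1) ^+ p = (-1) ^+ p.+2 :> k by rewrite !exprS mulrA mulN1r opprK mul1r.
have H := @alternating_sum_cone k _ _ _ p.+1 (@bar_face k FV p)
  (@bar_face k FV p.+1) (@cone p.+1) (@cone p) x (fun j => cone_faceS j x)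
  (cone_face_last x) dx.
rewrite pE; exact (etrans H (congr1 (fun z => z + _) (cone_face0 x))).
Qed.

(* Each application of act_defect strips one layer of T off the source of tau. *)
Inductive tame p : forall X : lmodType k, {linear X -> W p} -> Prop :=
| TameUnit (X : lmodType k) (tau : {linear X -> W p}) :
    (forall x, sigma p (tau x) = T_unit (W p) (tau x)) -> tame tau
| TameT (X : lmodType k) (tau : {linear T X -> W p}) (tau' : {linear X -> W p}) :
    (forall x, sigma p (tau x) = T_map tau' x) -> tame tau' -> tame tau.

Lemma boundary_minus_cycle (U U' U'' : lmodType k) (f : {linear U' -> U''})
    (g : {linear U -> U'}) c x y :
  f y = 0 -> f (g x) = 0 -> f (g x - c *: y) = 0.
Proof. by move=> fy gx; rewrite linearB linearZ gx /= fy scaler0 subr0. Qed.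

(** The error term in the boundary of the cone is a boundary minus a cycle, hence a cycle. By
    naturality of the defect it has the form D(tau') z, with one layer of T less in the source, so
    it bounds by induction. It vanishes when sigma after tau is the unit after tau. *)
Lemma tame_boundary p (X : lmodType k) (tau : {linear X -> W p.+1}) :
  tame tau -> forall y, bar_diff FV p (D_map p.+1 tau y) = 0 ->
  in_image (bar_diff FV p.+1) (D_map p.+1 tau y).
Proof.
elim=> {X tau} [X tau st y dy|X tau tau' st _ IH y dy].
  have := bar_diff_cone dy; set u := D_face _ _ _.
  have -> : u = D_map p (T_unit (W p.+1)) (D_map p tau (D_face X ord0 y)).
    apply: etrans (congr1 (D_face (W p.+2) ord0)
      (D_map_square (g' := T_unit (W p.+1)) (f' := tau) st y)) _.
    by rewrite D_face_natural; apply: (congr1 (D_map p (T_unit (W p.+1)))); apply: D_face_natural.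
  rewrite act_defect_unit add0r => E; exists ((-1) ^+ p *: cone (D_map p.+1 tau y)).
  exact: sign_preimage.
have := bar_diff_cone dy; set u := D_face _ _ _.
have -> : u = D_map p (T_map tau') (D_face (T X) ord0 y).
  apply: etrans (congr1 (D_face (W p.+2) ord0)
     (esym (D_map_comp (h := T_map tau') (fun x => esym (st x)) y))) _.
  exact: D_face_natural.
rewrite act_defect_natural; set z := act_defect _ => E.
have [w Ew] : in_image (bar_diff FV p.+1) (D_map p.+1 tau' z).
  apply: IH.
  have E' : D_map p.+1 tau' z = bar_diff FV p.+1 (cone (D_map p.+1 tau y)) -
      (-1) ^+ p *: D_map p.+1 tau y by rewrite E addrK.
  apply: etrans (congr1 (bar_diff FV p) E') _.
  exact: boundary_minus_cycle dy (bar_diff_sqr _).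
exists ((-1) ^+ p *: (cone (D_map p.+1 tau y) - w)).
apply: sign_preimage; rewrite linearB; apply: etrans (congr2 (fun a b => a - b) E Ew) _.
by rewrite addrC addKr.
Qed.

(** If tau commutes with the insertions sigma, so does tau after sigma, whose source has one layer
    less. At j = 0 the next source is V itself, where inserting a unit and applying the outer unit
    agree. *)
Lemma tame_of_sigma p j (tau : {linear W j -> W p}) :
  (forall x, sigma p (tau x) = T_map tau (sigma j x)) -> tame tau.
Proof.
elim: j tau => [|j IH] tau st.
  apply: (@TameT p V tau (tau \o T_unit V)).
    by move=> x; rewrite st; apply/esym; apply: T_map_comp.
  apply: TameUnit => x; rewrite /= st.
  apply: etrans (congr1 (T_map tau) (T_unit_natural (T_unit V) x)) _.
  exact: (T_unit_natural tau (T_unit V x)).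
apply: (@TameT p (W j) tau (tau \o sigma j)).
  by move=> x; rewrite st; apply/esym; apply: T_map_comp.
apply: IH => x; rewrite /= st; apply/esym.
exact: (T_map_comp (h := tau \o sigma j) (g := tau) (f := sigma j)).
Qed.

Lemma free_bar_exact p x : bar_diff FV p x = 0 -> in_image (bar_diff FV p.+1) x.
Proof.
have idE : D_map p.+1 idfun x = x by apply: D_map_id.
move=> dx; have := @tame_boundary p (W p.+1) idfun _ x; rewrite idE; apply=> //.
by apply: tame_of_sigma => y; apply/esym; apply: T_map_id.
Qed.
End FreeBar.

(** * Homology of the bar construction *)

Section AbComplex.
Variables (k : fieldType) (A : unitalAlgebra k).

Definition ab_complex q : lmodType k := ab (res_alg A q).

Definition ab_diff q : {linear ab_complex q.+1 -> ab_complex q} :=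
  face_diff (X := ab_complex) (fun q (i : 'I_q.+2) => ab_map (res_face A i)) q.
End AbComplex.

Section BarResolution.
Variables (k : fieldType).

(** Defined for linear maps, not only for algebra homomorphisms, so as to apply to the unit of T; it
    need not commute with [bar_diff]. *)
Definition bar_lmap (A B : unitalAlgebra k) (f : {linear A -> B}) p :
  {linear bar A p -> bar B p} := D_map p (Tpow_map f p).

Lemma bar_lmap_square (A B B' C : unitalAlgebra k) (g : {linear B -> C})
    (f : {linear A -> B}) (g' : {linear B' -> C}) (f' : {linear A -> B'}) p :
  (forall x, g (f x) = g' (f' x)) ->
  forall x, bar_lmap g p (bar_lmap f p x) = bar_lmap g' p (bar_lmap f' p x).
Proof.
move=> gf; apply: D_map_square; elim: p => [|p IH] //= x.
exact: T_map_square.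
Qed.

Lemma bar_lmap_cancel (A B : unitalAlgebra k) (g : {linear B -> A})
    (f : {linear A -> B}) p : (forall x, g (f x) = x) ->
  forall x, bar_lmap g p (bar_lmap f p x) = x.
Proof.
move=> gf x; have := @bar_lmap_square A B A A g f idfun idfun p gf x => ->.
have idp y : Tpow_map (idfun : {linear A -> A}) p y = y.
  by elim: p y {x} => [|p IH] //= y; apply: T_map_id.
by rewrite /bar_lmap; do 2 (rewrite D_map_id //).
Qed.

Variable A : unitalAlgebra k.

Definition bar_res_diff p q :
    {linear bar (res_alg A q.+1) p -> bar (res_alg A q) p} :=
  face_diff (X := fun q => bar (res_alg A q) p)
    (fun q (i : 'I_q.+2) => bar_map (res_face A i) p) q.

Definition bar_res_unit p q : {linear bar (res_alg A q) p -> bar (res_alg A q.+1) p} :=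
  bar_lmap (A := res_alg A q) (B := res_alg A q.+1) (T_unit (Tpow A q.+1)) p.

Definition bar_aug_unit p : {linear bar A p -> bar (res_alg A 0) p} :=
  bar_lmap (A := A) (B := res_alg A 0) (T_unit (Tpow A 0)) p.

Let unit0 p q x : bar_map (res_face A (ord0 : 'I_q.+2)) p (bar_res_unit p q x) = x.
Proof.
apply: (@bar_lmap_cancel (res_alg A q) (res_alg A q.+1) (res_face A ord0)
  (T_unit (Tpow A q.+1)) p) => y.
exact: res_face0_unit.
Qed.

Let unit1 p x : bar_map (res_face A (lift ord0 ord0 : 'I_2)) p (bar_res_unit p 0 x) =
  bar_aug_unit p (bar_map (res_augment A) p x).
Proof.
apply: (@bar_lmap_square (res_alg A 0) (res_alg A 1) A (res_alg A 0)
  (res_face A (lift ord0 ord0)) (T_unit (Tpow A 1)) (T_unit (Tpow A 0))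
  (res_augment A) p) => y.
exact: res_face1_unit.
Qed.

Let unitS p q (i : 'I_q.+2) x :
  bar_map (res_face A (lift ord0 i)) p (bar_res_unit p q.+1 x) =
  bar_res_unit p q (bar_map (res_face A i) p x).
Proof.
apply: (@bar_lmap_square (res_alg A q.+1) (res_alg A q.+2) (res_alg A q) (res_alg A q.+1)
  (res_face A (lift ord0 i)) (T_unit (Tpow A q.+2)) (T_unit (Tpow A q.+1))
  (res_face A i) p) => y.
exact: res_faceS_unit.
Qed.

Let unitA p x : bar_map (res_augment A) p (bar_aug_unit p x) = x.
Proof.
apply: (@bar_lmap_cancel A (res_alg A 0) (res_augment A) (T_unit (Tpow A 0)) p) => y.
exact: res_augment_unit.
Qed.

Lemma bar_res_diff_sqr p q x : bar_res_diff p q (bar_res_diff p q.+1 x) = 0.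
Proof.
apply: (@face_diff_sqr k (fun q => bar (res_alg A q) p)
  (fun q (i : 'I_q.+2) => bar_map (res_face A i) p)) => {}q i j {}x ij.
apply: (@bar_lmap_square (res_alg A q.+2) (res_alg A q.+1) (res_alg A q.+1)
  (res_alg A q) (res_face A (inord i)) (res_face A (inord j.+1))
  (res_face A (inord j)) (res_face A (inord i)) p) => y.
exact: res_faceC.
Qed.

Lemma face_diff0E (X : nat -> lmodType k)
    (d : forall q, 'I_q.+2 -> {linear X q.+1 -> X q}) x :
  face_diff d 0 x = d 0 ord0 x - d 0 (lift ord0 ord0) x.
Proof.
rewrite /face_diff /= /alternating_sum big_ord_recl big_ord1 expr0 scale1r.
by rewrite expr1 scaleN1r.
Qed.

Lemma bar_aug_diff p x : bar_map (res_augment A) p (bar_res_diff p 0 x) = 0.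
Proof.
apply: etrans (congr1 (bar_map (res_augment A) p)
  (@face_diff0E (fun q => bar (res_alg A q) p)
    (fun q (i : 'I_q.+2) => bar_map (res_face A i) p) x)) _.
rewrite linearB; apply/eqP; rewrite subr_eq0; apply/eqP.
apply: (@bar_lmap_square (res_alg A 1) (res_alg A 0) (res_alg A 0) A
  (res_augment A) (res_face A ord0) (res_augment A) (res_face A (lift ord0 ord0)) p).
exact: res_augment_face.
Qed.

Lemma bar_to_ab_natural (B C : unitalAlgebra k) (f : algHom B C) x :
  ab_map f (bar_to_ab B x) = bar_to_ab C (bar_map f 0 x).
Proof.
move: x; apply: D_ind => [|s v vs].
  by apply: eq_subspace => a u v; rewrite ?linearP.
rewrite bar_to_abE // ab_mapE alg_hom_prod; symmetry.
apply: etrans (congr1 (bar_to_ab C) (D_mapE _ _ _)) _.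
by apply: bar_to_abE; rewrite size_map.
Qed.

Lemma bar_homology_ab (char0 : [pchar k] =i pred0) n :
  exists F : {linear bar_homology A n -> homology (@ab_diff k A) n}, bijective F.
Proof.
apply: (@double_complex_iso k (fun p q => bar (res_alg A q) p)
  (fun p q => bar_diff (res_alg A q) p) bar_res_diff (bar A) (ab_complex A)
  (bar_diff A) (@ab_diff k A) (bar_map (res_augment A))
  (fun q => bar_to_ab (res_alg A q))).
- move=> p q x; apply/esym.
  apply: (@alternating_sum_natural k _ _ _ _ _
    (fun i => bar_map (res_face A i) p.+1) (fun i => bar_map (res_face A i) p)
    (bar_diff (res_alg A q.+1) p) (bar_diff (res_alg A q) p)) => i y.
  exact/esym/bar_map_diff.
- by move=> p x; apply: bar_map_diff.
- move=> q x.
  apply: (@alternating_sum_natural k _ _ _ _ _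
    (fun i => bar_map (res_face A i) 0) (fun i => ab_map (res_face A i))
    (bar_to_ab (res_alg A q.+1)) (bar_to_ab (res_alg A q))) => i y.
  exact: bar_to_ab_natural.
- by move=> p q x; apply: bar_diff_sqr.
- by move=> q x; apply: bar_to_ab_diff.
- by move=> p q x; apply: bar_res_diff_sqr.
- by move=> p x; apply: bar_aug_diff.
- by move=> p y; exists (bar_aug_unit p y); apply: unitA.
- move=> p x; exact: (@extra_degeneracy_exact0 k (fun q => bar (res_alg A q) p)
    (fun q (i : 'I_q.+2) => bar_map (res_face A i) p) _ (bar_map (res_augment A) p)
    (bar_aug_unit p) (bar_res_unit p) (@unit0 p) (@unit1 p)).
- move=> p q x; exact: (@extra_degeneracy_exactS k (fun q => bar (res_alg A q) p)
    (fun q (i : 'I_q.+2) => bar_map (res_face A i) p)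
    (bar_res_unit p) (@unit0 p) (@unitS p)).
- by move=> q y; apply: bar_to_ab_onto.
- by move=> q x; apply: bar_to_ab_exact.
- by move=> p q x; apply: free_bar_exact.
Qed.
End BarResolution.

(** * Functors on Delta S *)

Section DeltaSCategory.

Lemma dS_eq n m (f g : dS n m) : (forall j, tnth f j = tnth g j) -> f = g.
Proof. by move=> fg; apply: val_inj; apply: eq_from_tnth. Qed.

Lemma tnth_dS_comp n m l (g : dS m l) (f : dS n m) j :
  tnth (dS_comp g f) j = substitute f (tnth g j).
Proof. exact: tnth_map. Qed.

Lemma substitute_substitute n m l (g : l.+1.-tuple (seq 'I_m.+1))
    (f : m.+1.-tuple (seq 'I_n.+1)) Y :
  substitute f (substitute g Y) = substitute (map_tuple (substitute f) g) Y.
Proof.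
rewrite /substitute map_flatten -map_comp.
elim: Y => //= y Y IH; rewrite flatten_cat IH tnth_map; congr (_ ++ _).
Qed.

Lemma dS_compA n m l r (h : dS l r) (g : dS m l) (f : dS n m) :
  dS_comp h (dS_comp g f) = dS_comp (dS_comp h g) f.
Proof.
apply: dS_eq => j; rewrite !tnth_dS_comp.
by rewrite (substitute_substitute g f).
Qed.

Lemma dS_comp1 n m (f : dS n m) : dS_comp f (dS_id n) = f.
Proof.
apply: dS_eq => j; rewrite tnth_dS_comp /substitute.
rewrite (eq_map (g := fun y => [:: y])) ?flatten_seq1 // => y.
exact: tnth_mktuple.
Qed.
End DeltaSCategory.

(** * Projective functors and the functor tensor product *)

Section Presheaves.
Variable k : fieldType.
Implicit Types P M N : contraFunctor k.

Section FreeCover.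
Variable P : contraFunctor k.

(** The basis at [n] of a direct sum of representable functors, with one summand for each element y
    of each P m. *)
Definition cover_gen n : choiceType := {m : nat & (dS n m * P m)%type}.
Definition cover_pair n m (f : dS n m) (y : P m) : cover_gen n := Tagged _ (f, y).

Definition cover_obj n : lmodType k := {malg k[cover_gen n]}.

Definition cover_pull n n' (f : dS n n') (c : cover_gen n') : cover_gen n :=
  cover_pair (dS_comp (tagged c).1 f) (tagged c).2.

Definition cover_map n n' (f : dS n n') : {linear cover_obj n' -> cover_obj n} :=
  linext (fun c => << cover_pull f c >>).

Lemma cover_mapE n n' (f : dS n n') c :
  cover_map f << c >> = << cover_pull f c >>.
Proof. exact: linextU. Qed.

Lemma cover_map_id n x : cover_map (dS_id n) x = x.
Proof.
apply: (linear_malg_eq (f := cover_map (dS_id n)) (g := idfun)) => -[m [f y]].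
by rewrite cover_mapE /cover_pull /= dS_comp1.
Qed.

Lemma cover_map_comp n m l (g : dS m l) (f : dS n m) x :
  cover_map (dS_comp g f) x = cover_map f (cover_map g x).
Proof.
move: x; apply: malg_ind => [|[r [h y]]].
  by apply: eq_subspace => a u v; rewrite ?linearP.
by rewrite !cover_mapE /cover_pull /= dS_compA.
Qed.

Definition free_cover : contraFunctor k := ContraFunctor cover_map_id cover_map_comp.

Definition cover_eval_gen n (c : cover_gen n) : P n :=
  con_map P (tagged c).1 (tagged c).2.

Definition cover_eval n : {linear free_cover n -> P n} := linext (@cover_eval_gen n).

Lemma cover_evalE n c : cover_eval n << c >> = cover_eval_gen c.
Proof. exact: linextU. Qed.

Lemma cover_eval_natural n m (f : dS n m) x :
  cover_eval n (con_map free_cover f x) = con_map P f (cover_eval m x).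
Proof.
move: x; apply: malg_ind => [|[r [h y]]].
  by apply: eq_subspace => a u v; rewrite ?linearP.
rewrite cover_mapE !cover_evalE /cover_eval_gen /=; exact: con_comp.
Qed.

Definition cover_counit : contraMap free_cover P := ContraMap cover_eval_natural.

Lemma cover_counit_onto n y : exists x, cover_counit n x = y.
Proof.
exists << cover_pair (dS_id n) y >>; apply: etrans (cover_evalE _) _.
exact: con_id.
Qed.

Lemma cover_section : projective P ->
  exists h : contraMap P free_cover, forall n x, cover_counit n (h n x) = x.
Proof.
move=> pP; have idN n m (f : dS n m) (x : P m) :
  (idfun : {linear P n -> P n}) (con_map P f x) = con_map P f ((idfun : {linear P m -> P m}) x).
  by [].
have [h hE] := pP _ _ cover_counit (ContraMap idN) cover_counit_onto.
by exists h.
Qed.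
End FreeCover.

Section Selection.
Variables (P : contraFunctor k) (pP : projective P).

(** Values are chosen at the generators of the free cover, without any condition; linearity and
    naturality of R propagate the relation to the whole cover. Restricting along a section of the
    counit gives the map on P. Lifting problems for projectives become instances of this. *)
Lemma projective_select (M : contraFunctor k) (R : forall n, P n -> M n -> Prop) :
  (forall n, linear_rel (@R n)) ->
  (forall n m (f : dS n m) p y, R m p y -> R n (con_map P f p) (con_map M f y)) ->
  (forall n p, exists y, R n p y) ->
  exists phi : contraMap P M, forall n p, R n p (phi n p).
Proof.
move=> linR natR totR; have [h hE] := cover_section pP.
pose sel m (y : P m) : M m := sval (cid (totR m y)).
have selP m y : R m y (sel m y) by rewrite /sel; case: cid.
pose phi0 n : {linear free_cover P n -> M n} :=
  linext (fun c : cover_gen P n => con_map M (tagged c).1 (sel _ (tagged c).2)).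
have phi0E n c : phi0 n << c >> = con_map M (tagged c).1 (sel _ (tagged c).2).
  exact: linextU.
have phi0N n m (f : dS n m) x : phi0 n (cover_map P f x) = con_map M f (phi0 m x).
  move: x; apply: malg_ind => [|[r [g y]]].
    by apply: eq_subspace => a u v; rewrite ?linearP.
  rewrite cover_mapE !phi0E /=; exact: con_comp.
have phi0R n u : R n (cover_eval P n u) (phi0 n u).
  move: u; apply: malg_ind => [|[r [g y]]].
    split=> [|a u v Ru Rv]; first by rewrite !linear0; apply: (linR n).1.
    by rewrite !linearP; apply: (linR n).2.
  by rewrite cover_evalE phi0E; apply: natR; apply: selP.
have N n m (f : dS n m) x : (phi0 n \o h n) (con_map P f x) =
    con_map M f ((phi0 m \o h m) x).
  by rewrite /= nat_mapP phi0N.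
exists (ContraMap N) => n p.
by have := phi0R n (h n p); rewrite [X in R n X]hE.
Qed.

(** The vector space P n is a retract of the free cover at n, which has a given basis, so that no
    basis of P n has to be chosen. *)
Lemma linear_select n (W : lmodType k) (R : P n -> W -> Prop) :
  linear_rel R -> (forall p, exists y, R p y) ->
  exists phi : {linear P n -> W}, forall p, R p (phi p).
Proof.
move=> linR totR; have [h hE] := cover_section pP.
pose sel (y : P n) : W := sval (cid (totR y)).
have selP y : R y (sel y) by rewrite /sel; case: cid.
pose phi0 : {linear free_cover P n -> W} :=
  linext (fun c : cover_gen P n => sel (cover_eval_gen c)).
have phi0R u : R (cover_eval P n u) (phi0 u).
  move: u; apply: malg_ind => [|c].
    split=> [|a u v Ru Rv]; first by rewrite !linear0; apply: linR.1.
    by rewrite !linearP; apply: linR.2.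
  by rewrite cover_evalE [phi0 _]linextU; apply: selP.
exists (phi0 \o h n) => p.
by have := phi0R (h n p); rewrite [X in R X]hE.
Qed.
End Selection.

Section Tensor.
Implicit Types F G : covFunctor k.

Lemma ft_ind F P (S : ftensor F P -> Prop) : subspace S ->
  (forall n (p : P n) (x : F n), S (ftpure p x)) -> forall z, S z.
Proof. by move=> sS Sp; apply: presented_ind => // -[n [p x]]; apply: Sp. Qed.

Section Lift.
Variables (F : covFunctor k) (P : contraFunctor k) (W : lmodType k).
Variable B : forall n, P n -> F n -> W.

Record balanced : Prop := Balanced {
  bal_linl : forall n a p p' x, B (a *: p + p') x = a *: B p x + @B n p' x;
  bal_linr : forall n a p x x', B p (a *: x + x') = a *: B p x + @B n p x';
  bal_map : forall n m (f : dS n m) p x,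
    B (con_map P f p) x = B p (cov_map F f x) }.

Hypothesis balB : balanced.

Lemma ft_lift_subproof r :
  ftensor_rel r -> linext (fun c : ftgen F P => B (tagged c).1 (tagged c).2) r = 0.
Proof.
case=> [n a p p' x|n a p x x'|n m f p x].
- by rewrite !linearB linearZ /= !linextU /= bal_linl // addrAC addrK subrr.
- by rewrite !linearB linearZ /= !linextU /= bal_linr // addrAC addrK subrr.
- by rewrite linearB /= !linextU /= bal_map // subrr.
Qed.

Definition ft_lift : {linear ftensor F P -> W} := plift ft_lift_subproof.

Lemma ft_liftE n (p : P n) x : ft_lift (ftpure p x) = B p x.
Proof. exact: pliftE. Qed.
End Lift.

Lemma ftensor_mapE F P Q (phi : contraMap P Q) n (p : P n) (x : F n) :
  ftensor_map F phi (ftpure p x) = ftpure (phi n p) x.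
Proof. exact: pliftE. Qed.

Record covMap F G := CovMap {
  cov_nat :> forall n, {linear F n -> G n};
  cov_natP : forall n m (f : dS n m) x,
    cov_nat m (cov_map F f x) = cov_map G f (cov_nat n x) }.

Section CovariantMap.
Variables (F G : covFunctor k) (P : contraFunctor k) (phi : covMap F G).

Lemma ft_covmap_balanced :
  balanced (fun n (p : P n) (x : F n) => ftpure p (phi n x)).
Proof.
split=> [n a p p' x|n a p x x'|n m f p x].
- exact: ftpure_linl.
- by rewrite linearP ftpure_linr.
- by rewrite ftpure_bal cov_natP.
Qed.

Definition ft_covmap : {linear ftensor F P -> ftensor G P} :=
  ft_lift ft_covmap_balanced.

Lemma ft_covmapE n (p : P n) x : ft_covmap (ftpure p x) = ftpure p (phi n x).
Proof. exact: ft_liftE. Qed.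
End CovariantMap.

Lemma ft_covmap_square F G G' H P (psi : covMap G H) (phi : covMap F G)
    (psi' : covMap G' H) (phi' : covMap F G') :
  (forall n x, psi n (phi n x) = psi' n (phi' n x)) ->
  forall z : ftensor F P, ft_covmap P psi (ft_covmap P phi z) =
    ft_covmap P psi' (ft_covmap P phi' z).
Proof.
move=> E; apply: ft_ind => [|n p x].
  by apply: eq_subspace => a u v; rewrite ?linearP.
by rewrite !ft_covmapE E.
Qed.

Lemma ft_covmap_nat F G P Q (psi : covMap F G) (phi : contraMap P Q)
    (z : ftensor F P) :
  ftensor_map G phi (ft_covmap P psi z) = ft_covmap Q psi (ftensor_map F phi z).
Proof.
move: z; apply: ft_ind => [|n p x].
  by apply: eq_subspace => a u v; rewrite ?linearP.
by rewrite !(ft_covmapE, ftensor_mapE).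
Qed.

Lemma ftpure_0l F P n (x : F n) : ftpure (0 : P n) x = 0.
Proof.
by apply: (scaleD_fun0 (f := fun p : P n => ftpure p x)) => a p p'; apply: ftpure_linl.
Qed.

Lemma ftpure_0r F P n (p : P n) : ftpure p (0 : F n) = 0.
Proof. by apply: (scaleD_fun0 (f := fun x : F n => ftpure p x)) => a x x'; apply: ftpure_linr. Qed.

Lemma ftpure_addl F P n (p p' : P n) (x : F n) :
  ftpure p x + ftpure p' x = ftpure (p + p') x.
Proof. by rewrite -[p in RHS]scale1r ftpure_linl scale1r. Qed.

Lemma subspace_ftpure F P n (p : P n) (S : ftensor F P -> Prop) :
  subspace S -> subspace (fun x : F n => S (ftpure p x)).
Proof.
move=> [S0 SD]; split=> [|a u v Su Sv]; first by rewrite ftpure_0r.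
by rewrite ftpure_linr; apply: SD.
Qed.
End Tensor.

(* For P projective, P (x) - extends to families of linear maps tau_n : F n -> G n
   that are not natural in n. *)
Section Flat.
Variables (F G : covFunctor k) (P : contraFunctor k).
Variable h : contraMap P (free_cover P).
Variable tau : forall n, {linear F n -> G n}.

(** The generator (f, y) stands for the pullback of y along f, so p (x) x becomes y (x) f x.
    Applying tau only after x has been moved to the object of y keeps the formula balanced although
    tau is not natural. *)
Definition flat_gen n (x : F n) (c : cover_gen P n) : ftensor G P :=
  ftpure (tagged c).2 (tau _ (cov_map F (tagged c).1 x)).

Lemma flat_balanced : balanced (fun n (p : P n) (x : F n) =>
  linext (flat_gen x) (h n p)).
Proof.
split=> [n a p p' x|n a p x x'|n m f p x]; first by rewrite !linearP.
  move: (h n p); apply: malg_ind => [|c].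
    apply: eq_subspace; last exact: linear_combination.
    by move=> b u v; rewrite linearP.
  by rewrite !linextU /flat_gen !linearP ftpure_linr.
rewrite nat_mapP; move: (h m p); apply: malg_ind => [|c].
  by apply: eq_subspace => b u v; rewrite ?linearP.
rewrite cover_mapE !linextU /flat_gen /= cov_comp //.
Qed.

Definition flat_map : {linear ftensor F P -> ftensor G P} := ft_lift flat_balanced.

Lemma flat_mapE n (p : P n) x : flat_map (ftpure p x) = linext (flat_gen x) (h n p).
Proof. exact: ft_liftE. Qed.
End Flat.

Lemma flat_map_cancel (F G : covFunctor k) P (h : contraMap P (free_cover P))
    (tau : forall n, {linear F n -> G n}) (phi : covMap G F) :
  (forall n x, cover_counit P n (h n x) = x) ->
  (forall n x, phi n (tau n x) = x) ->
  forall z, ft_covmap P phi (flat_map h tau z) = z.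
Proof.
move=> hE pt; apply: ft_ind => [|n p x].
  by apply: eq_subspace => a u v; rewrite ?linearP.
rewrite flat_mapE -[in RHS](hE n p); move: (h n p); apply: malg_ind => [|c].
  apply: eq_subspace => b u v; first by rewrite !linearP.
  by rewrite linearP ftpure_linl.
rewrite linextU ft_covmapE pt cover_evalE /cover_eval_gen.
exact/esym/ftpure_bal.
Qed.

Lemma flat_map_square (F G F' G' : covFunctor k) P (h : contraMap P (free_cover P))
    (tau : forall n, {linear F n -> G n}) (tau' : forall n, {linear F' n -> G' n})
    (phi : covMap G G') (psi : covMap F F') :
  (forall n x, phi n (tau n x) = tau' n (psi n x)) ->
  forall z, ft_covmap P phi (flat_map h tau z) = flat_map h tau' (ft_covmap P psi z).
Proof.
move=> E; apply: ft_ind => [|n p x].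
  by apply: eq_subspace => a u v; rewrite ?linearP.
rewrite ft_covmapE !flat_mapE; move: (h n p); apply: malg_ind => [|c].
  by apply: eq_subspace => b u v; rewrite !linearP.
by rewrite !linextU ft_covmapE /flat_gen E cov_natP.
Qed.
End Presheaves.

(** * Symmetric homology in degree zero *)

Section TensorPowers.
Variable k : fieldType.

Definition tpure (V : lmodType k) n (t : n.-tuple V) : tpow V n :=
  gen (@tpow_rel k V n) t.

Lemma tpow_ind (V : lmodType k) n (S : tpow V n -> Prop) : subspace S ->
  (forall t, S (tpure t)) -> forall x, S x.
Proof. exact: presented_ind. Qed.

Lemma tpow_liftE (V W : lmodType k) n (F : n.-tuple V -> W) (mF : multilinear F) t :
  tpow_lift mF (tpure t) = F t.
Proof. exact: pliftE. Qed.

Section Map.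
Variables (V W : lmodType k) (f : {linear V -> W}) (n : nat).

Lemma tpow_map_multilinear : multilinear (fun t : n.-tuple V => tpure (map_tuple f t)).
Proof.
move=> i a t t1 t2 h1 h2 e; apply: (@tpow_gen_multilinear _ _ _ i).
- by move=> j ji; rewrite !tnth_map h1.
- by move=> j ji; rewrite !tnth_map h2.
- by rewrite !tnth_map e linearP.
Qed.

Definition tpow_map : {linear tpow V n -> tpow W n} := tpow_lift tpow_map_multilinear.

Lemma tpow_mapE t : tpow_map (tpure t) = tpure (map_tuple f t).
Proof. exact: tpow_liftE. Qed.
End Map.

Lemma tpow_map_square (U V V' W : lmodType k) n (g : {linear V -> W})
    (f : {linear U -> V}) (g' : {linear V' -> W}) (f' : {linear U -> V'}) :
  (forall x, g (f x) = g' (f' x)) ->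
  forall x, tpow_map g n (tpow_map f n x) = tpow_map g' n (tpow_map f' n x).
Proof.
move=> E; apply: tpow_ind => [|t].
  by apply: eq_subspace => a u v; rewrite ?linearP.
rewrite !tpow_mapE; congr tpure; apply: eq_from_tnth => i.
by rewrite !tnth_map E.
Qed.

Lemma tpow_map_cancel (U V : lmodType k) n (g : {linear V -> U})
    (f : {linear U -> V}) : (forall x, g (f x) = x) ->
  forall x, tpow_map g n (tpow_map f n x) = x.
Proof.
move=> E; apply: tpow_ind => [|t].
  by apply: eq_subspace => a u v; rewrite ?linearP.
rewrite !tpow_mapE; congr tpure; apply: eq_from_tnth => i.
by rewrite !tnth_map E.
Qed.

Lemma bsymE (A : unitalAlgebra k) n m (f : dS n m) t :
  cov_map (Bsym A) f (tpure t) = tpure (bsym_tensor f t).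
Proof. exact: bsym_mapE. Qed.

Lemma bsym_map_natural (A B : unitalAlgebra k) (phi : algHom A B) n m (f : dS n m) x :
  tpow_map phi m.+1 (cov_map (Bsym A) f x) = cov_map (Bsym B) f (tpow_map phi n.+1 x).
Proof.
move: x; apply: tpow_ind => [|t].
  by apply: eq_subspace => a u v; rewrite ?linearP.
rewrite tpow_mapE !bsymE tpow_mapE; congr tpure; apply: eq_from_tnth => j.
rewrite tnth_map !tnth_mktuple alg_hom_prod -map_comp; congr alg_prod.
by apply: eq_map => i; rewrite tnth_map.
Qed.

Definition bsym_cov (A B : unitalAlgebra k) (phi : algHom A B) :
    covMap (Bsym A) (Bsym B) :=
  @CovMap k (Bsym A) (Bsym B) (fun n => tpow_map phi n.+1)
    (fun n m f x => bsym_map_natural phi f x).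
End TensorPowers.

Section HSDegreeZero.
Variables (k : fieldType) (B : unitalAlgebra k) (P : projResolution (const_functor k)).

Definition total_prod_fun n (t : n.-tuple B) : ab B := to_ab B (alg_prod t).

Lemma tuple_slot (X : Type) n (t : n.-tuple X) (i : 'I_n) :
  tval t = take i t ++ tnth t i :: drop i.+1 t.
Proof. by rewrite (tnth_nth (tnth t i)) -drop_nth ?size_tuple // cat_take_drop. Qed.

Lemma agree_off_slot (V : lmodType k) n (t t' : n.-tuple V) (i : 'I_n) :
  agree_off i t t' -> take i t = take i t' /\ drop i.+1 t = drop i.+1 t'.
Proof.
move=> tt; split; apply: (@eq_from_nth _ 0); rewrite ?size_take ?size_drop ?size_tuple // => j.
  rewrite ltn_ord => ji; have jn := ltn_trans ji (ltn_ord i); rewrite !nth_take //.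
  by have := tt (Ordinal jn); rewrite !(tnth_nth 0); apply; rewrite -val_eqE /= ltn_eqF.
rewrite ltn_subRL => jn; rewrite !nth_drop.
have := tt (Ordinal jn); rewrite !(tnth_nth 0); apply.
by rewrite -val_eqE /=; lia.
Qed.

Lemma multilinear_slots (V W : lmodType k) n (F : seq V -> W) :
  (forall u w a x y, size (u ++ w) = n.-1 ->
     F (u ++ (a *: x + y) :: w) = a *: F (u ++ x :: w) + F (u ++ y :: w)) ->
  multilinear (fun t : n.-tuple V => F t).
Proof.
move=> mF i a t t1 t2 h1 h2 e; rewrite (tuple_slot t i) (tuple_slot t1 i) (tuple_slot t2 i).
have [-> ->] := agree_off_slot h1; have [<- <-] := agree_off_slot h2.
have [<- <-] := agree_off_slot h1; rewrite e mF //.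
rewrite size_cat size_take size_drop size_tuple ltn_ord.
by have := ltn_ord i; lia.
Qed.

Lemma total_prod_multilinear n : multilinear (@total_prod_fun n).
Proof.
apply: (multilinear_slots (F := fun s => to_ab B (alg_prod s))) => u w a x y _.
by rewrite alg_prod_multilinear linearP.
Qed.

Definition total_prod n : {linear tpow B n -> ab B} := tpow_lift (@total_prod_multilinear n).

Lemma total_prodE n t : @total_prod n (tpure t) = to_ab B (alg_prod t).
Proof. exact: tpow_liftE. Qed.

(** The monomials of f use every variable once, so f only permutes the factors of the total
    product. *)
Lemma total_prod_bsym n m (f : dS n m) x :
  total_prod m.+1 (cov_map (Bsym B) f x) = total_prod n.+1 x.
Proof.
move: x; apply: tpow_ind => [|t].
  by apply: eq_subspace => a u v; rewrite ?linearP.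
rewrite bsymE !total_prodE.
have -> : alg_prod (bsym_tensor f t) =
    alg_prod [seq tnth t i | i <- flatten f].
  rewrite map_flatten alg_prod_flatten -map_comp.
  by rewrite -[in RHS](map_tnth_enum f) -map_comp.
apply: to_ab_perm; rewrite -[X in perm_eq _ X](map_tnth_enum t).
exact/perm_map/dS_monomialsP.
Qed.

Definition aug n (p : res P 0 n) : k := res_aug P n p.

Lemma aug_con n m (f : dS n m) (p : res P 0 m) : aug (con_map (res P 0) f p) = aug p.
Proof. exact (nat_mapP (res_aug P) f p). Qed.

Lemma augZ n a (p : res P 0 n) : aug (a *: p) = a * aug p.
Proof. by rewrite /aug linearZ. Qed.

Lemma hs_to_ab_balanced :
  balanced (fun n (p : res P 0 n) (x : Bsym B n) => aug p *: total_prod n.+1 x).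
Proof.
split=> [n a p p' x|n a p x x'|n m f p x].
- by rewrite /aug linearP scalerDl -scalerA.
- by rewrite linearP scalerDr !scalerA mulrC.
- by rewrite aug_con total_prod_bsym.
Qed.

Definition hs_to_ab : {linear ftensor (Bsym B) (res P 0) -> ab B} :=
  ft_lift hs_to_ab_balanced.

Lemma hs_to_abE n (p : res P 0 n) (x : Bsym B n) :
  hs_to_ab (ftpure p x) = aug p *: total_prod n.+1 x.
Proof. exact: ft_liftE. Qed.

Let bnd := in_image (ftensor_map (Bsym B) (res_diff P 0)).
Let bnd_subspace : subspace bnd. Proof. exact: in_image_subspace. Qed.

Lemma hs_to_ab_diff z : hs_to_ab (ftensor_map (Bsym B) (res_diff P 0) z) = 0.
Proof.
move: z; apply: ft_ind => [|n p x].
  by apply: eq_subspace => a u v; rewrite ?linearP // scaler0 addr0.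
rewrite ftensor_mapE hs_to_abE.
have -> : aug (res_diff P 0 n p) = 0.
  exact ((@res_exact0 _ _ P n _).2 (ex_intro _ p erefl)).
exact: scale0r.
Qed.

Lemma ftpure_aug0 n (p : res P 0 n) (x : Bsym B n) : aug p = 0 -> bnd (ftpure p x).
Proof.
by move=> /(@res_exact0 _ _ P n p).1[y <-]; exists (ftpure y x); apply: ftensor_mapE.
Qed.

Lemma ftpure_Bl n (p p' : res P 0 n) (x : Bsym B n) :
  ftpure p x - ftpure p' x = ftpure (p - p') x.
Proof.
have -> : p - p' = (-1) *: p' + p by rewrite scaleN1r addrC.
by rewrite ftpure_linl scaleN1r addrC.
Qed.

Lemma base_point_ex : exists p : res P 0 0, aug p = 1.
Proof. exact: (@res_aug_onto _ _ P 0 1). Qed.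

Let p0 : res P 0 0 := sval (cid base_point_ex).
Let aug_p0 : aug p0 = 1. Proof. by rewrite /p0; case: cid. Qed.

Lemma ftpure_homologous n (p p' : res P 0 n) (x : Bsym B n) : aug p = aug p' ->
  bnd (ftpure p x - ftpure p' x).
Proof.
by move=> pp; rewrite ftpure_Bl; apply: ftpure_aug0; rewrite /aug linearB [X in X - _]pp subrr.
Qed.

Definition hs_point (x : B) : ftensor (Bsym B) (res P 0) := ftpure p0 (tpure [tuple x] : Bsym B 0).

Lemma hs_point_linear a x y : hs_point (a *: x + y) = a *: hs_point x + hs_point y.
Proof.
rewrite /hs_point -ftpure_linr; congr ftpure.
apply: (@tpow_gen_multilinear _ _ _ ord0) => // j; by rewrite ord1.
Qed.

Definition dS_word n (w : seq 'I_n.+1) (wP : perm_eq w (enum 'I_n.+1)) : dS n 0 :=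
  @DS n 0 [tuple w] (etrans (congr1 (fun s => perm_eq s _) (cats0 w)) wP).

Lemma hs_point_prod n (w : seq 'I_n.+1) (wP : perm_eq w (enum 'I_n.+1)) (t : n.+1.-tuple B) :
  hs_point (alg_prod [seq tnth t i | i <- w]) =
  ftpure (con_map (res P 0) (dS_word wP) p0) (tpure t : Bsym B n).
Proof.
rewrite ftpure_bal bsymE /hs_point; apply: (congr1 (fun u => ftpure p0 (tpure u : Bsym B 0))).
by apply: eq_from_tnth => j; rewrite ord1 tnth_mktuple.
Qed.

Lemma hs_to_ab_onto y : exists x, hs_to_ab x = y.
Proof.
have [x <-] := to_ab_onto y; exists (hs_point x).
by rewrite hs_to_abE aug_p0 scale1r total_prodE /= alg_mulr1.
Qed.

(** Modulo boundaries p (x) x depends on p only through its augmentation. Hence a tensor may be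
    multiplied out by a morphism to [0], and two morphisms to [0], listing the variables in
    different orders, give homologous results. That makes the commutator relators bound and every
    chain homologous to a point of B. *)
Lemma hs_to_ab_exact z : hs_to_ab z = 0 -> bnd z.
Proof.
have p00 : hs_point 0 = 0 by apply: scaleD_fun0; apply: hs_point_linear.
have comm (a b c : B) : bnd (hs_point (alg_prod [:: a; b; c] - alg_prod [:: b; a; c])).
  have -> : hs_point (alg_prod [:: a; b; c] - alg_prod [:: b; a; c]) =
      hs_point (alg_prod [:: a; b; c]) - hs_point (alg_prod [:: b; a; c]).
    by rewrite [X in hs_point X]addrC -[X in hs_point (X + _)]scaleN1r
      hs_point_linear scaleN1r addrC.
  pose t := [tuple a; b; c].
  pose i0 : 'I_3 := ord0.
  pose i1 : 'I_3 := @Ordinal 3 1 isT.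
  pose i2 : 'I_3 := @Ordinal 3 2 isT.
  have e3 : enum 'I_3 = [:: i0; i1; i2].
    by apply: (inj_map val_inj); rewrite val_enum_ord.
  have wP : perm_eq [:: i0; i1; i2] (enum 'I_3) by rewrite e3.
  have wP' : perm_eq [:: i1; i0; i2] (enum 'I_3) by rewrite e3.
  have E1 := hs_point_prod wP t; have E2 := hs_point_prod wP' t.
  rewrite /= !(tnth_nth 0) /= in E1 E2.
  rewrite [X in bnd (X - _)]E1 [X in bnd (_ - X)]E2.
  by apply: ftpure_homologous; rewrite !aug_con.
suff [y [zy zb]] : exists y, hs_to_ab z = to_ab B y /\ bnd (z - hs_point y).
  rewrite zy => y0; rewrite -(subrK (hs_point y) z); apply: subspaceD => //.
  apply: (@to_ab_eq0 k B (fun y => bnd (hs_point y))) y0 => [|a b c]; last exact: comm.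
  split; first by rewrite p00; apply: bnd_subspace.1.
  by move=> a u v bu bv; rewrite hs_point_linear; apply: bnd_subspace.2.
have sub : subspace (fun z => exists y, hs_to_ab z = to_ab B y /\ bnd (z - hs_point y)).
  split; first by exists 0; rewrite !linear0 p00 subr0; split=> //; apply: bnd_subspace.1.
  move=> a u v [y [uy ub]] [x [vx vb]]; exists (a *: y + x).
  rewrite (linearP hs_to_ab) (linearP (to_ab B)) hs_point_linear uy vx; split=> //.
  rewrite opprD addrACA -scalerBr; exact: bnd_subspace.2.
move: z; apply: ft_ind => // n p; apply: tpow_ind => [|t].
  exact (@subspace_ftpure k (Bsym B) (res P 0) n p _ sub).
(* The element p has the same augmentation as [aug p] times the pullback of [p0] along the morphism
   multiplying all factors in order. *)
exists (aug p *: alg_prod t); split.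
  by rewrite hs_to_abE total_prodE linearZ.
have E := hs_point_prod (perm_refl (enum 'I_n.+1)) t.
rewrite map_tnth_enum in E.
have -> : hs_point (aug p *: alg_prod t) = aug p *: hs_point (alg_prod t).
  by rewrite -[aug p *: alg_prod t]addr0 hs_point_linear p00 addr0.
set f := dS_word _ in E.
rewrite E -[_ *: ftpure _ _]addr0 -(ftpure_0l _ (tpure t : Bsym B n)) -ftpure_linl addr0.
apply: ftpure_homologous.
by rewrite augZ aug_con aug_p0 mulr1.
Qed.
End HSDegreeZero.

(** * Shifted resolutions *)

Section RawMorphisms.

(** Monomials as lists of numbers: composites become list computations, free of casts between
    ordinal types. *)
Definition raw n m (f : dS n m) : seq (seq nat) := map (map val) f.

Definition is_raw n m (X : seq (seq nat)) :=
  (size X == m.+1) && perm_eq (flatten X) (iota 0 n.+1).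

Lemma raw_inj n m : injective (@raw n m).
Proof.
move=> f g fg; apply/val_inj/val_inj; move: fg; apply: inj_map.
exact/inj_map/val_inj.
Qed.

Lemma rawP n m (f : dS n m) : is_raw n m (raw f).
Proof.
rewrite /is_raw size_map size_tuple eqxx andTb.
by rewrite -map_flatten -val_enum_ord; apply/perm_map/dS_monomialsP.
Qed.

Lemma nth_raw n m (f : dS n m) (j : 'I_m.+1) :
  nth [::] (raw f) j = map val (tnth f j).
Proof. by rewrite (nth_map [::]) ?size_tuple // -tnth_nth. Qed.

Definition raw_tuple n m (X : seq (seq nat)) : m.+1.-tuple (seq 'I_n.+1) :=
  [tuple map inord (nth [::] X j) | j < m.+1].

Lemma raw_tupleK n m X : is_raw n m X -> map (map val) (raw_tuple n m X) = X.
Proof.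
case/andP=> /eqP sX pX; apply: (@eq_from_nth _ [::]).
  by rewrite size_map size_tuple sX.
rewrite size_map size_tuple => j jm.
rewrite (nth_map [::]) ?size_tuple //.
have := tnth_nth [::] (raw_tuple n m X) (Ordinal jm) => <-; rewrite tnth_mktuple /=.
rewrite -map_comp map_id_in // => a aX /=; apply: inordK.
have : a \in flatten X by apply/flattenP; exists (nth [::] X j) => //; rewrite mem_nth ?sX.
by rewrite (perm_mem pX) mem_iota.
Qed.

Lemma raw_tuple_dS n m X : is_raw n m X -> is_dS (raw_tuple n m X).
Proof.
move=> rX; have /andP[_ pX] := rX.
apply: (perm_map_inj (f := val)); first exact: val_inj.
by rewrite val_enum_ord map_flatten raw_tupleK.
Qed.

Definition mk_dS n m X (rX : is_raw n m X) : dS n m := DS (raw_tuple_dS rX).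

Lemma raw_mk n m X (rX : is_raw n m X) : raw (mk_dS rX) = X.
Proof. exact: raw_tupleK. Qed.

Definition raw_subst (T : Type) (X : seq (seq T)) (Y : seq (seq nat)) :=
  [seq flatten [seq nth [::] X i | i <- y] | y <- Y].

Lemma raw_comp n m l (g : dS m l) (f : dS n m) :
  raw (dS_comp g f) = raw_subst (raw f) (raw g).
Proof.
rewrite /raw /raw_subst /= -!map_comp; apply: eq_map => y /=.
rewrite /substitute map_flatten -!map_comp; congr flatten.
by apply: eq_map => i /=; rewrite nth_raw.
Qed.

Lemma flatten_raw_subst (T : Type) (X : seq (seq T)) Y :
  flatten (raw_subst X Y) = flatten (reindex [::] X (flatten Y)).
Proof.
rewrite /raw_subst /reindex map_flatten.
by elim: Y => //= y Y ->; rewrite flatten_cat.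
Qed.

Lemma raw_id n : raw (dS_id n) = [seq [:: i] | i <- iota 0 n.+1].
Proof.
have -> : raw (dS_id n) = map (map val) (map (fun i => [:: i]) (enum 'I_n.+1)) by [].
by rewrite -val_enum_ord -!map_comp.
Qed.

Lemma raw_letter n m (f : dS n m) y i : y \in raw f -> i \in y -> (i < n.+1)%N.
Proof.
move=> yf iy; have /andP[_ pf] := rawP f.
have : i \in flatten (raw f) by apply/flattenP; exists y.
by rewrite (perm_mem pf) mem_iota.
Qed.

Lemma is_raw_shift n m X : is_raw n m X -> is_raw n.+1 m.+1 (rcons X [:: n.+1]).
Proof.
case/andP=> sX pX; rewrite /is_raw size_rcons eqSS sX flatten_rcons.
by rewrite -[n.+2]addn1 iotaD perm_cat2r.
Qed.

Definition shift n m (f : dS n m) : dS n.+1 m.+1 := mk_dS (is_raw_shift (rawP f)).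

Lemma raw_shift n m (f : dS n m) : raw (shift f) = rcons (raw f) [:: n.+1].
Proof. exact: raw_mk. Qed.

Lemma raw_subst_rcons (T : Type) (X : seq (seq T)) Y z :
  raw_subst X (rcons Y z) = rcons (raw_subst X Y) (flatten [seq nth [::] X i | i <- z]).
Proof. exact: map_rcons. Qed.

Lemma raw_subst_shift (T : Type) (X : seq (seq T)) m (Y : seq (seq nat)) z : size X = m.+1 ->
  (forall y i, y \in Y -> i \in y -> (i < m.+1)%N) ->
  raw_subst (rcons X z) (rcons Y [:: m.+1]) = rcons (raw_subst X Y) z.
Proof.
move=> sX Ym; rewrite raw_subst_rcons /= nth_rcons sX ltnn eqxx cats0.
congr rcons; apply/eq_in_map => y yY; congr flatten; apply/eq_in_map => i iy.
by rewrite nth_rcons sX (Ym y).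
Qed.

Lemma size_raw n m (f : dS n m) : size (raw f) = m.+1.
Proof. by rewrite size_map size_tuple. Qed.

Lemma shift_comp n m l (g : dS m l) (f : dS n m) :
  shift (dS_comp g f) = dS_comp (shift g) (shift f).
Proof.
apply: raw_inj; rewrite raw_shift !raw_comp !raw_shift.
by rewrite (raw_subst_shift _ (size_raw f) (@raw_letter _ _ g)).
Qed.

Lemma shift_id n : shift (dS_id n) = dS_id n.+1.
Proof.
by apply: raw_inj; rewrite raw_shift !raw_id -[n.+2]addn1 iotaD map_cat cats1.
Qed.

Lemma is_raw_incl n : is_raw n n.+1 (rcons [seq [:: i] | i <- iota 0 n.+1] [::]).
Proof.
by rewrite /is_raw size_rcons size_map size_iota eqxx flatten_rcons cats0 flatten_seq1 /=.
Qed.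
Definition incl n : dS n n.+1 := mk_dS (is_raw_incl n).

Lemma raw_subst_id (T : Type) (X : seq (seq T)) n : size X = n.+1 ->
  raw_subst X [seq [:: i] | i <- iota 0 n.+1] = X.
Proof.
move=> sX; rewrite /raw_subst -map_comp -[RHS](mkseq_nth [::]) sX.
by apply: eq_map => i /=; rewrite cats0.
Qed.

Lemma raw_subst_singletons X s : raw_subst [seq [:: i] | i <- X] s =
  [seq [seq nth 0%N X i | i <- y & (i < size X)%N] | y <- s].
Proof.
apply: eq_map => y; elim: y => //= i y IH.
case: ltnP => iX; last by rewrite nth_default ?size_map.
by rewrite (nth_map 0%N) //= IH.
Qed.

Lemma incl_natural n m (f : dS n m) :
  dS_comp (shift f) (incl n) = dS_comp (incl m) f.
Proof.
apply: raw_inj; rewrite !raw_comp raw_shift !raw_mk.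
rewrite (raw_subst_shift _ _ (@raw_letter _ _ f)) ?size_map ?size_iota //.
rewrite raw_subst_rcons raw_subst_id ?size_raw //; apply: (congr1 (fun X => rcons X [::])).
rewrite raw_subst_singletons -[RHS]map_id; apply/eq_in_map => y yf.
rewrite size_iota; have -> : [seq i <- y | (i < n.+1)%N] = y.
  by apply/all_filterP/allP => i; apply: raw_letter yf.
rewrite -[RHS]map_id; apply/eq_in_map => i iy.
by rewrite nth_iota // (raw_letter yf iy).
Qed.

Lemma is_raw_retract n :
  is_raw n.+1 n (rcons [seq [:: i] | i <- iota 0 n] [:: n; n.+1]).
Proof.
rewrite /is_raw size_rcons size_map size_iota eqxx flatten_rcons flatten_seq1.
by rewrite -[n.+2]addn2 iotaD perm_refl.
Qed.
(** The last two slots are multiplied together. This is not natural in n, but it suffices for lifts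
    along [incl] to exist at each object; projectivity then makes them natural. *)
Definition retraction n : dS n.+1 n := mk_dS (is_raw_retract n).

Lemma retraction_incl n : dS_comp (retraction n) (incl n) = dS_id n.
Proof.
apply: raw_inj; rewrite raw_comp !raw_mk raw_id raw_subst_rcons.
set X := rcons _ [::].
have nX i : nth [::] X i = if (i < n.+1)%N then [:: i] else [::].
  rewrite nth_rcons size_map size_iota; case: ltnP => ni; last by rewrite if_same.
  by rewrite (nth_map 0%N) ?size_iota // nth_iota.
move: nX; clearbody X => nX.
have -> : iota 0 n.+1 = rcons (iota 0 n) n by rewrite -cats1 -[n.+1]addn1 iotaD.
rewrite map_rcons; congr rcons; last by rewrite /= !nX ltnSn ltnn.
rewrite /raw_subst -map_comp; apply/eq_in_map => i; rewrite mem_iota /= add0n => ni.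
by rewrite cats0 nX ltnS ltnW.
Qed.
End RawMorphisms.

Section ShiftedResolution.
Variables (k : fieldType) (P : projResolution (const_functor k)).

Lemma shift_con_id (Q : contraFunctor k) n (x : Q n.+1) : con_map Q (shift (dS_id n)) x = x.
Proof. by rewrite shift_id; apply: con_id. Qed.

Lemma shift_con_comp (Q : contraFunctor k) n m l (g : dS m l) (f : dS n m) (x : Q l.+1) :
  con_map Q (shift (dS_comp g f)) x =
  con_map Q (shift f) (con_map Q (shift g) x).
Proof. by rewrite shift_comp; apply: con_comp. Qed.

Definition shifted (Q : contraFunctor k) : contraFunctor k :=
  @ContraFunctor k (fun n => Q n.+1) (fun n m f => con_map Q (shift f))
    (@shift_con_id Q) (@shift_con_comp Q).

Lemma incl_retraction_pull (Q : contraFunctor k) n (x : Q n) :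
  con_map Q (incl n) (con_map Q (retraction n) x) = x.
Proof. by rewrite -con_comp retraction_incl con_id. Qed.

Lemma incl_shift_pull (Q : contraFunctor k) n m (f : dS n m) (y : Q m.+1) :
  con_map Q (incl n) (con_map Q (shift f) y) = con_map Q f (con_map Q (incl m) y).
Proof. by rewrite -!con_comp incl_natural. Qed.

Local Notation d := (res_diff P).

Lemma res_diff_sqr i n (x : P i.+2 n) : d i n (d i.+1 n x) = 0.
Proof. by apply/res_exactS; exists x. Qed.

Definition shift_section q (phi : contraMap (P q) (shifted (P q))) :=
  forall n p, con_map (P q) (incl n) (phi n p) = p.

Definition shift_lift q (phi : contraMap (P q) (shifted (P q)))
    (psi : contraMap (P q.+1) (shifted (P q.+1))) :=
  forall n p, d q n.+1 (psi n p) = phi n (d q n p).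

(** Being a section of the pullback along [incl] and lifting phi along d are jointly a natural
    linear condition, so only pointwise solvability has to be checked. *)
Lemma shift_lift_exists q phi : @shift_section q phi ->
  (forall n p, exists y, d q n.+1 y = phi n (d q n p)) ->
  exists psi, shift_section psi /\ shift_lift phi psi.
Proof.
move=> sphi tot.
pose R n (p : P q.+1 n) (y : shifted (P q.+1) n) :=
  con_map (P q.+1) (incl n) y = p /\ d q n.+1 y = phi n (d q n p).
have [psi Rpsi] : exists psi : contraMap (P q.+1) (shifted (P q.+1)),
    forall n p, R n p (psi n p).
  apply: projective_select; first exact: res_projective.
  - move=> n; split; first by split; rewrite !linear0.
    by move=> a u v x y [ux dx] [vy dy]; split; rewrite !linearP ?ux ?vy ?dx ?dy.
  - move=> n m f p y [yp dy]; split.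
      by apply: etrans (incl_shift_pull f y) _; rewrite yp.
    apply: etrans (nat_mapP (d q) (shift f) y) _; rewrite dy.
    apply: etrans (esym (nat_mapP phi f _)) _.
    by apply: (congr1 (phi n)); apply/esym/nat_mapP.
  move=> n p; have [y1 dy1] := tot n p.
  have : d q n (con_map (P q.+1) (incl n) y1 - p) = 0.
    by rewrite linearB nat_mapP dy1 sphi subrr.
  move=> /(@res_exactS _ _ P q n _).1[u du].
  (* The pullback of y1 along [incl] differs from p by a boundary d u. The retraction extends u to
     n+1, and subtracting the boundary of the extension corrects the pullback without affecting d
     y1. *)
  exists (y1 - d q.+1 n.+1 (con_map (P q.+2) (retraction n) u)); split.
    rewrite linearB /= -nat_mapP incl_retraction_pull du.
    by rewrite opprB addrC subrK.
  by rewrite linearB res_diff_sqr subr0.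
by exists psi; split=> n p; have [] := Rpsi n p.
Qed.

(** The induction carries two consecutive degrees, because phi after d is shown to be a boundary by
    means of the lifting relation one degree lower. A homotopy in a given degree needs no more than
    such a pair. *)
Lemma shift_lift_pair q : exists phi psi,
  [/\ @shift_section q phi, shift_section psi & shift_lift phi psi].
Proof.
elim: q => [|q [phi [psi [sphi spsi lpsi]]]].
  have [phi sphi] : exists phi : contraMap (P 0) (shifted (P 0)), shift_section phi.
    pose R n (p : P 0%N n) (y : shifted (P 0) n) := con_map (P 0) (incl n) y = p.
    have [phi Rphi] : exists phi : contraMap (P 0) (shifted (P 0)),
        forall n p, R n p (phi n p).
      apply: projective_select; first exact: res_projective.
      - move=> n; split; first by rewrite /R linear0.
        by move=> a u v x y ux vy; rewrite /R linearP ux vy.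
      - by move=> n m f p y yp; apply: etrans (incl_shift_pull f y) _; rewrite yp.
      - by move=> n p; exists (con_map (P 0) (retraction n) p); apply: incl_retraction_pull.
    by exists phi.
  have [|psi [spsi lpsi]] := shift_lift_exists sphi; last by exists phi, psi.
  move=> n p; apply/(@res_exact0 _ _ P n.+1 _).1.
  (* The constant functor sends [incl] to the identity, so a section of the pullback along [incl]
     preserves augmentations. *)
  apply: etrans (esym (nat_mapP (res_aug P) (incl n) (phi n (d 0 n p)))) _.
  by rewrite sphi; apply/(@res_exact0 _ _ P n _).2; exists p.
have [|chi [schi lchi]] := shift_lift_exists spsi; last by exists psi, chi.
move=> n p; apply/(@res_exactS _ _ P q n.+1 _).1.
by rewrite lpsi res_diff_sqr linear0.
Qed.

Lemma contraction_step q n (s : {linear P q n -> P q.+1 n}) :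
  (forall p, d q n (s (d q n p)) = d q n p) ->
  exists t : {linear P q.+1 n -> P q.+2 n}, forall p, d q.+1 n (t p) = p - s (d q n p).
Proof.
move=> sd; pose R (p : P q.+1 n) (y : P q.+2 n) := d q.+1 n y = p - s (d q n p).
have [t Rt] : exists t : {linear P q.+1 n -> P q.+2 n}, forall p, R p (t p).
  apply: linear_select; first exact: res_projective.
    split; first by rewrite /R !linear0 ?subr0 ?addr0.
    move=> a u v x y du dv; rewrite /R (linearP (d q.+1 n)) (linearP (d q n)).
    by rewrite (linearP s) du dv opprD addrACA -scalerBr.
  move=> p; have : d q n (p - s (d q n p)) = 0 by rewrite linearB sd subrr.
  by move=> /(@res_exactS _ _ P q n _).1.
by exists t.
Qed.

(** At a fixed object the resolution is an exact complex of vector spaces and therefore splits. The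
    equation d s d = d says that s is a section of d on its image; s is not natural in n. *)
Lemma pointwise_contraction q n : exists s : {linear P q n -> P q.+1 n},
  forall p, d q n (s (d q n p)) = d q n p.
Proof.
elim: q => [|q [s sd]].
  (* Subtracting a multiple of an element of augmentation 1 brings p into the kernel of the
     augmentation, that is, into the image of d. *)
  have [p0 ap0] := @res_aug_onto _ _ P n (1 : k).
  pose R (p : P 0%N n) (y : P 1%N n) := d 0 n y = p - (res_aug P n p : k) *: p0.
  have [s sE] : exists s : {linear P 0 n -> P 1 n}, forall p, R p (s p).
    apply: linear_select; first exact: res_projective.
      split; first by rewrite /R !linear0 scale0r ?subr0 ?addr0.
      move=> a u v x y du dv; rewrite /R (linearP (d 0 n)) du dv.
      rewrite (linearP (res_aug P n)) scalerDl -scalerA.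
      by rewrite opprD addrACA -scalerBr.
    move=> p; have : res_aug P n (p - (res_aug P n p : k) *: p0) = 0.
      rewrite linearB linearZ [X in _ - X](_ : _ = res_aug P n p) ?subrr //.
      by rewrite /= ap0; apply: mulr1.
    by move=> /(@res_exact0 _ _ P n _).1.
  exists s => p; rewrite sE.
  have -> : res_aug P n (d 0 n p) = 0 by apply/(@res_exact0 _ _ P n _).2; exists p.
  by rewrite scale0r subr0.
have [t tE] := contraction_step sd.
by exists t => p; rewrite tE res_diff_sqr linear0 subr0.
Qed.

Lemma contraction_pair q n : exists (s : {linear P q n -> P q.+1 n})
    (t : {linear P q.+1 n -> P q.+2 n}),
  forall p, d q.+1 n (t p) + s (d q n p) = p.
Proof.
have [s sd] := pointwise_contraction q n.
have [t tE] := contraction_step sd.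
by exists s, t => p; rewrite tE subrK.
Qed.
End ShiftedResolution.

(** * Placing letters *)

Section InversePermutation.

Definition inverse_perm (L : seq nat) := [seq index a L | a <- iota 0 (size L)].

Lemma is_oneline_inverse m L : is_oneline m L -> is_oneline m (inverse_perm L).
Proof.
move=> hL; have uL : uniq L by rewrite (perm_uniq hL) iota_uniq.
have e : [seq index a L | a <- L] = iota 0 m.
  apply: (@eq_from_nth _ 0%N); rewrite size_map ?size_iota (is_oneline_size hL) // => i im.
  by rewrite (nth_map 0%N) ?(is_oneline_size hL) // nth_iota // index_uniq ?(is_oneline_size hL).
by rewrite /is_oneline -e /inverse_perm (is_oneline_size hL) perm_map // perm_sym.
Qed.

Lemma reindex_inj_left m h : is_oneline m h ->
  {in is_oneline m &, injective (fun L => reindex 0%N L h)}.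
Proof.
move=> hh L L' hL hL' LL; apply: (@eq_from_nth _ 0%N) => [|j jL].
  by rewrite !(@is_oneline_size m).
have jh : j \in h by rewrite (perm_mem hh) mem_iota /= add0n -(is_oneline_size hL).
have := congr1 (fun s => nth 0%N s (index j h)) LL.
by rewrite /reindex !(nth_map 0%N) ?index_mem // nth_index.
Qed.


End InversePermutation.

Section Letters.
Variables (k : fieldType) (V : lmodType k).

(** The letter number i of v is put at position L_i. *)
Definition place (v : seq V) (L : seq nat) : seq V := reindex 0 v (inverse_perm L).

Lemma size_place v L : size (place v L) = size L.
Proof. by rewrite size_reindex size_map size_iota. Qed.

Lemma nth_place m v L a : is_oneline m L -> (a < m)%N ->
  nth 0 (place v L) a = nth 0 v (index a L).
Proof.
move=> hL am; rewrite (nth_map 0%N) ?size_map ?size_iota ?(is_oneline_size hL) //.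
by rewrite (nth_map 0%N) ?size_iota ?(is_oneline_size hL) // nth_iota ?(is_oneline_size hL).
Qed.

(** When letters and labels are permuted together, every letter keeps its position. *)
Lemma place_reindex m v L h : size v = m -> is_oneline m L -> is_oneline m h ->
  place (reindex 0 v h) (reindex 0%N L h) = place v L.
Proof.
move=> sv hL hh; have hLh := is_oneline_reindex hL hh.
apply: (@eq_from_nth _ 0); rewrite !size_place !(@is_oneline_size m) // => a am.
rewrite !(@nth_place m) //; set i := index a (reindex _ _ _).
have im : (i < m)%N.
  by rewrite /i -(is_oneline_size hLh) index_mem (perm_mem hLh) mem_iota.
have e : nth 0%N L (nth 0%N h i) = a.
  have <- : nth 0%N (reindex 0%N L h) i = a.
    by rewrite nth_index // (perm_mem hLh) mem_iota.
  by rewrite (nth_map 0%N) ?(is_oneline_size hh).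
have ihm : (nth 0%N h i < m)%N.
  by apply: (is_oneline_lt hh); rewrite mem_nth // (is_oneline_size hh).
rewrite (nth_map 0%N) ?(is_oneline_size hh) // -[in RHS]e index_uniq //.
  by rewrite (is_oneline_size hL).
by rewrite (perm_uniq hL) iota_uniq.
Qed.

Lemma map_place m (v : seq V) L : size v = m -> is_oneline m L ->
  [seq nth 0 (place v L) a | a <- L] = v.
Proof.
move=> sv hL; apply: (@eq_from_nth _ 0); rewrite size_map ?(is_oneline_size hL) // => i im.
rewrite (nth_map 0%N) ?(is_oneline_size hL) // (nth_place _ hL); last first.
  by apply: (is_oneline_lt hL); rewrite mem_nth // (is_oneline_size hL).
by rewrite index_uniq ?(is_oneline_size hL) // (perm_uniq hL) iota_uniq.
Qed.

Lemma place_multilinear m L (W : lmodType k) (F : seq V -> W) u w a x y :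
  is_oneline m L -> (size u + size w).+1 = m -> word_multilinear F ->
  F (place (u ++ (a *: x + y) :: w) L) =
  a *: F (place (u ++ x :: w) L) + F (place (u ++ y :: w) L).
Proof.
move=> hL sm mF; have hI : is_oneline (size u + size w).+1 (inverse_perm L).
  by rewrite sm; apply: is_oneline_inverse.
by have [A [B [_ E]]] := reindex_slot 0 hI; rewrite /place !E mF.
Qed.

(* The junk value 0 makes tens n multilinear on words of every length. *)
Definition tens n (ys : seq V) : tpow V n :=
  if size ys == n then tpure [tuple nth 0 ys j | j < n] else 0.

Lemma tens_tuple n (t : n.-tuple V) : tens n t = tpure t.
Proof.
rewrite /tens size_tuple eqxx; congr tpure; apply: eq_from_tnth => i.
by rewrite tnth_mktuple -tnth_nth.
Qed.

Lemma tens_multilinear n : word_multilinear (@tens n).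
Proof.
move=> u w a x y; rewrite /tens !size_cat /=; case: eqP => [e|_]; last first.
  by rewrite scaler0 addr0.
have iu : (size u < n)%N by rewrite -e addnS ltnS leq_addr.
apply: (@tpow_gen_multilinear _ _ _ (Ordinal iu)).
- move=> j; rewrite -val_eqE /= !tnth_mktuple !nth_cat => ju.
  case: ltnP => // uj; have : (0 < j - size u)%N by rewrite subn_gt0 ltn_neqAle eq_sym ju.
  by case: (j - size u)%N.
- move=> j; rewrite -val_eqE /= !tnth_mktuple !nth_cat => ju.
  case: ltnP => // uj; have : (0 < j - size u)%N by rewrite subn_gt0 ltn_neqAle eq_sym ju.
  by case: (j - size u)%N.
- by rewrite !tnth_mktuple !nth_cat /= ltnn subnn.
Qed.

Lemma tpow_spanning_ind n (G : V -> Prop) (S : tpow V n -> Prop) :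
  spanning G -> subspace S ->
  (forall ys, size ys = n -> (forall y, y \in ys -> G y) -> S (tens n ys)) ->
  forall x, S x.
Proof.
move=> sG sS SG; apply: tpow_ind => // t; rewrite -tens_tuple.
apply: (word_multilinear_ind sG (@tens_multilinear n) sS) => ys Gys.
have [sn|sn] := eqVneq (size ys) n; first exact: SG.
by rewrite /tens (negbTE sn); apply: sS.1.
Qed.
End Letters.

Lemma tpow_words_ind (k : fieldType) (V : lmodType k) n (S : tpow (T V) n -> Prop) :
  subspace S ->
  (forall ws : seq (seq V), size ws = n -> S (tens n (map (@word k V) ws))) ->
  forall x, S x.
Proof.
move=> sS Sw; apply: (tpow_spanning_ind (@spanning_word k V)) => // ys sn Gys.
by have [ws ysE] := all_words Gys; rewrite ysE; apply: Sw; rewrite -sn ysE size_map.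
Qed.

Section RawPullback.
Variables (k : fieldType) (Q : contraFunctor k).

(** Zero when the list is not a morphism; sums over all labellings can then be written without a
    proof for each summand. *)
Definition con_raw n m (X : seq (seq nat)) : {linear Q m -> Q n} :=
  match Bool.bool_dec (is_raw n m X) true with
  | left rX => con_map Q (mk_dS rX)
  | right _ => \0
  end.

Lemma con_rawE n m (f : dS n m) : con_raw n m (raw f) = con_map Q f.
Proof.
rewrite /con_raw; case: (Bool.bool_dec _ _) => [rX|]; last by rewrite rawP.
by congr (con_map Q _); apply: raw_inj; rewrite raw_mk.
Qed.

Lemma con_raw_mk n m X (rX : is_raw n m X) : con_raw n m X = con_map Q (mk_dS rX).
Proof. by rewrite -con_rawE raw_mk. Qed.
End RawPullback.

Lemma con_raw_natural (k : fieldType) (Q Q' : contraFunctor k) (e : contraMap Q Q')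
    n m X y : e n (con_raw Q n m X y) = con_raw Q' n m X (e m y).
Proof.
rewrite /con_raw; case: (Bool.bool_dec _ _) => rX; first exact: nat_mapP.
exact: linear0.
Qed.

Lemma bsym_raw (k : fieldType) (A : unitalAlgebra k) n m (f : dS n m) (ys : seq A) :
  size ys = n.+1 ->
  cov_map (Bsym A) f (tens n.+1 ys) =
  tens m.+1 [seq alg_prod [seq nth 0 ys i | i <- y] | y <- raw f].
Proof.
move=> sn; pose t := tcast sn (in_tuple ys); have -> : ys = t by rewrite val_tcast.
rewrite tens_tuple bsymE -tens_tuple; congr tens.
apply: (@eq_from_nth _ 0); rewrite size_tuple ?size_map ?size_tuple // => j jm.
rewrite -(tnth_nth 0 _ (Ordinal jm)) tnth_mktuple.
rewrite (nth_map [::]) ?size_raw // (nth_raw f (Ordinal jm)) -map_comp.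
by congr alg_prod; apply: eq_map => i /=; rewrite (tnth_nth 0).
Qed.

(** * The contraction for a free algebra *)

Section Substitution.

Lemma shape_raw_subst (X : Type) (w : seq (seq X)) Y :
  shape (raw_subst w Y) = [seq sumn [seq nth 0%N (shape w) i | i <- y] | y <- Y].
Proof.
rewrite /raw_subst /shape -map_comp; apply: eq_map => y /=.
rewrite size_flatten /shape -map_comp; congr sumn; apply: eq_map => i /=.
have [iw|wi] := ltnP i (size w); first by rewrite (nth_map [::]).
by rewrite !nth_default ?size_map.
Qed.

(** Substituting labelled blocks into f moves whole blocks of labels, so it amounts to permuting L
    by the block permutation of f and cutting the result along the new word lengths. *)
Lemma raw_subst_reshape (X : Type) (w : seq (seq X)) L n m (f : dS n m) :
  size w = n.+1 -> is_oneline (size (flatten w)) L ->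
  raw_subst (reshape (shape w) L) (raw f) =
  reshape (shape (raw_subst w (raw f)))
    (reindex 0%N L (blocks (flatten (raw f)) (shape w))).
Proof.
move=> sw hL; have szL : size L = sumn (shape w).
  by rewrite (is_oneline_size hL) size_flatten.
have shE : shape (reshape (shape w) L) = shape w by rewrite reshapeKl ?szL.
have flE : flatten (reshape (shape w) L) = L by rewrite reshapeKr ?szL.
have /andP[_ pf] := rawP f.
have szr : size (reshape (shape w) L) = n.+1 by rewrite size_reshape size_map.
rewrite -[LHS]flattenK !shape_raw_subst shE; congr reshape.
have := @reindex_blocks _ 0%N (reshape (shape w) L) (flatten (raw f)).
by rewrite flE shE flatten_raw_subst szr => ->.
Qed.
End Substitution.

Section WordContraction.
Variables (k : fieldType) (char0 : [pchar k] =i pred0) (V : lmodType k).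
Variables (Q Q' : contraFunctor k) (phi : contraMap Q (shifted Q)).
Variable s : forall m, {linear Q m -> Q' m}.

Local Notation FV := (free_alg V).
Local Notation M := (Bsym FV).

Definition placed_word (v : seq V) L : seq FV :=
  rcons (map (T_unit V) (place v L)) (word [::]).

(** The morphism [m] -> [n+1] has as monomials the labels L cut along [sh], followed by the extra
    variable x_m alone. That variable carries the empty word added by [placed_word] and is matched
    by the extra slot that phi gives to p. Only after pulling back to [m], where the tensor consists
    of bare letters, is the map s applied. *)
Definition contraction_term n (p : Q n) (sh : seq nat) m (v : seq V) L : ftensor M Q' :=
  ftpure (s m (con_raw Q m n.+1 (rcons (reshape sh L) [:: m]) (phi n p)))
    (tens m.+1 (placed_word v L) : M m).

(* The words with m letters in total are written as the image of their letters
   under a morphism of Delta S; the labelling of the letters is averaged. *)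
Definition contraction_words n (p : Q n) sh m (v : seq V) : ftensor M Q' :=
  (m`!%:R)^-1 *: \sum_(L <- perms m) contraction_term p sh m v L.

Definition contraction_gen n (p : Q n) (ws : seq (seq V)) : ftensor M Q' :=
  contraction_words p (shape ws) (size (flatten ws)) (flatten ws).

Lemma scale_sum_combination (W : lmodType k) (I : eqType) (r : seq I) c a
    (F G H : I -> W) : (forall i, i \in r -> F i = a *: G i + H i) ->
  c *: \sum_(i <- r) F i = a *: (c *: \sum_(i <- r) G i) + c *: \sum_(i <- r) H i.
Proof.
move=> E; rewrite scalerA mulrC -scalerA -scalerDr; congr (_ *: _).
rewrite scaler_sumr -big_split; apply: eq_big_seq => i ir.
exact: E.
Qed.

Lemma contraction_words_multilinear n (p : Q n) sh m u w a x y :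
  (size u + size w).+1 = m ->
  contraction_words p sh m (u ++ (a *: x + y) :: w) =
  a *: contraction_words p sh m (u ++ x :: w) + contraction_words p sh m (u ++ y :: w).
Proof.
move=> sm; apply: scale_sum_combination => L; rewrite mem_perms => hL.
rewrite -ftpure_linr; apply: (congr1 (ftpure _)).
pose F (v : seq V) : tpow FV m.+1 := tens m.+1 (rcons (map (T_unit V) v) (word [::])).
apply: (place_multilinear (F := F) _ _ _ hL sm) => u' w' b x' y'.
have FE z : F (u' ++ z :: w') = tens m.+1 (map (T_unit V) u' ++
      T_unit V z :: rcons (map (T_unit V) w') (word [::])).
    by rewrite /F map_cat rcons_cat.
  by rewrite !FE linearP; apply: tens_multilinear.
Qed.

Lemma contraction_words_linear n a (p p' : Q n) sh m v :
  contraction_words (a *: p + p') sh m v =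
  a *: contraction_words p sh m v + contraction_words p' sh m v.
Proof.
apply: scale_sum_combination => L _; rewrite -ftpure_linl.
apply: (congr1 (fun z => ftpure z _)).
rewrite (linearP (phi n)) (linearP (con_raw Q m n.+1 _)); exact: linearP.
Qed.

Lemma contraction_gen_relators n (p : Q n) N :
  kills_relators (@T_rel k V) N (contraction_gen p).
Proof.
move=> xs ys r _ [u w a x y]; rewrite !linearB linearZ /= !linextU.
have E z : contraction_gen p (xs ++ (u ++ z :: w) :: ys) =
    contraction_words p (shape (xs ++ (u ++ x :: w) :: ys))
      (size (flatten xs ++ u) + size (w ++ flatten ys)).+1
      ((flatten xs ++ u) ++ z :: (w ++ flatten ys)).
  rewrite /contraction_gen.
  have -> : flatten (xs ++ (u ++ z :: w) :: ys) =
      (flatten xs ++ u) ++ z :: (w ++ flatten ys).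
    by rewrite flatten_cat /= -!catA.
  have -> : shape (xs ++ (u ++ z :: w) :: ys) = shape (xs ++ (u ++ x :: w) :: ys).
    by rewrite /shape !map_cat /= !size_cat.
  by rewrite [size (_ ++ z :: _)]size_cat /= addnS.
rewrite !E contraction_words_multilinear //.
by rewrite addrAC addrK subrr.
Qed.

Definition contraction_tuple n (p : Q n) (t : n.+1.-tuple FV) : ftensor M Q' :=
  mlext (t : seq (presented (@T_rel k V))) (contraction_gen p).

Lemma contraction_tuple_multilinear n (p : Q n) : multilinear (contraction_tuple p).
Proof.
apply: (@multilinear_slots k _ _ n.+1
  (fun ys : seq FV => mlext (ys : seq (presented (@T_rel k V))) (contraction_gen p))).
move=> u w a x y _; apply: (@mlext_slot k _ _ (@T_rel k V)).
exact: contraction_gen_relators.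
Qed.

Definition contraction_tensor n (p : Q n) : {linear tpow FV n.+1 -> ftensor M Q'} :=
  tpow_lift (contraction_tuple_multilinear p).

Lemma contraction_tensorE n (p : Q n) ws : size ws = n.+1 ->
  contraction_tensor p (tens n.+1 (map (@word k V) ws)) = contraction_gen p ws.
Proof.
move=> sn; have sn' : size (map (@word k V) ws) = n.+1 by rewrite size_map.
pose t := tcast sn' (in_tuple (map (@word k V) ws)).
have tE : map (@word k V) ws = t by rewrite val_tcast.
rewrite [in LHS]tE (@tens_tuple k FV) [LHS]tpow_liftE /contraction_tuple -tE.
apply: (@mlext_gen k _ _ (@T_rel k V)) => N.
exact: contraction_gen_relators.
Qed.

(** By naturality of phi, pulling p back along f is the same as permuting the letters and their
    labels by one block permutation, which leaves the placed word unchanged. *)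
Lemma contraction_term_map n n' (f : dS n n') (p : Q n') (ws : seq (seq V)) L :
  size ws = n.+1 -> is_oneline (size (flatten ws)) L ->
  let tau := blocks (flatten (raw f)) (shape ws) in
  contraction_term (con_map Q f p) (shape ws) (size (flatten ws)) (flatten ws) L =
  contraction_term p (shape (raw_subst ws (raw f))) (size (flatten ws))
    (reindex 0 (flatten ws) tau) (reindex 0%N L tau).
Proof.
move=> sw hL tau; set m := size (flatten ws).
have /andP[_ pf] := rawP f.
have htau : is_oneline m tau.
  by rewrite /m size_flatten; apply: is_oneline_blocks; rewrite size_map sw.
rewrite /contraction_term /placed_word (place_reindex (erefl m) hL htau).
apply: (congr1 (fun z => ftpure (s m z) _)).
rewrite -(raw_subst_reshape f sw hL).
have szL : size L = sumn (shape ws).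
  by rewrite (is_oneline_size hL) size_flatten.
have rX : is_raw m n.+1 (rcons (reshape (shape ws) L) [:: m]).
  rewrite /is_raw size_rcons size_reshape size_map sw eqxx flatten_rcons.
  rewrite reshapeKr ?szL // -[m.+1]addn1 iotaD perm_cat2r.
  exact: hL.
rewrite (con_raw_mk _ rX).
apply: etrans (congr1 (con_map Q (mk_dS rX)) (nat_mapP phi f p)) _.
apply: etrans (esym (con_comp (shift f) (mk_dS rX) (phi n' p))) _.
rewrite -con_rawE raw_comp raw_mk raw_shift raw_subst_shift //.
  by rewrite size_reshape size_map.
exact: raw_letter.
Qed.

(** The labelling L on one side corresponds to L after tau on the other. As s does not commute with
    permutations of the variables, the individual terms are not balanced, but their sum over all
    labellings is. *)
Lemma contraction_gen_map n n' (f : dS n n') (p : Q n') (ws : seq (seq V)) :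
  size ws = n.+1 ->
  contraction_gen (con_map Q f p) ws = contraction_gen p (raw_subst ws (raw f)).
Proof.
move=> sw; have /andP[_ pf] := rawP f.
set tau := blocks (flatten (raw f)) (shape ws).
have htau : is_oneline (size (flatten ws)) tau.
  by rewrite size_flatten; apply: is_oneline_blocks; rewrite size_map sw.
have flE : flatten (raw_subst ws (raw f)) = reindex 0 (flatten ws) tau.
  by rewrite flatten_raw_subst reindex_blocks // sw.
rewrite /contraction_gen flE size_reindex (is_oneline_size htau).
rewrite /contraction_words; apply: (congr1 (fun z => _ *: z)).
apply: etrans _ (@sum_perms _ _ (fun L => reindex 0%N L tau) _ _
  (reindex_inj_left htau)); last by move=> L hL; apply: is_oneline_reindex.
apply: eq_big_seq => L; rewrite mem_perms => hL.
exact: contraction_term_map.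
Qed.

Lemma contraction_balanced :
  balanced (fun n (p : Q n) (x : M n) => contraction_tensor p x).
Proof.
split=> [n a p p' x|n a p x x'|n n' f p x]; last 1 first.
- move: x; apply: (@tpow_words_ind k V) => [|ws sw].
    by apply: eq_subspace => a u v; rewrite ?linearP.
  have -> : cov_map M f (tens n.+1 (map (@word k V) ws)) =
      tens n'.+1 (map (@word k V) (raw_subst ws (raw f))).
    rewrite bsym_raw; last by rewrite size_map.
    apply: (congr1 (tens n'.+1)); rewrite /raw_subst -[RHS]map_comp.
    apply/eq_in_map => y yf.
    apply: etrans _ (@free_alg_prod_words k V [seq nth [::] ws i | i <- y]).
    apply: (congr1 (@alg_prod k FV)); rewrite -map_comp; apply/eq_in_map => i iy.
    have iw : (i < size ws)%N by rewrite sw (raw_letter yf iy).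
    exact: (nth_map [::] 0 (@word k V) iw).
  have sw' : size (raw_subst ws (raw f)) = n'.+1 by rewrite size_map size_raw.
  rewrite (contraction_tensorE _ sw) (contraction_tensorE _ sw').
  exact: contraction_gen_map.
- move: x; apply: (@tpow_words_ind k V) => [|ws sw].
    apply: eq_subspace; last exact: linear_combination.
    by move=> b u v; rewrite linearP.
  rewrite !(contraction_tensorE _ sw); exact: contraction_words_linear.
- exact: linearP.
Qed.

Definition word_contraction : {linear ftensor M Q -> ftensor M Q'} :=
  ft_lift contraction_balanced.

Lemma word_contractionE n (p : Q n) ws : size ws = n.+1 ->
  word_contraction (ftpure p (tens n.+1 (map (@word k V) ws) : M n)) =
  contraction_gen p ws.
Proof. by move=> sw; rewrite ft_liftE contraction_tensorE. Qed.
End WordContraction.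

(** * Symmetric homology of a free algebra *)

Section FreeHS.
Variables (k : fieldType) (char0 : [pchar k] =i pred0) (V : lmodType k).

Local Notation FV := (free_alg V).
Local Notation M := (Bsym FV).

Lemma bsym_incl n (ws : seq (seq V)) : size ws = n.+1 ->
  cov_map M (incl n) (tens n.+1 (map (@word k V) ws)) =
  tens n.+2 (rcons (map (@word k V) ws) (word [::])).
Proof.
move=> sw; rewrite bsym_raw; last by rewrite size_map.
apply: (congr1 (tens n.+2)).
rewrite raw_mk map_rcons; apply: (congr1 (fun X => rcons X _)).
rewrite -map_comp; apply: (@eq_from_nth _ (0 : FV)); rewrite !size_map size_iota.
  by rewrite sw.
move=> i im; rewrite (nth_map 0%N) ?size_iota // nth_iota // add0n.
by apply: alg_mulr1.
Qed.

Lemma bsym_placed_word n (ws : seq (seq V)) L (m := size (flatten ws))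
    (rX : is_raw m n.+1 (rcons (reshape (shape ws) L) [:: m])) :
  size ws = n.+1 -> is_oneline m L ->
  cov_map M (mk_dS rX) (tens m.+1 (placed_word (flatten ws) L)) =
  tens n.+2 (rcons (map (@word k V) ws) (word [::])).
Proof.
move=> sw hL; have szp : size (map (T_unit V) (place (flatten ws) L)) = m.
  by rewrite size_map size_place (is_oneline_size hL).
rewrite bsym_raw; last by rewrite size_rcons szp.
apply: (congr1 (tens n.+2)); rewrite raw_mk map_rcons.
have szL : size L = sumn (shape ws).
  by rewrite (is_oneline_size hL) /m size_flatten.
have flE : flatten (reshape (shape ws) L) = L by rewrite reshapeKr ?szL.
apply: (congr2 rcons).
  have wsE : ws = map (map (nth 0 (place (flatten ws) L))) (reshape (shape ws) L).
    by rewrite map_reshape (map_place erefl hL) flattenK.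
  rewrite [in RHS]wsE -map_comp; apply/eq_in_map => y yX.
  have -> : [seq nth (0 : FV) (placed_word (flatten ws) L) i | i <- y] =
      map (@word k V) [seq [:: nth 0 (place (flatten ws) L) i] | i <- y].
    rewrite -map_comp; apply/eq_in_map => i iy.
    have im : (i < m)%N.
      apply: (is_oneline_lt hL); rewrite -flE; apply/flattenP; by exists y.
    rewrite /placed_word nth_rcons szp im (nth_map 0) //.
    by rewrite size_place (is_oneline_size hL).
  apply: etrans (free_alg_prod_words _) _; apply: (congr1 (@word k V)).
  by rewrite (map_comp (fun x => [:: x])) flatten_seq1.
rewrite /placed_word [map _ [:: m]]/= nth_rcons szp ltnn eqxx.
exact: alg_mulr1.
Qed.

(** Without s each summand is already p (x) w: the labelled morphism sends the placed letters to the
    words followed by an empty word, this is the image of the words under [incl], and phi is a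
    section of the pullback along [incl]. *)
Lemma section_average (Q : contraFunctor k) (phi : contraMap Q (shifted Q)) n
    (p : Q n) (ws : seq (seq V)) (m := size (flatten ws)) :
  (forall n p, con_map Q (incl n) (phi n p) = p) -> size ws = n.+1 ->
  (m`!%:R)^-1 *: \sum_(L <- perms m)
    ftpure (con_raw Q m n.+1 (rcons (reshape (shape ws) L) [:: m]) (phi n p))
      (tens m.+1 (placed_word (flatten ws) L) : M m) =
  ftpure p (tens n.+1 (map (@word k V) ws) : M n).
Proof.
move=> sphi sw; set z := ftpure p _.
rewrite (eq_big_seq (fun=> z)) => [|L].
  rewrite big_const_seq count_predT iter_addr_0 size_perms.
  by rewrite -scaler_nat scalerA mulVf ?fact_neq0 // scale1r.
rewrite mem_perms => hL.
have szL : size L = sumn (shape ws).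
  by rewrite (is_oneline_size hL) /m size_flatten.
have rX : is_raw m n.+1 (rcons (reshape (shape ws) L) [:: m]).
  rewrite /is_raw size_rcons size_reshape size_map sw eqxx flatten_rcons.
  by rewrite reshapeKr ?szL // -[m.+1]addn1 iotaD perm_cat2r.
rewrite (con_raw_mk _ rX) ftpure_bal (bsym_placed_word rX sw hL).
rewrite -(bsym_incl sw) -ftpure_bal sphi.
by [].
Qed.

Variable P : projResolution (const_functor k).

(** The pointwise identity d t + s d = 1 at the objects [m] is transported to the tensor product:
    [S'] and [S] are built from t and s, and satisfy d S' + S d = 1 after averaging. *)
Lemma free_hs_exact q (z : ftensor M (P q.+1)) :
  ftensor_map M (res_diff P q) z = 0 ->
  in_image (ftensor_map M (res_diff P q.+1)) z.
Proof.
have [phi [psi [sphi spsi lpsi]]] := shift_lift_pair P q.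
pose s n := sval (cid (contraction_pair P q n)).
pose t n := sval (cid (svalP (cid (contraction_pair P q n)))).
have st n p : res_diff P q.+1 n (t n p) + s n (res_diff P q n p) = p.
  exact: (svalP (cid (svalP (cid (contraction_pair P q n))))).
pose S := word_contraction V phi s; pose S' := word_contraction V psi t.
suff E y : ftensor_map M (res_diff P q.+1) (S' y) +
    S (ftensor_map M (res_diff P q) y) = y.
  move=> dz; exists (S' z); rewrite -[RHS]E dz linear0 addr0.
  by [].
have sub : subspace (fun y => ftensor_map M (res_diff P q.+1) (S' y) +
    S (ftensor_map M (res_diff P q) y) = y).
  by apply: eq_subspace => a u v //; rewrite !linearP scalerDr addrACA.
move: y; apply: ft_ind => // n p x.
move: x; apply: (@tpow_words_ind k V) => [|ws sw].
  exact (@subspace_ftpure k M (P q.+1) n p _ sub).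
rewrite ftensor_mapE /S /S' !(word_contractionE _ _ _ sw).
rewrite -[RHS](section_average p spsi sw) /contraction_gen /contraction_words.
rewrite linear_scale_sum -scalerDr -big_split; apply: (congr1 (fun u => _ *: u)).
apply: eq_bigr => L _; rewrite /contraction_term ftensor_mapE.
set X := rcons _ _; set m := size _.
(* Since phi d = d psi, and pullback along X commutes with d, both halves of the homotopy are
   evaluated at the same element, the pullback of psi p to [m]. *)
have phid : phi n (res_diff P q n p) = res_diff P q n.+1 (psi n p) by rewrite lpsi.
rewrite phid -(con_raw_natural (res_diff P q)).
rewrite -[in RHS](st m (con_raw (P q.+1) m n.+1 X (psi n p))).
exact: ftpure_addl.
Qed.
End FreeHS.

(** * Comparison *)

Section HSResolution.
Variables (k : fieldType) (A : unitalAlgebra k) (P : projResolution (const_functor k)).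

Definition hs_obj p q : lmodType k := ftensor (Bsym (res_alg A q)) (P p).

Definition hs_res_face p q (i : 'I_q.+2) : {linear hs_obj p q.+1 -> hs_obj p q} :=
  ft_covmap (P p) (bsym_cov (res_face A i)).

Definition hs_res_diff p q : {linear hs_obj p q.+1 -> hs_obj p q} :=
  face_diff (@hs_res_face p) q.

Definition hs_augment p : {linear hs_obj p 0 -> ftensor (Bsym A) (P p)} :=
  ft_covmap (P p) (bsym_cov (res_augment A)).

Definition hs_section p : contraMap (P p) (free_cover (P p)) :=
  sval (cid (cover_section (@res_projective k _ P p))).

Lemma hs_sectionK p n x : cover_counit (P p) n (hs_section p n x) = x.
Proof. by rewrite /hs_section; case: cid. Qed.

(** The tensor powers of the unit of T do not commute with the action of Delta S, since the unit is
    not multiplicative. Projectivity of P p still allows them to act on the tensor product. *)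
Definition hs_res_unit p q : {linear hs_obj p q -> hs_obj p q.+1} :=
  @flat_map k (Bsym (res_alg A q)) (Bsym (res_alg A q.+1)) (P p) (hs_section p)
    (fun n => tpow_map (T_unit (Tpow A q.+1)) n.+1).

Definition hs_aug_unit p : {linear ftensor (Bsym A) (P p) -> hs_obj p 0} :=
  @flat_map k (Bsym A) (Bsym (res_alg A 0)) (P p) (hs_section p)
    (fun n => tpow_map (T_unit (Tpow A 0)) n.+1).

Let unit0 p q x : hs_res_face p (ord0 : 'I_q.+2) (hs_res_unit p q x) = x.
Proof.
apply: (@flat_map_cancel k (Bsym (res_alg A q)) (Bsym (res_alg A q.+1)) (P p)
  (hs_section p) _ (bsym_cov (res_face A ord0))); first exact: hs_sectionK.
move=> n; apply: (@tpow_map_cancel k (res_alg A q) (res_alg A q.+1) n.+1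
  (res_face A ord0) (T_unit (Tpow A q.+1))) => y.
exact: res_face0_unit.
Qed.

Let unit1 p x : hs_res_face p (lift ord0 ord0 : 'I_2) (hs_res_unit p 0 x) =
  hs_aug_unit p (hs_augment p x).
Proof.
apply: (@flat_map_square k (Bsym (res_alg A 0)) (Bsym (res_alg A 1)) (Bsym A)
  (Bsym (res_alg A 0)) (P p) (hs_section p) _ _
  (bsym_cov (res_face A (lift ord0 ord0))) (bsym_cov (res_augment A))) => n.
apply: (@tpow_map_square k (res_alg A 0) (res_alg A 1) A (res_alg A 0) n.+1
  (res_face A (lift ord0 ord0)) (T_unit (Tpow A 1)) (T_unit (Tpow A 0)) (res_augment A)) => y.
exact: res_face1_unit.
Qed.

Let unitS p q (i : 'I_q.+2) x :
  hs_res_face p (lift ord0 i) (hs_res_unit p q.+1 x) =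
  hs_res_unit p q (hs_res_face p i x).
Proof.
apply: (@flat_map_square k (Bsym (res_alg A q.+1)) (Bsym (res_alg A q.+2))
  (Bsym (res_alg A q)) (Bsym (res_alg A q.+1)) (P p) (hs_section p) _ _
  (bsym_cov (res_face A (lift ord0 i))) (bsym_cov (res_face A i))) => n.
apply: (@tpow_map_square k (res_alg A q.+1) (res_alg A q.+2) (res_alg A q)
  (res_alg A q.+1) n.+1 (res_face A (lift ord0 i)) (T_unit (Tpow A q.+2))
  (T_unit (Tpow A q.+1)) (res_face A i)) => y.
exact: res_faceS_unit.
Qed.

Let unitA p x : hs_augment p (hs_aug_unit p x) = x.
Proof.
apply: (@flat_map_cancel k (Bsym A) (Bsym (res_alg A 0)) (P p) (hs_section p) _
  (bsym_cov (res_augment A))); first exact: hs_sectionK.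
move=> n; apply: (@tpow_map_cancel k A (res_alg A 0) n.+1 (res_augment A)
  (T_unit (Tpow A 0))) => y.
exact: res_augment_unit.
Qed.

Lemma hs_res_diff_sqr p q x : hs_res_diff p q (hs_res_diff p q.+1 x) = 0.
Proof.
apply: (@face_diff_sqr k (hs_obj p) (@hs_res_face p)) => {}q i j {}x ij.
apply: ft_covmap_square => n.
apply: (@tpow_map_square k (res_alg A q.+2) (res_alg A q.+1) (res_alg A q.+1)
  (res_alg A q) n.+1 (res_face A (inord i)) (res_face A (inord j.+1))
  (res_face A (inord j)) (res_face A (inord i))) => y.
exact: res_faceC.
Qed.

Lemma hs_augment_diff p x : hs_augment p (hs_res_diff p 0 x) = 0.
Proof.
apply: etrans (congr1 (hs_augment p) (@face_diff0E k (hs_obj p) (@hs_res_face p) x)) _.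
rewrite linearB; apply/eqP; rewrite subr_eq0; apply/eqP.
apply: ft_covmap_square => n.
apply: (@tpow_map_square k (res_alg A 1) (res_alg A 0) (res_alg A 0) A n.+1
  (res_augment A) (res_face A ord0) (res_augment A) (res_face A (lift ord0 ord0))).
exact: res_augment_face.
Qed.

Lemma ftensor_diff_sqr (F : covFunctor k) p (z : ftensor F (P p.+2)) :
  ftensor_map F (res_diff P p) (ftensor_map F (res_diff P p.+1) z) = 0.
Proof.
move: z; apply: ft_ind => [|n y x].
  by apply: eq_subspace => a u v; rewrite ?linearP // scaler0 addr0.
by rewrite !ftensor_mapE res_diff_sqr ftpure_0l.
Qed.

Lemma hs_to_ab_natural (B C : unitalAlgebra k) (f : algHom B C)
    (z : ftensor (Bsym B) (P 0)) :
  ab_map f (hs_to_ab B P z) = hs_to_ab C P (ft_covmap (P 0) (bsym_cov f) z).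
Proof.
move: z; apply: ft_ind => [|n p x].
  by apply: eq_subspace => a u v; rewrite ?linearP.
rewrite ft_covmapE !hs_to_abE linearZ; apply: (congr1 (fun u => _ *: u)).
move: x; apply: tpow_ind => [|t].
  by apply: eq_subspace => a u v; rewrite ?linearP.
rewrite tpow_mapE !total_prodE; apply: etrans (ab_mapE f _) _.
by rewrite alg_hom_prod.
Qed.

Lemma HS_ab (char0 : [pchar k] =i pred0) n :
  exists F : {linear HS A P n -> homology (@ab_diff k A) n}, bijective F.
Proof.
apply: (@double_complex_iso k hs_obj
  (fun p q => ftensor_map (Bsym (res_alg A q)) (res_diff P p)) hs_res_diff
  (fun p => ftensor (Bsym A) (P p)) (ab_complex A)
  (fun p => ftensor_map (Bsym A) (res_diff P p)) (@ab_diff k A) hs_augment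
  (fun q => hs_to_ab (res_alg A q) P)).
- move=> p q x; apply/esym.
  apply: (@alternating_sum_natural k _ _ _ _ _
    (@hs_res_face p.+1 q) (@hs_res_face p q)
    (ftensor_map (Bsym (res_alg A q.+1)) (res_diff P p))
    (ftensor_map (Bsym (res_alg A q)) (res_diff P p))) => i y.
  exact/esym/ft_covmap_nat.
- by move=> p x; apply: ft_covmap_nat.
- move=> q x.
  apply: (@alternating_sum_natural k _ _ _ _ _
    (@hs_res_face 0 q) (fun i => ab_map (res_face A i))
    (hs_to_ab (res_alg A q.+1) P) (hs_to_ab (res_alg A q) P)) => i y.
  exact: hs_to_ab_natural.
- by move=> p q x; apply: ftensor_diff_sqr.
- by move=> q x; apply: hs_to_ab_diff.
- by move=> p q x; apply: hs_res_diff_sqr.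
- by move=> p x; apply: hs_augment_diff.
- by move=> p y; exists (hs_aug_unit p y); apply: unitA.
- move=> p x; exact: (@extra_degeneracy_exact0 k (hs_obj p) (@hs_res_face p) _
    (hs_augment p) (hs_aug_unit p) (hs_res_unit p) (@unit0 p) (@unit1 p)).
- move=> p q x; exact: (@extra_degeneracy_exactS k (hs_obj p) (@hs_res_face p)
    (hs_res_unit p) (@unit0 p) (@unitS p)).
- by move=> q y; apply: hs_to_ab_onto.
- by move=> q x; apply: hs_to_ab_exact.
- by move=> p q x; apply: free_hs_exact.
Qed.
End HSResolution.

Lemma bijective_linear_inverse (k : fieldType) (V W : lmodType k)
    (f : {linear V -> W}) :
  bijective f -> exists g : {linear W -> V}, bijective g.
Proof.
case=> g fK gK; have lg : linear g := can2_linear fK gK.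
pose h : {linear W -> V} := HB.pack g (GRing.isLinear.Build k W V _ g lg).
by exists h; exists f.
Qed.

Theorem corollary1p2 (k : fieldType) (char0 : [pchar k] =i pred0)
    (A : unitalAlgebra k) (P : projResolution (const_functor k)) :
  forall n : nat,
    exists f : {linear HS A P n -> bar_homology A n}, bijective f.
Proof.
move=> n; have [f fb] := HS_ab A P char0 n.
have [g gb] := bar_homology_ab A char0 n.
have [h hb] := bijective_linear_inverse gb.
by exists (h \o f); apply: bij_comp.
Qed.
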